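(* For every real number $t \geq 3$, one has $$|\zeta(1+it)| \leq \tfrac{3}{4}\log t,$$ where $\zeta$ denotes the Riemann zeta-function.
   Context: $\zeta(s)$ is the Riemann zeta-function, defined by $\zeta(s)=\sum_{n\geq 1} n^{-s}$ for $\Re(s)>1$ and by analytic continuation elsewhere on $\mathbb{C}\setminus\{1\}$; $\log$ is the natural logarithm. *)

(* Defs.v *)
(* Stdlib world: the classical reals R with Coquelicot's complex numbers C. *)
From Stdlib Require Import Reals.
From Coquelicot Require Import Coquelicot.

Open Scope R_scope.

Definition Cexp (z : C) : C :=
  (exp (Re z) * cos (Im z), exp (Re z) * sin (Im z)).

(* Principal branch n^s = exp (s log n); used only for n >= 1, since [ln 0]
   is a junk value. *)
Definition nat_Cpow (n : nat) (s : C) : C := Cexp (s * RtoC (ln (INR n)))%C.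

(* Differentiability is over the field C (so complex differentiability), and
   the Dirichlet series is indexed from 0, hence the shift [S n].  By the
   identity theorem on the connected open set C \ {1}, at most one function
   satisfies this predicate up to its value at the pole 1, which is left
   unconstrained. *)
Definition is_riemann_zeta (zeta : C -> C) : Prop :=
  (forall s : C, 1 < Re s ->
     @is_series C_AbsRing C_NormedModule
       (fun n : nat => nat_Cpow (S n) (- s)%C) (zeta s)) /\
  (forall s : C, s <> RtoC 1 -> @ex_derive C_AbsRing C_NormedModule zeta s).

(* Main.v *)
(* By continuity at [1 + i t], zeta there is a limit from the half-plane of absolute convergence, so the
   trapezoidal rule on the tail of the Dirichlet series (Euler-Maclaurin) compares [zeta (1 + i t)] with
   the partial sums of [n ^ (- 1 - i t)].  The phase increments [t * ln (1 + 1 / n)] decrease in [n].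
   Where they stay away from the multiples of [2 pi], the Kuzmin-Landau inequality bounds the sum; the
   short blocks near each multiple are bounded trivially.  Taking about [t ^ (1 / 4)] multiples of
   [2 pi] leaves about [t ^ (3 / 4)] terms, whose harmonic sum gives [3 / 4 * ln t] with room to spare for
   [t >= 2000].  For [3 <= t <= 2000] the remaining short sum is instead evaluated on a grid in verified
   fixed-point arithmetic, and linear interpolation with a second-derivative bound covers the points in
   between. *)
Require Import Defs.
From Stdlib Require Import Reals Lra Lia Psatz ZArith List Bool Machin.
From Coquelicot Require Import Coquelicot.
Open Scope R_scope.

(** * Euler-Maclaurin summation on the line Re s = 1 *)

(** Write [q = t ^ (1 / 4)] and let [phi] be the distance kept from each multiple of [2 pi]. The
    block near [2 pi j] costs about [phi / (pi j)], and the Kuzmin-Landau blocks with index up to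
    [K] cost together about [4 pi K ^ 2 / (phi t)]. With [K] of order [q] and [phi] of order [1 / q]
    both totals tend to zero, so they only have to stay below the constant saved by the trivially
    summed part, about [ln (13 / 3) - 581 / 1000]. This is checked for [q >= 9]; below that, [K] and
    [phi] are fixed range by range. Mean-value arguments fail for complex-valued functions. Hence
    moduli are bounded through all real projections [a * Re z + b * Im z] with [a * a + b * b <= 1];
    since [(- a, - b)] is also allowed, one-sided real estimates suffice. On the grid no sine or
    cosine is evaluated: a table of [n ^ (- i / 8)] yields the starting values and the rotation
    factors by powering, and each step is one multiplication per term. Rounding errors are carried
    as a quality factor that multiplies along with the numbers. *)

Lemma one_le_INR (n : nat) : (1 <= n)%nat -> 1 <= INR n.
Proof. intros Hn. change 1 with (INR 1). apply le_INR; auto. Qed.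

Lemma two_le_INR (n : nat) : (2 <= n)%nat -> 2 <= INR n.
Proof. intros Hn. change 2 with (INR 2). apply le_INR; auto. Qed.

(** The projection onto the direction of [z] itself, [(a, b) = z / |z|], already equals the
    modulus. *)
Lemma Cmod_le_of_proj (z : C) (B : R) :
  (forall a b, a * a + b * b <= 1 -> a * Re z + b * Im z <= B) -> Cmod z <= B.
Proof.
  intros H. destruct z as [x y]; unfold Re, Im in H; simpl in H.
  destruct (Req_dec (Cmod (x, y)) 0) as [E | E].
  - rewrite E. specialize (H 0 0). lra.
  - pose proof (Cmod_ge_0 (x, y)) as Hp.
    assert (Hs : Cmod (x, y) * Cmod (x, y) = x * x + y * y).
    { unfold Cmod; simpl. rewrite sqrt_sqrt; nra. }
    specialize (H (x / Cmod (x, y)) (y / Cmod (x, y))).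
    set (m := Cmod (x, y)) in *.
    assert (Hone : x / m * (x / m) + y / m * (y / m) = 1).
    { transitivity ((x * x + y * y) / (m * m)); [field; auto | rewrite <- Hs; field; auto]. }
    assert (Hval : x / m * x + y / m * y = m).
    { transitivity ((x * x + y * y) / m); [field; auto | rewrite <- Hs; field; auto]. }
    lra.
Qed.

Lemma proj_le_Cmod (z : C) (a b : R) :
  a * a + b * b <= 1 -> a * Re z + b * Im z <= Cmod z.
Proof.
  intros H. destruct z as [x y]; unfold Re, Im; simpl.
  unfold Cmod; simpl. apply Rle_trans with (Rabs (a * x + b * y)); [apply Rle_abs |].
  rewrite <- sqrt_Rsqr_abs. apply sqrt_le_1_alt. unfold Rsqr.
  pose proof (Rle_0_sqr (a * y - b * x)) as H1; unfold Rsqr in H1.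
  pose proof (Rle_0_sqr x) as H2; pose proof (Rle_0_sqr y) as H3; unfold Rsqr in H2, H3.
  assert (H4 : 0 <= (1 - (a * a + b * b)) * (x * x + y * y)) by (apply Rmult_le_pos; lra).
  simpl; lra.
Qed.

Lemma nonneg_derive_le (f df : R -> R) (a b : R) :
  a <= b ->
  (forall x, a <= x <= b -> is_derive f x (df x)) ->
  (forall x, a <= x <= b -> 0 <= df x) ->
  f a <= f b.
Proof.
  intros Hab Hd Hp.
  destruct (MVT_gen f a b df) as [c [Hc E]].
  - intros x; rewrite Rmin_left, Rmax_right by lra. intros; apply Hd; lra.
  - intros x; rewrite Rmin_left, Rmax_right by lra. intros Hx.
    apply derivable_continuous_pt. exists (df x). apply is_derive_Reals. apply Hd; lra.
  - rewrite Rmin_left, Rmax_right in Hc by lra.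
    specialize (Hp c Hc). nra.
Qed.

(** The trapezoid error, as a function of the step length, vanishes to second order at 0, and the
    derivative of its derivative [D1] is [- y / 2 * f2]. Two monotonicity comparisons with multiples
    of [y ^ 2] and [y ^ 3] give the bound. Only a lower bound on [f2] enters, because the result is
    applied to every projection direction. *)
Lemma trapezoid_le (F f f1 f2 : R -> R) (x h K : R) :
  0 <= h ->
  (forall y, x <= y <= x + h -> is_derive F y (f y)) ->
  (forall y, x <= y <= x + h -> is_derive f y (f1 y)) ->
  (forall y, x <= y <= x + h -> is_derive f1 y (f2 y)) ->
  (forall y, x <= y <= x + h -> - K <= f2 y) ->
  F (x + h) - F x - h / 2 * (f x + f (x + h)) <= K * h ^ 3 / 12.
Proof.
  intros Hh HF Hf Hf1 HK.
  assert (shift : forall (g dg : R -> R), (forall y, x <= y <= x + h -> is_derive g y (dg y)) ->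
     forall y, 0 <= y <= h -> is_derive (fun y => g (x + y)) y (dg (x + y))).
  { intros g dg Hg y Hy.
    replace (dg (x + y)) with (1 * dg (x + y)) by ring.
    apply (is_derive_comp g (fun y => x + y)).
    - apply Hg; lra.
    - auto_derive; auto. }
  pose proof (shift _ _ HF) as HF'; pose proof (shift _ _ Hf) as Hf'; pose proof (shift _ _ Hf1) as Hf1'.
  (* [D1] is the derivative of the trapezoid error with respect to the step length. *)
  set (D1 := fun y => (f (x + y) - f x) / 2 - y / 2 * f1 (x + y)).
  assert (H1 : forall y, 0 <= y <= h -> D1 y <= K * y ^ 2 / 4).
  { intros y Hy.
    enough (H : 0 * 0 * K / 4 - D1 0 <= y * y * K / 4 - D1 y).
    { unfold D1 at 1 in H. rewrite Rplus_0_r in H. simpl. lra. }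
    apply (nonneg_derive_le (fun y => y * y * K / 4 - D1 y)
             (fun y => y * K / 2 - (f1 (x + y) / 2 - (f1 (x + y) / 2 + y / 2 * f2 (x + y))))); [lra | |].
    - intros z Hz. apply (is_derive_minus (fun y => y * y * K / 4) D1).
      + auto_derive; auto. field.
      + unfold D1. apply (is_derive_minus (fun y => (f (x + y) - f x) / 2) (fun y => y / 2 * f1 (x + y))).
        * apply (is_derive_ext (fun y => / 2 * (f (x + y) - f x))); [intros; simpl; lra |].
          replace (f1 (x + z) / 2) with (/ 2 * (f1 (x + z) - 0)) by lra.
          apply (is_derive_scal (fun y => f (x + y) - f x)).
          apply (is_derive_minus (fun y => f (x + y)) (fun _ => f x)); [apply Hf'; lra | auto_derive; auto].
        * replace (f1 (x + z) / 2) with (/ 2 * f1 (x + z)) by lra.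
          apply (is_derive_mult (fun y => y / 2) (fun y => f1 (x + y))).
          -- auto_derive; auto. lra.
          -- apply Hf1'; lra.
          -- intros; apply Rmult_comm.
    - intros z Hz. specialize (HK (x + z)). nra. }
  enough (H : 0 * 0 * 0 * K / 12 - (F (x + 0) - F x - 0 / 2 * (f x + f (x + 0)))
      <= h * h * h * K / 12 - (F (x + h) - F x - h / 2 * (f x + f (x + h)))).
  { rewrite Rplus_0_r in H. simpl. lra. }
  apply (nonneg_derive_le (fun h => h * h * h * K / 12 - (F (x + h) - F x - h / 2 * (f x + f (x + h))))
     (fun y => y * y * K / 4 - (f (x + y) - 0 - (/ 2 * (f x + f (x + y)) + y / 2 * f1 (x + y))))); [lra | |].
  - intros z Hz.
    apply (is_derive_minus (fun h => h * h * h * K / 12) (fun h => F (x + h) - F x - h / 2 * (f x + f (x + h)))).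
    + auto_derive; auto. field.
    + apply (is_derive_minus (fun h => F (x + h) - F x) (fun h => h / 2 * (f x + f (x + h)))).
      * apply (is_derive_minus (fun h => F (x + h)) (fun _ => F x)); [apply HF'; lra | auto_derive; auto].
      * apply (is_derive_mult (fun h => h / 2) (fun h => f x + f (x + h))).
        -- auto_derive; auto. lra.
        -- replace (f1 (x + z)) with (0 + f1 (x + z)) by ring.
           apply (is_derive_plus (fun _ => f x) (fun h => f (x + h))); [auto_derive; auto | apply Hf'; lra].
        -- intros; apply Rmult_comm.
  - intros z Hz. specialize (H1 z Hz). unfold D1 in H1. simpl in H1. lra.
Qed.

(* For real [c, d], this is the form of [c * Re z + d * Im z] with [z = x ^ (- sigma - i t)]; the family
   is closed under differentiation in [x]. *)
Definition pw (a b sigma t x : R) : R :=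
  exp (- sigma * ln x) * (a * cos (t * ln x) + b * sin (t * ln x)).

Lemma pw_derive (a b sigma t x : R) :
  0 < x ->
  is_derive (pw a b sigma t) x
    (pw (t * b - sigma * a) (- (t * a) - sigma * b) (sigma + 1) t x).
Proof.
  intros Hx. unfold pw. auto_derive; [auto |].
  replace (- (sigma + 1) * ln x) with (- sigma * ln x + - ln x) by ring.
  rewrite exp_plus, exp_Ropp, exp_ln by auto. field. lra.
Qed.

Lemma pw_lower (a b r sigma t x : R) :
  0 <= r -> a * a + b * b <= r * r -> - (r * exp (- sigma * ln x)) <= pw a b sigma t x.
Proof.
  intros Hr Hab. unfold pw.
  set (c := cos (t * ln x)) in *; set (s := sin (t * ln x)) in *.
  assert (Hcs : c * c + s * s = 1).
  { pose proof (sin2_cos2 (t * ln x)) as H. unfold Rsqr in H. unfold c, s. lra. }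
  clearbody c s.
  pose proof (exp_pos (- sigma * ln x)) as He.
  assert (- r <= a * c + b * s).
  { pose proof (Rle_0_sqr (a * s - b * c)) as H0; unfold Rsqr in H0.
    assert ((a * c + b * s) * (a * c + b * s) + (a * s - b * c) * (a * s - b * c) = a * a + b * b)
      by (transitivity ((a * a + b * b) * (c * c + s * s)); [ring | rewrite Hcs; ring]).
    apply Rnot_lt_le; intros Hlt. nra. }
  nra.
Qed.

Lemma pw_opp (a b sigma t x : R) : pw (- a) (- b) sigma t x = - pw a b sigma t x.
Proof. unfold pw; ring. Qed.

Fixpoint rsum (f : nat -> R) (m len : nat) : R :=
  match len with O => 0 | S k => f m + rsum f (S m) k end.

Fixpoint csum (f : nat -> C) (m len : nat) : C :=
  match len with O => 0%C | S k => (f m + csum f (S m) k)%C end.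

Lemma rsum_S (f : nat -> R) (m len : nat) :
  rsum f m (S len) = rsum f m len + f (m + len)%nat.
Proof.
  revert m; induction len as [| len IH]; intros m.
  - simpl. rewrite Nat.add_0_r. ring.
  - change (rsum f m (S (S len))) with (f m + rsum f (S m) (S len)).
    rewrite IH. simpl. rewrite Nat.add_succ_r. ring.
Qed.

Lemma csum_app (f : nat -> C) (m k l : nat) :
  csum f m (k + l) = (csum f m k + csum f (m + k) l)%C.
Proof.
  revert m; induction k as [| k IH]; intros m; simpl.
  - rewrite Nat.add_0_r. ring.
  - rewrite IH, Nat.add_succ_r. simpl. ring.
Qed.

Lemma csum_S (f : nat -> C) (m len : nat) :
  csum f m (S len) = (csum f m len + f (m + len)%nat)%C.
Proof.
  replace (S len) with (len + 1)%nat by lia. rewrite csum_app; simpl. ring.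
Qed.

Lemma csum_ext (f g : nat -> C) (m len : nat) :
  (forall n, (m <= n < m + len)%nat -> f n = g n) -> csum f m len = csum g m len.
Proof.
  revert m; induction len as [| len IH]; intros m H; simpl; auto.
  rewrite H by lia. f_equal. apply IH. intros; apply H; lia.
Qed.

Lemma csum_proj (f : nat -> C) (a b : R) (m len : nat) :
  a * Re (csum f m len) + b * Im (csum f m len)
    = rsum (fun n => a * Re (f n) + b * Im (f n)) m len.
Proof.
  revert m; induction len as [| len IH]; intros m; simpl.
  - ring.
  - rewrite <- IH. unfold Re, Im; simpl; ring.
Qed.

Lemma csum_le (f : nat -> C) (g : nat -> R) (m len : nat) :
  (forall n, (m <= n < m + len)%nat -> Cmod (f n) <= g n) ->
  Cmod (csum f m len) <= rsum g m len.
Proof.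
  revert m; induction len as [| len IH]; intros m H; simpl.
  - rewrite Cmod_0. lra.
  - eapply Rle_trans; [apply Cmod_triangle |].
    apply Rplus_le_compat; [apply H; lia | apply IH; intros; apply H; lia].
Qed.

Lemma rsum_le (f g : nat -> R) (m len : nat) :
  (forall n, (m <= n < m + len)%nat -> f n <= g n) ->
  rsum f m len <= rsum g m len.
Proof.
  revert m; induction len as [| len IH]; intros m H; simpl.
  - lra.
  - apply Rplus_le_compat; [apply H; lia | apply IH; intros; apply H; lia].
Qed.

Lemma rsum_ext (f g : nat -> R) (m len : nat) :
  (forall n, (m <= n < m + len)%nat -> f n = g n) -> rsum f m len = rsum g m len.
Proof.
  intros H; apply Rle_antisym; apply rsum_le; intros n Hn; rewrite H; auto; lra.
Qed.

(* Corresponds to the primitive [x ^ (1 - s) / (1 - s)] of [x ^ (- s)]. *)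
Definition pw_prim (a b sigma t x : R) : R :=
  pw ((- (sigma - 1) * a - t * b) / ((sigma - 1) * (sigma - 1) + t * t))
     ((t * a - (sigma - 1) * b) / ((sigma - 1) * (sigma - 1) + t * t)) (sigma - 1) t x.

Lemma pw_prim_derive (a b sigma t x : R) :
  0 < x -> 0 < t -> is_derive (pw_prim a b sigma t) x (pw a b sigma t x).
Proof.
  intros Hx Ht. unfold pw_prim.
  evar_last; [apply pw_derive; auto |].
  replace (sigma - 1 + 1) with sigma by ring.
  assert (0 < (sigma - 1) * (sigma - 1) + t * t).
  { pose proof (Rle_0_sqr (sigma - 1)) as H; unfold Rsqr in H. pose proof (Rmult_lt_0_compat t t Ht Ht). lra. }
  f_equal; field; lra.
Qed.

(** Projection of the Euler-Maclaurin approximation with cut-off [N]. For [sigma > 1] the term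
    [- pw_prim] is the integral of the summand over [[N, oo)]; unlike that integral it still makes
    sense at [sigma = 1]. *)
Definition em_sum (a b sigma t : R) (N : nat) : R :=
  rsum (fun n => pw a b sigma t (INR n)) 1 (N - 1) + / 2 * pw a b sigma t (INR N)
  - pw_prim a b sigma t (INR N).

(** This is [|s (s + 1)|] for [s = sigma + i t], the factor in the second derivative of
    [x ^ (- s)]. *)
Definition em_const (sigma t : R) : R :=
  sqrt ((sigma * sigma + t * t) * ((sigma + 1) * (sigma + 1) + t * t)).

Lemma em_const_sqr (sigma t : R) :
  em_const sigma t * em_const sigma t
    = (sigma * sigma + t * t) * ((sigma + 1) * (sigma + 1) + t * t).
Proof.
  unfold em_const. apply sqrt_sqrt.
  pose proof (Rle_0_sqr sigma) as H1; pose proof (Rle_0_sqr (sigma + 1)) as H2;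
    pose proof (Rle_0_sqr t) as H3; unfold Rsqr in *.
  apply Rmult_le_pos; lra.
Qed.

Lemma exp_opp_mul_ln_le (sigma : R) (n : nat) (k : nat) (y : R) :
  INR k <= sigma -> 1 <= INR n <= y -> exp (- sigma * ln y) <= / INR n ^ k.
Proof.
  intros Hs Hn.
  rewrite <- (exp_ln (INR n ^ k)) by (apply pow_lt; lra).
  rewrite <- exp_Ropp.
  assert (Hln : ln (INR n) <= ln y).
  { destruct (Req_dec (INR n) y) as [-> | E]; [lra |]. left; apply ln_increasing; lra. }
  assert (H0 : 0 <= ln (INR n)).
  { rewrite <- ln_1. destruct (Req_dec 1 (INR n)) as [<- | E]; [lra |]. left; apply ln_increasing; lra. }
  rewrite ln_pow by lra.
  assert (- sigma * ln y <= - (INR k * ln (INR n))).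
  { pose proof (pos_INR k). nra. }
  destruct (Req_dec (- sigma * ln y) (- (INR k * ln (INR n)))) as [-> | E]; [lra |].
  left; apply exp_increasing; lra.
Qed.

(** The difference is exactly the trapezoid error on [[N, N + 1]], where the second derivative is at
    most [em_const sigma t * x ^ (- sigma - 2)], hence at most [em_const sigma t / N ^ 3]. *)
Lemma em_step (a b sigma t : R) (N : nat) :
  a * a + b * b <= 1 -> 1 <= sigma -> 0 < t -> (1 <= N)%nat ->
  em_sum a b sigma t N - em_sum a b sigma t (S N) <= em_const sigma t / 12 / INR N ^ 3.
Proof.
  intros Hab Hs Ht HN.
  assert (HN1 : 1 <= INR N) by (apply one_le_INR; auto).
  pose proof (trapezoid_le (pw_prim a b sigma t) (pw a b sigma t)
    (pw (t * b - sigma * a) (- (t * a) - sigma * b) (sigma + 1) t)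
    (pw (t * (- (t * a) - sigma * b) - (sigma + 1) * (t * b - sigma * a))
        (- (t * (t * b - sigma * a)) - (sigma + 1) * (- (t * a) - sigma * b)) (sigma + 1 + 1) t)
    (INR N) 1 (em_const sigma t / INR N ^ 3)) as H.
  assert (Hc0 : 0 <= em_const sigma t) by apply sqrt_pos.
  assert (HH : pw_prim a b sigma t (INR N + 1) - pw_prim a b sigma t (INR N)
      - 1 / 2 * (pw a b sigma t (INR N) + pw a b sigma t (INR N + 1))
      <= em_const sigma t / INR N ^ 3 * 1 ^ 3 / 12).
  { apply H; [lra | | | |]; intros y Hy.
    - apply pw_prim_derive; lra.
    - apply pw_derive; lra.
    - apply pw_derive; lra.
    - eapply Rle_trans; [| apply (pw_lower _ _ (em_const sigma t))]; auto.
      + apply Ropp_le_contravar. apply Rmult_le_compat_l; auto.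
        apply exp_opp_mul_ln_le; [simpl; lra | lra].
      + rewrite em_const_sqr.
        apply Rle_trans with ((sigma * sigma + t * t) * ((sigma + 1) * (sigma + 1) + t * t) * (a * a + b * b));
          [right; ring |].
        rewrite <- (Rmult_1_r ((sigma * sigma + t * t) * ((sigma + 1) * (sigma + 1) + t * t))) at 2.
        apply Rmult_le_compat_l; auto. apply Rmult_le_pos; nra. }
  unfold em_sum.
  replace (S N - 1)%nat with (S (N - 1)) by lia.
  rewrite rsum_S. replace (1 + (N - 1))%nat with N by lia.
  rewrite S_INR.
  replace (em_const sigma t / 12 / INR N ^ 3) with (em_const sigma t / INR N ^ 3 * 1 ^ 3 / 12)
    by (field; lra).
  lra.
Qed.

Lemma em_le (a b sigma t : R) (N k : nat) :
  a * a + b * b <= 1 -> 1 <= sigma -> 0 < t -> (2 <= N)%nat ->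
  em_sum a b sigma t N - em_sum a b sigma t (N + k)
    <= em_const sigma t / 24 * (/ (INR N * (INR N - 1)) - / (INR (N + k) * (INR (N + k) - 1))).
Proof.
  intros Hab Hs Ht HN.
  induction k as [| k IH].
  - rewrite Nat.add_0_r. lra.
  - rewrite Nat.add_succ_r.
    pose proof (em_step a b sigma t (N + k) Hab Hs Ht ltac:(lia)) as H.
    assert (Hn : 2 <= INR (N + k)) by (apply two_le_INR; lia).
    rewrite S_INR. set (x := INR (N + k)) in *. clearbody x.
    assert (Hc0 : 0 <= em_const sigma t) by apply sqrt_pos.
    enough (em_const sigma t / 12 / x ^ 3
       <= em_const sigma t / 24 * (/ (x * (x - 1)) - / ((x + 1) * (x + 1 - 1)))) by lra.
    (* The steps telescope after enlarging [1 / x ^ 3] to [1 / (x (x ^ 2 - 1))], which is half of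
       this difference; the denominators force [N >= 2]. *)
    replace (/ (x * (x - 1)) - / ((x + 1) * (x + 1 - 1))) with (2 / (x * (x * x - 1))) by (field; nra).
    replace (em_const sigma t / 24 * (2 / (x * (x * x - 1))))
      with (em_const sigma t / 12 * / (x * (x * x - 1))) by (field; nra).
    apply Rmult_le_compat_l; [lra |].
    apply Rinv_le_contravar; [| simpl; nra].
    apply Rmult_lt_0_compat; nra.
Qed.

Lemma nat_Cpow_proj (a b sigma t : R) (n : nat) :
  a * Re (nat_Cpow n (- (sigma, t))%C) + b * Im (nat_Cpow n (- (sigma, t))%C)
    = pw a (- b) sigma t (INR n).
Proof.
  unfold nat_Cpow, Cexp, pw, Re, Im; simpl.
  replace (- sigma * ln (INR n) - - t * 0) with (- sigma * ln (INR n)) by ring.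
  replace (- sigma * 0 + - t * ln (INR n)) with (- (t * ln (INR n))) by ring.
  rewrite cos_neg, sin_neg. ring.
Qed.

Lemma is_lim_seq_exp_ln (c : R) : 0 < c -> is_lim_seq (fun n => exp (- c * ln (INR (S n)))) 0.
Proof.
  intros Hc.
  apply (is_lim_comp_seq exp (fun n => - c * ln (INR (S n))) m_infty 0).
  - apply is_lim_exp_m.
  - exists O; intros n _; discriminate.
  - replace m_infty with (Rbar_mult (- c) p_infty).
    + apply is_lim_seq_scal_l.
      apply (is_lim_comp_seq ln (fun n => INR (S n)) p_infty p_infty).
      * apply is_lim_ln_p.
      * exists O; intros n _; discriminate.
      * apply -> is_lim_seq_incr_1. apply is_lim_seq_INR.
    + unfold Rbar_mult, Rbar_mult'. destruct (Rle_dec 0 (- c)); [exfalso; lra | reflexivity].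
Qed.

Lemma is_lim_seq_pw (a b sigma t : R) :
  0 < sigma -> is_lim_seq (fun n => pw a b sigma t (INR (S n))) 0.
Proof.
  intros Hs.
  set (r := Rabs a + Rabs b).
  assert (Hr : 0 <= r) by (unfold r; pose proof (Rabs_pos a); pose proof (Rabs_pos b); lra).
  assert (Hab : a * a + b * b <= r * r).
  { unfold r.
    pose proof (Rabs_pos a); pose proof (Rabs_pos b).
    assert (Ha : a * a = Rabs a * Rabs a) by (rewrite <- Rabs_mult, Rabs_pos_eq; [auto | apply Rle_0_sqr]).
    assert (Hb : b * b = Rabs b * Rabs b) by (rewrite <- Rabs_mult, Rabs_pos_eq; [auto | apply Rle_0_sqr]).
    rewrite Ha, Hb. nra. }
  apply (is_lim_seq_le_le (fun n => - r * exp (- sigma * ln (INR (S n)))) _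
                          (fun n => r * exp (- sigma * ln (INR (S n))))).
  - intros n. split.
    + pose proof (pw_lower a b r sigma t (INR (S n)) Hr Hab). lra.
    + pose proof (pw_lower (- a) (- b) r sigma t (INR (S n)) Hr ltac:(lra)) as H.
      rewrite pw_opp in H. lra.
  - replace (Finite 0) with (Rbar_mult (- r) 0) by (simpl; f_equal; ring).
    apply is_lim_seq_scal_l. apply is_lim_seq_exp_ln; auto.
  - replace (Finite 0) with (Rbar_mult r 0) by (simpl; f_equal; ring).
    apply is_lim_seq_scal_l. apply is_lim_seq_exp_ln; auto.
Qed.

Lemma is_series_proj (u : nat -> C) (l : C) (a b : R) :
  @is_series C_AbsRing C_NormedModule u l ->
  is_lim_seq (fun n => rsum (fun k => a * Re (u (k - 1)%nat) + b * Im (u (k - 1)%nat)) 1 n)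
             (a * Re l + b * Im l).
Proof.
  intros H.
  assert (Hsum : forall n, sum_n u n = csum (fun k => u (k - 1)%nat) 1 (S n)).
  { induction n as [| n IH].
    - rewrite sum_O. simpl. rewrite Cplus_0_r. reflexivity.
    - rewrite sum_Sn, csum_S, <- IH. replace (1 + S n - 1)%nat with (S n) by lia. reflexivity. }
  apply is_lim_seq_incr_1.
  apply (is_lim_seq_ext (fun n => a * Re (sum_n u n) + b * Im (sum_n u n))).
  { intros n. rewrite Hsum. apply csum_proj. }
  assert (Hfst : is_lim_seq (fun n => Re (sum_n u n)) (Re l)).
  { apply is_lim_seq_spec. intros eps.
    assert (He : locally l (ball l eps)) by (exists eps; auto).
    destruct (H _ He) as [N HN]. exists N. intros n Hn. apply (HN n Hn). }
  assert (Hsnd : is_lim_seq (fun n => Im (sum_n u n)) (Im l)).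
  { apply is_lim_seq_spec. intros eps.
    assert (He : locally l (ball l eps)) by (exists eps; auto).
    destruct (H _ He) as [N HN]. exists N. intros n Hn. apply (HN n Hn). }
  apply (is_lim_seq_plus _ _ (a * Re l) (b * Im l)); [| | reflexivity].
  - apply (is_lim_seq_scal_l _ a (Re l)); auto.
  - apply (is_lim_seq_scal_l _ b (Im l)); auto.
Qed.

(** Let the second cut-off in [em_le] tend to infinity: for [sigma > 1] the half term and the
    primitive vanish and the sum converges to the Dirichlet series. The sign of [b] flips because
    [pw] carries [+ sin] while [n ^ (- i t)] carries [- sin]. *)
Lemma em_zeta_right (zeta : C -> C) (a b sigma t : R) (N : nat) :
  is_riemann_zeta zeta -> a * a + b * b <= 1 -> 1 < sigma -> 0 < t -> (2 <= N)%nat ->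
  em_sum a b sigma t N - (a * Re (zeta (sigma, t)) - b * Im (zeta (sigma, t)))
    <= em_const sigma t / 24 / (INR N * (INR N - 1)).
Proof.
  intros [Hz _] Hab Hs Ht HN.
  assert (HN2 : 2 <= INR N) by (apply two_le_INR; auto).
  specialize (Hz (sigma, t) Hs). apply (is_series_proj _ _ a (- b)) in Hz.
  replace (a * Re (zeta (sigma, t)) - b * Im (zeta (sigma, t)))
    with (a * Re (zeta (sigma, t)) + - b * Im (zeta (sigma, t))) by ring.
  set (L := a * Re (zeta (sigma, t)) + - b * Im (zeta (sigma, t))) in *.
  assert (Hlim : is_lim_seq (fun n => em_sum a b sigma t (S n)) L).
  { unfold em_sum.
    apply (is_lim_seq_ext (fun n => rsum (fun k => a * Re (nat_Cpow (S (k - 1)) (- (sigma, t))%C)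
          + - b * Im (nat_Cpow (S (k - 1)) (- (sigma, t))%C)) 1 n
        + (/ 2 * pw a b sigma t (INR (S n)) - pw_prim a b sigma t (INR (S n))))).
    - intros n. replace (S n - 1)%nat with n by lia.
      rewrite (rsum_ext _ (fun n => pw a b sigma t (INR n))).
      + unfold Rminus. rewrite Rplus_assoc. reflexivity.
      + intros k Hk. rewrite nat_Cpow_proj, Ropp_involutive.
        replace (S (k - 1)) with k by lia. reflexivity.
    - replace (Finite L) with (Finite (L + (/ 2 * 0 - 0))) by (f_equal; ring).
      apply (is_lim_seq_plus' _ _ _ _ Hz).
      apply is_lim_seq_minus'.
      + apply (is_lim_seq_scal_l _ (/ 2) 0). apply is_lim_seq_pw; lra.
      + apply is_lim_seq_pw; lra. }
  apply (is_lim_seq_incr_n _ (N - 1)) in Hlim.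
  assert (Hle : Rbar_le (em_sum a b sigma t N - em_const sigma t / 24 / (INR N * (INR N - 1))) L).
  { apply (is_lim_seq_le (fun _ => em_sum a b sigma t N - em_const sigma t / 24 / (INR N * (INR N - 1)))
              (fun n => em_sum a b sigma t (N + n))).
    - intros k.
      pose proof (em_le a b sigma t N k Hab ltac:(lra) Ht HN) as H.
      assert (Hk : 2 <= INR (N + k)) by (apply two_le_INR; lia).
      assert (Hc0 : 0 <= em_const sigma t) by apply sqrt_pos.
      assert (0 <= em_const sigma t / 24 * / (INR (N + k) * (INR (N + k) - 1))).
      { apply Rmult_le_pos; [lra |]. left; apply Rinv_0_lt_compat. nra. }
      unfold Rdiv at 1. lra.
    - apply is_lim_seq_const.
    - refine (is_lim_seq_ext _ _ _ _ Hlim). intros n. simpl. f_equal. lia. }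
  simpl in Hle. lra.
Qed.

Lemma rsum_continuous (f : nat -> R -> R) (x : R) (m len : nat) :
  (forall n, (m <= n < m + len)%nat -> continuous (f n) x) ->
  continuous (fun y => rsum (fun n => f n y) m len) x.
Proof.
  revert m; induction len as [| len IH]; intros m H; simpl.
  - apply continuous_const.
  - apply (continuous_plus (f m)); [apply H; lia | apply IH; intros; apply H; lia].
Qed.

(** The slack [Phi] of the inequality is continuous in [sigma] at 1, since [zeta] is differentiable
    at [1 + i t]. If it were negative at 1, it would be negative at some [sigma > 1], against
    [em_zeta_right]. *)
Lemma em_zeta_edge (zeta : C -> C) (a b t : R) (N : nat) :
  is_riemann_zeta zeta -> a * a + b * b <= 1 -> 0 < t -> (2 <= N)%nat ->
  em_sum a b 1 t N - (a * Re (zeta (1, t)) - b * Im (zeta (1, t)))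
    <= em_const 1 t / 24 / (INR N * (INR N - 1)).
Proof.
  intros Hz Hab Ht HN.
  assert (HN2 : 2 <= INR N) by (apply two_le_INR; auto).
  set (Phi := fun sigma => em_const sigma t / 24 / (INR N * (INR N - 1))
     - (em_sum a b sigma t N - (a * Re (zeta (sigma, t)) - b * Im (zeta (sigma, t))))).
  assert (Hcont : continuous Phi 1).
  { assert (Hzc : forall eps : posreal, locally 1 (fun sigma => ball (zeta (1, t)) eps (zeta (sigma, t)))).
    { pose proof (@ex_derive_continuous C_AbsRing C_NormedModule zeta (1, t)) as Hc.
      specialize (Hc ltac:(apply (proj2 Hz); intros E; injection E; lra)).
      intros eps.
      destruct (Hc (@ball C_UniformSpace (zeta (1, t)) eps)) as [d Hd]; [exists eps; auto |].
      exists d. intros y Hy. apply Hd.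
      change (Cmod ((y, t) - (1, t))%C < d). change (Rabs (y - 1) < d) in Hy.
      replace ((y, t) - (1, t))%C with (RtoC (y - 1)); [rewrite Cmod_R; exact Hy |].
      unfold RtoC, Cminus, Cplus, Copp; simpl. f_equal; ring. }
    assert (Hre : continuous (fun sigma => Re (zeta (sigma, t))) 1).
    { intros P [eps HP]. destruct (Hzc eps) as [d Hd]. exists d. intros y Hy. apply HP, (Hd y Hy). }
    assert (Him : continuous (fun sigma => Im (zeta (sigma, t))) 1).
    { intros P [eps HP]. destruct (Hzc eps) as [d Hd]. exists d. intros y Hy. apply HP, (Hd y Hy). }
    unfold Phi.
    apply (continuous_minus (fun sigma => em_const sigma t / 24 / (INR N * (INR N - 1)))).
    - apply (ex_derive_continuous (fun sigma => em_const sigma t / 24 / (INR N * (INR N - 1)))).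
      unfold em_const. auto_derive.
      apply Rmult_lt_0_compat; nra.
    - apply (continuous_minus (fun sigma => em_sum a b sigma t N)).
      + unfold em_sum. apply (continuous_minus (fun sigma => rsum (fun n : nat => pw a b sigma t (INR n)) 1 (N - 1) +
    / 2 * pw a b sigma t (INR N))).
        * apply (continuous_plus (fun sigma => rsum (fun n : nat => pw a b sigma t (INR n)) 1 (N - 1))).
          -- apply (rsum_continuous (fun n sigma => pw a b sigma t (INR n))).
             intros n _. apply (ex_derive_continuous (fun sigma => pw a b sigma t (INR n))).
             unfold pw. auto_derive. auto.
          -- apply (ex_derive_continuous (fun sigma => / 2 * pw a b sigma t (INR N))).
             unfold pw. auto_derive. auto.
        * apply (ex_derive_continuous (fun sigma => pw_prim a b sigma t (INR N))).
          unfold pw_prim, pw. auto_derive. repeat split; auto; nra.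
      + apply (continuous_minus (fun sigma => a * Re (zeta (sigma, t)))).
        * apply (continuous_mult (fun _ => a)); [apply continuous_const | auto].
        * apply (continuous_mult (fun _ => b)); [apply continuous_const | auto]. }
  enough (0 <= Phi 1) by (unfold Phi in *; lra).
  apply Rnot_lt_le; intros Hneg.
  assert (Hl : locally (Phi 1) (fun y => y < 0)).
  { apply (open_lt 0). exact Hneg. }
  destruct (Hcont _ Hl) as [d Hd].
  pose proof (cond_pos d) as Hdp.
  specialize (Hd (1 + d / 2)).
  assert (Phi (1 + d / 2) < 0).
  { apply Hd. change (Rabs (1 + d / 2 - 1) < d). rewrite Rabs_pos_eq; lra. }
  pose proof (em_zeta_right zeta a b (1 + d / 2) t N Hz Hab ltac:(lra) Ht HN).
  unfold Phi in *. lra.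
Qed.

(* [ipow t x = x ^ (- i t)] *)
Definition cis (x : R) : C := (cos x, sin x).
Definition ipow (t x : R) : C := cis (- (t * ln x)).
Definition zterm (t : R) (n : nat) : C := (ipow t (INR n) / RtoC (INR n))%C.

(** On [Re s = 1] the integral term [N ^ (1 - s) / (s - 1)] is [N ^ (- i t) / (i t)], which is where
    [- Ci / t] comes from. Applying [em_zeta_edge] with [- b] restores the usual projection. *)
Lemma zeta_euler_maclaurin (zeta : C -> C) (t : R) (N : nat) :
  is_riemann_zeta zeta -> 0 < t -> (2 <= N)%nat ->
  Cmod (csum (zterm t) 1 (N - 1) + ipow t (INR N) * (RtoC (/ (2 * INR N)) - Ci * RtoC (/ t))
        - zeta (1, t))%C
    <= (t * t + 5 / 2) / (24 * (INR N * (INR N - 1))).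
Proof.
  intros Hz Ht HN.
  assert (HN2 : 2 <= INR N) by (apply two_le_INR; auto).
  apply Cmod_le_of_proj. intros a b Hab.
  pose proof (em_zeta_edge zeta a (- b) t N Hz ltac:(lra) Ht HN) as H.
  assert (Hpw : forall n, (1 <= n)%nat -> pw a (- b) 1 t (INR n) = a * Re (zterm t n) + b * Im (zterm t n)).
  { intros n Hn. assert (1 <= INR n) by (apply one_le_INR; auto).
    unfold pw, zterm, ipow, cis, Re, Im; simpl.
    replace (- (1) * ln (INR n)) with (- ln (INR n)) by ring.
    rewrite exp_Ropp, exp_ln, cos_neg, sin_neg by lra. field. lra. }
  assert (E : em_sum a (- b) 1 t N
     = a * Re (csum (zterm t) 1 (N - 1) + ipow t (INR N) * (RtoC (/ (2 * INR N)) - Ci * RtoC (/ t)))%C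
     + b * Im (csum (zterm t) 1 (N - 1) + ipow t (INR N) * (RtoC (/ (2 * INR N)) - Ci * RtoC (/ t)))%C).
  { unfold em_sum. rewrite (rsum_ext _ (fun n => a * Re (zterm t n) + b * Im (zterm t n))).
    2:{ intros n Hn. apply Hpw; lia. }
    rewrite <- csum_proj. rewrite Hpw by lia.
    unfold pw_prim, pw.
    replace (- (1 - 1) * ln (INR N)) with 0 by ring. rewrite exp_0.
    unfold zterm, ipow, cis, Re, Im; simpl. rewrite cos_neg, sin_neg. field. lra. }
  (* The geometric mean of [1 + t ^ 2] and [4 + t ^ 2] is at most their arithmetic mean. *)
  assert (Hc : em_const 1 t <= t * t + 5 / 2).
  { unfold em_const. apply Rle_trans with (sqrt ((t * t + 5 / 2) * (t * t + 5 / 2))).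
    - apply sqrt_le_1_alt. nra.
    - rewrite sqrt_square; nra. }
  assert (Hc2 : em_const 1 t / 24 / (INR N * (INR N - 1)) <= (t * t + 5 / 2) / (24 * (INR N * (INR N - 1)))).
  { replace ((t * t + 5 / 2) / (24 * (INR N * (INR N - 1)))) with ((t * t + 5 / 2) / 24 / (INR N * (INR N - 1)))
      by (field; lra).
    apply Rmult_le_compat_r; [left; apply Rinv_0_lt_compat; nra | lra]. }
  rewrite E in H.
  set (Z := (csum (zterm t) 1 (N - 1) + ipow t (INR N) * (RtoC (/ (2 * INR N)) - Ci * RtoC (/ t)))%C) in *.
  clearbody Z. unfold Re, Im in *; simpl. lra.
Qed.

(** * The Kuzmin-Landau inequality *)

Lemma cis_add (x y : R) : cis (x + y) = (cis x * cis y)%C.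
Proof.
  unfold cis, Cmult; simpl. rewrite cos_plus, sin_plus. f_equal; ring.
Qed.

Lemma Cmod_cis (x : R) : Cmod (cis x) = 1.
Proof.
  unfold cis, Cmod; simpl.
  replace (cos x * (cos x * 1) + sin x * (sin x * 1)) with ((sin x)² + (cos x)²) by (unfold Rsqr; ring).
  rewrite sin2_cos2. apply sqrt_1.
Qed.

Lemma cis_sub_period (x : R) (k : nat) : cis (- (x + 2 * INR k * PI)) = cis (- x).
Proof.
  unfold cis. rewrite !cos_neg, !sin_neg, cos_period, sin_period. reflexivity.
Qed.

Definition cot (x : R) : R := cos x / sin x.

(** The difference of the cotangents is [sin (y - x) / (sin x * sin y)]. *)
Lemma cot_decr (x y : R) : 0 < x -> x <= y -> y < PI -> cot y <= cot x.
Proof.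
  intros Hx Hxy Hy.
  assert (Hsx : 0 < sin x) by (apply sin_gt_0; lra).
  assert (Hsy : 0 < sin y) by (apply sin_gt_0; lra).
  assert (Hd : 0 <= sin (y - x)) by (apply sin_ge_0; lra).
  rewrite sin_minus in Hd.
  unfold cot. apply Rmult_le_reg_r with (sin x * sin y); [nra |].
  replace (cos y / sin y * (sin x * sin y)) with (cos y * sin x) by (field; lra).
  replace (cos x / sin x * (sin x * sin y)) with (cos x * sin y) by (field; lra).
  lra.
Qed.

Lemma mul_cos_le_sin (y : R) : 0 <= y <= PI / 2 -> y * cos y <= sin y.
Proof.
  intros Hy.
  enough (sin 0 - 0 * cos 0 <= sin y - y * cos y) by (rewrite sin_0 in H; lra).
  apply (nonneg_derive_le (fun y => sin y - y * cos y) (fun y => y * sin y)); [lra | |].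
  - intros x Hx. auto_derive; auto. ring.
  - intros x Hx. apply Rmult_le_pos; [lra |]. pose proof PI_RGT_0. apply sin_ge_0; lra.
Qed.

(* [csc x + cot x = cot (x / 2)] *)
Lemma csc_add_cot_le (x : R) : 0 < x < PI -> / sin x + cot x <= 2 / x.
Proof.
  intros Hx.
  set (y := x / 2).
  assert (Hxy : x = 2 * y) by (unfold y; field).
  assert (Hy : 0 < y < PI / 2) by lra.
  assert (Hs : 0 < sin y) by (apply sin_gt_0; lra).
  assert (Hc : 0 < cos y) by (apply cos_gt_0; lra).
  assert (E : / sin x + cot x = cos y / sin y).
  { unfold cot. rewrite Hxy, sin_2a, cos_2a.
    replace (cos y * cos y - sin y * sin y) with (2 * (cos y * cos y) - 1).
    - field. lra.
    - pose proof (sin2_cos2 y) as H; unfold Rsqr in H. lra. }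
  rewrite E, Hxy.
  pose proof (mul_cos_le_sin y ltac:(lra)) as H.
  apply Rmult_le_reg_r with (y * sin y); [nra |].
  replace (cos y / sin y * (y * sin y)) with (y * cos y) by (field; lra).
  replace (2 / (2 * y) * (y * sin y)) with (sin y) by (field; lra). lra.
Qed.

(** Reflection [x -> PI - x] fixes the cosecant and negates the cotangent. *)
Lemma csc_sub_cot_le (x : R) : 0 < x < PI -> / sin x - cot x <= 2 / (PI - x).
Proof.
  intros Hx. pose proof (csc_add_cot_le (PI - x) ltac:(lra)) as H.
  rewrite sin_PI_x in H. unfold cot in *. rewrite sin_PI_x in H.
  replace (cos (PI - x)) with (- cos x) in H by (rewrite cos_minus, cos_PI, sin_PI; ring).
  unfold Rdiv in *. lra.
Qed.

(** This is [1 / (1 - exp (- 2 i x))]. Its real part is constant, so its total variation along a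
    monotone sequence is read off the cotangent alone. *)
Definition klc (x : R) : C := (/ 2, - / 2 * cot x).

Lemma klc_mul (x : R) : sin x <> 0 -> (klc x * (1 - cis (- (2 * x))))%C = 1%C.
Proof.
  intros Hs. unfold klc, cis, cot, Cmult, Cminus, Cplus, Copp, RtoC; simpl.
  rewrite cos_neg, sin_neg, cos_2a_sin, sin_2a. f_equal.
  - transitivity (sin x * sin x + cos x * cos x); [field; auto |].
    pose proof (sin2_cos2 x) as H; unfold Rsqr in H. lra.
  - field; auto.
Qed.

Lemma Cmod_klc (x : R) : 0 < sin x -> Cmod (klc x) = / 2 * / sin x.
Proof.
  intros Hs. unfold klc, Cmod; simpl.
  replace (/ 2 * (/ 2 * 1) + - / 2 * cot x * (- / 2 * cot x * 1)) with ((/ 2 * / sin x) * (/ 2 * / sin x)).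
  - apply sqrt_square. apply Rmult_le_pos; [lra | left; apply Rinv_0_lt_compat; auto].
  - unfold cot. pose proof (sin2_cos2 x) as H; unfold Rsqr in H.
    transitivity (/ 4 * ((sin x * sin x + cos x * cos x) / (sin x * sin x))); [rewrite H |]; field; lra.
Qed.

Lemma Cmod_klc_sub (x y : R) : cot x <= cot y -> Cmod (klc y - klc x)%C <= / 2 * (cot y - cot x).
Proof.
  intros H. replace (klc y - klc x)%C with ((- / 2 * RtoC (cot y - cot x)) * Ci)%C.
  - rewrite !Cmod_mult, Cmod_R, Rabs_pos_eq by lra.
    assert (E : Cmod Ci = 1).
    { unfold Cmod, Ci; simpl. replace (0 * (0 * 1) + 1 * (1 * 1)) with 1 by ring. apply sqrt_1. }
    rewrite E, Cmod_opp, Cmod_inv, Cmod_R, Rabs_pos_eq by (lra || (intros E2; apply RtoC_inj in E2; lra)). lra.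
  - unfold klc, Ci, RtoC, Cmult, Cminus, Cplus, Copp, Cinv; simpl. f_equal; field.
Qed.

Definition phase (t : R) (n : nat) : R := t * ln (1 + / INR n).

Lemma phase_eq (t : R) (n : nat) : (1 <= n)%nat -> phase t n = t * ln (INR (S n)) - t * ln (INR n).
Proof.
  intros Hn. assert (1 <= INR n) by (apply one_le_INR; auto).
  unfold phase. rewrite S_INR.
  replace (1 + / INR n) with ((INR n + 1) / INR n) by (field; lra).
  rewrite ln_div by lra. ring.
Qed.

Lemma phase_decr (t : R) (m n : nat) : 0 < t -> (1 <= m <= n)%nat -> phase t n <= phase t m.
Proof.
  intros Ht Hmn.
  assert (1 <= INR m) by (apply one_le_INR; lia).
  assert (INR m <= INR n) by (apply le_INR; lia).
  unfold phase. apply Rmult_le_compat_l; [lra |].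
  assert (/ INR n <= / INR m) by (apply Rinv_le_contravar; lra).
  assert (0 < / INR n) by (apply Rinv_0_lt_compat; lra).
  destruct (Req_dec (/ INR n) (/ INR m)) as [-> | E]; [lra |].
  left; apply ln_increasing; lra.
Qed.

Lemma ln_1p_le (x : R) : 0 < x -> ln (1 + x) <= x.
Proof.
  intros Hx. rewrite <- (ln_exp x) at 2. left; apply ln_increasing; [lra |].
  apply exp_ineq1. lra.
Qed.

Lemma phase_le (t : R) (n : nat) : 0 < t -> (1 <= n)%nat -> phase t n <= t / INR n.
Proof.
  intros Ht Hn. assert (1 <= INR n) by (apply one_le_INR; auto).
  unfold phase, Rdiv. apply Rmult_le_compat_l; [lra |]. apply ln_1p_le. apply Rinv_0_lt_compat; lra.
Qed.

Lemma phase_ge (t : R) (n : nat) : 0 < t -> (1 <= n)%nat -> t / (INR n + 1) <= phase t n.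
Proof.
  intros Ht Hn. assert (1 <= INR n) by (apply one_le_INR; auto).
  unfold phase, Rdiv. apply Rmult_le_compat_l; [lra |].
  assert (E : ln (1 + / INR n) = - ln (1 + - / (INR n + 1))).
  { rewrite <- ln_Rinv.
    - f_equal. field. lra.
    - replace (1 + - / (INR n + 1)) with (INR n / (INR n + 1)) by (field; lra).
      apply Rdiv_lt_0_compat; lra. }
  rewrite E.
  assert (H1 : ln (1 + - / (INR n + 1)) <= - / (INR n + 1)).
  { rewrite <- (ln_exp (- / (INR n + 1))) at 2. left; apply ln_increasing.
    - replace (1 + - / (INR n + 1)) with (INR n / (INR n + 1)) by (field; lra).
      apply Rdiv_lt_0_compat; lra.
    - apply exp_ineq1. pose proof (Rinv_0_lt_compat (INR n + 1) ltac:(lra)). lra. }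
  lra.
Qed.

Lemma ipow_succ (t : R) (n : nat) : (1 <= n)%nat -> ipow t (INR (S n)) = (ipow t (INR n) * cis (- phase t n))%C.
Proof.
  intros Hn. unfold ipow. rewrite <- cis_add. f_equal. rewrite phase_eq by auto. ring.
Qed.

(* Summation by parts against the factors [1 / (1 - cis (- phase t n))], whose imaginary parts are
   monotone in [n]. *)
Lemma kuzmin_landau (t phi : R) (k A len : nat) :
  0 < t -> 0 < phi -> (1 <= A)%nat ->
  (forall n, (A <= n < A + len)%nat ->
     2 * PI * INR k + phi <= phase t n <= 2 * PI * (INR k + 1) - phi) ->
  Cmod (csum (fun n => ipow t (INR n)) A len) <= 4 / phi.
Proof.
  intros Ht Hphi HA Hu.
  destruct len as [| len].
  { simpl. rewrite Cmod_0. apply Rlt_le, Rdiv_lt_0_compat; lra. }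
  pose proof PI_RGT_0 as Hpi.
  (* Half the phase, reduced modulo [PI] into [(0, PI)], where the cotangent is monotone. *)
  set (x := fun n => phase t n / 2 - INR k * PI).
  assert (Hx : forall n, (A <= n < A + S len)%nat -> phi / 2 <= x n <= PI - phi / 2).
  { intros n Hn. specialize (Hu n Hn). unfold x. lra. }
  assert (Hs : forall n, (A <= n < A + S len)%nat -> 0 < sin (x n)).
  { intros n Hn. specialize (Hx n Hn). apply sin_gt_0; lra. }
  assert (Hw : forall n, (A <= n < A + S len)%nat ->
     (ipow t (INR n) = klc (x n) * ipow t (INR n) - klc (x n) * ipow t (INR (S n)))%C).
  { intros n Hn. rewrite ipow_succ by lia.
    replace (- phase t n) with (- (2 * x n + 2 * INR k * PI)) by (unfold x; field).
    rewrite cis_sub_period.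
    pose proof (klc_mul (x n) ltac:(pose proof (Hs n Hn); lra)) as H.
    transitivity (ipow t (INR n) * (klc (x n) * (1 - cis (- (2 * x n)))))%C; [rewrite H; ring | ring]. }
  (* Each term is [klc (x n)] times a difference of consecutive [ipow]. Adding the boundary term
     isolates the variation of [klc], which telescopes because [cot (x n)] increases with [n]. *)
  assert (Hind : forall l, (l <= len)%nat ->
    Cmod (csum (fun n => ipow t (INR n)) A (S l) + klc (x (A + l)%nat) * ipow t (INR (S (A + l))))%C
      <= Cmod (klc (x A)) + / 2 * (cot (x (A + l)%nat) - cot (x A))).
  { induction l as [| l IH]; intros Hl.
    - rewrite Nat.add_0_r. simpl csum.
      replace (ipow t (INR A) + 0 + klc (x A) * ipow t (INR (S A)))%C with (klc (x A) * ipow t (INR A))%C.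
      + rewrite Cmod_mult. unfold ipow at 1. rewrite Cmod_cis. lra.
      + rewrite (Hw A) at 2 by lia. ring.
    - rewrite csum_S.
      replace (A + S l)%nat with (S (A + l)) by lia.
      set (n := (A + l)%nat) in *.
      replace (csum (fun n => ipow t (INR n)) A (S l) + ipow t (INR (S n)) + klc (x (S n)) * ipow t (INR (S (S n))))%C
        with ((csum (fun n => ipow t (INR n)) A (S l) + klc (x n) * ipow t (INR (S n)))
              + (klc (x (S n)) - klc (x n)) * ipow t (INR (S n)))%C
        by (rewrite (Hw (S n)) at 3 by (unfold n; lia); ring).
      eapply Rle_trans; [apply Cmod_triangle |].
      rewrite (Cmod_mult (_ - _)). unfold ipow at 3. rewrite Cmod_cis, Rmult_1_r.
      assert (Hc : cot (x n) <= cot (x (S n))).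
      { pose proof (Hx n ltac:(unfold n; lia)); pose proof (Hx (S n) ltac:(unfold n; lia)).
        apply cot_decr; try lra. unfold x.
        pose proof (phase_decr t n (S n) Ht ltac:(unfold n; lia)). lra. }
      pose proof (Cmod_klc_sub _ _ Hc). specialize (IH ltac:(lia)). fold n in IH. lra. }
  specialize (Hind len ltac:(lia)).
  set (B := (A + len)%nat) in *.
  assert (HB : (A <= B < A + S len)%nat) by (unfold B; lia).
  assert (HA' : (A <= A < A + S len)%nat) by lia.
  assert (Htri : Cmod (csum (fun n => ipow t (INR n)) A (S len))
     <= Cmod (csum (fun n => ipow t (INR n)) A (S len) + klc (x B) * ipow t (INR (S B)))%C + Cmod (klc (x B))).
  { replace (csum (fun n => ipow t (INR n)) A (S len)) with
      ((csum (fun n => ipow t (INR n)) A (S len) + klc (x B) * ipow t (INR (S B))) + - (klc (x B) * ipow t (INR (S B))))%C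
      at 1 by ring.
    eapply Rle_trans; [apply Cmod_triangle |].
    rewrite Cmod_opp, Cmod_mult. unfold ipow at 3. rewrite Cmod_cis. lra. }
  rewrite Cmod_klc in Hind by auto. rewrite (Cmod_klc (x B)) in Htri by auto.
  pose proof (Hx A HA') as HxA; pose proof (Hx B HB) as HxB.
  (* The two end moduli combine with the telescoped cotangents into [csc + cot] at [x B] and
     [csc - cot] at [x A], so neither end has to be bounded by its cosecant separately. *)
  pose proof (csc_add_cot_le (x B) ltac:(lra)) as H1.
  pose proof (csc_sub_cot_le (x A) ltac:(lra)) as H2.
  assert (H3 : 2 / x B <= 4 / phi).
  { replace (4 / phi) with (2 / (phi / 2)) by (field; lra).
    apply Rmult_le_compat_l; [lra |]. apply Rinv_le_contravar; lra. }
  assert (H4 : 2 / (PI - x A) <= 4 / phi).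
  { replace (4 / phi) with (2 / (phi / 2)) by (field; lra).
    apply Rmult_le_compat_l; [lra |]. apply Rinv_le_contravar; lra. }
  lra.
Qed.

(** Abel summation. The induction bounds the weighted sum minus its boundary term
    [b (A + l) * csum f A l]; each step then costs [(b n - b (S n)) * B], which telescopes. *)
Lemma abel_bound (f : nat -> C) (b : nat -> R) (B : R) (A len : nat) :
  (forall l, (l <= len)%nat -> Cmod (csum f A l) <= B) ->
  (forall n, (A <= n < A + len)%nat -> 0 <= b (S n) <= b n) -> 0 <= b A ->
  Cmod (csum (fun n => RtoC (b n) * f n)%C A len) <= b A * B.
Proof.
  intros HB Hb HbA.
  assert (Hind : forall l, (l <= len)%nat ->
    0 <= b (A + l)%nat /\
    Cmod (csum (fun n => RtoC (b n) * f n) A l - RtoC (b (A + l)%nat) * csum f A l)%C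
      <= (b A - b (A + l)%nat) * B).
  { induction l as [| l IH]; intros Hl.
    - rewrite Nat.add_0_r. split; [auto |]. simpl.
      replace (0 - RtoC (b A) * 0)%C with (RtoC 0) by ring. rewrite Cmod_0. lra.
    - destruct (IH ltac:(lia)) as [IH1 IH2].
      specialize (Hb (A + l)%nat ltac:(lia)).
      replace (A + S l)%nat with (S (A + l)) by lia. split; [lra |].
      rewrite (csum_S (fun n => RtoC (b n) * f n)%C).
      replace (csum (fun n => RtoC (b n) * f n) A l + RtoC (b (A + l)%nat) * f (A + l)%nat
           - RtoC (b (S (A + l))) * csum f A (S l))%C
        with ((csum (fun n => RtoC (b n) * f n) A l - RtoC (b (A + l)%nat) * csum f A l)
           + RtoC (b (A + l)%nat - b (S (A + l))) * csum f A (S l))%C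
        by (rewrite csum_S, RtoC_minus; ring).
      eapply Rle_trans; [apply Cmod_triangle |].
      rewrite Cmod_mult, Cmod_R, Rabs_pos_eq by lra.
      specialize (HB (S l) Hl). nra. }
  destruct (Hind len ltac:(lia)) as [H1 H2].
  specialize (HB len ltac:(lia)).
  replace (csum (fun n => RtoC (b n) * f n)%C A len) with
   ((csum (fun n => RtoC (b n) * f n) A len - RtoC (b (A + len)%nat) * csum f A len)
     + RtoC (b (A + len)%nat) * csum f A len)%C by ring.
  eapply Rle_trans; [apply Cmod_triangle |].
  rewrite Cmod_mult, Cmod_R, Rabs_pos_eq by lra. nra.
Qed.

Lemma kuzmin_landau_weighted (t phi : R) (k A len : nat) :
  0 < t -> 0 < phi -> (1 <= A)%nat ->
  (forall n, (A <= n < A + len)%nat ->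
     2 * PI * INR k + phi <= phase t n <= 2 * PI * (INR k + 1) - phi) ->
  Cmod (csum (zterm t) A len) <= / INR A * (4 / phi).
Proof.
  intros Ht Hphi HA Hu.
  rewrite (csum_ext _ (fun n => RtoC (/ INR n) * ipow t (INR n))%C).
  - apply (abel_bound (fun n => ipow t (INR n)) (fun n => / INR n)).
    + intros l Hl. apply kuzmin_landau with k; auto. intros n Hn; apply Hu; lia.
    + intros n Hn. assert (1 <= INR n) by (apply one_le_INR; lia).
      rewrite S_INR. split; [left; apply Rinv_0_lt_compat; lra |].
      apply Rinv_le_contravar; lra.
    + left; apply Rinv_0_lt_compat. apply lt_0_INR; lia.
  - intros n Hn. unfold zterm. assert (1 <= INR n) by (apply one_le_INR; lia).
    rewrite RtoC_inv by lra. unfold Cdiv. ring.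
Qed.

(** * The tail of the Dirichlet series *)

Lemma ln_le_sub_1 (x : R) : 0 < x -> ln x <= x - 1.
Proof.
  intros Hx. rewrite <- (ln_exp (x - 1)).
  destruct (Req_dec x 1) as [-> | E].
  - replace (1 - 1) with 0 by ring. rewrite exp_0. lra.
  - left. apply ln_increasing; auto. pose proof (exp_ineq1 (x - 1) ltac:(lra)). lra.
Qed.

(** The phase is at most [t / n] and so tends to 0. The first index at which it drops below a level
    serves as a block boundary; monotonicity then controls all later indices. *)
Lemma first_phase_below (t Y : R) (m : nat) :
  0 < t -> 0 < Y -> (1 <= m)%nat ->
  exists A, (m <= A)%nat /\ phase t A < Y /\ forall n, (m <= n < A)%nat -> Y <= phase t n.
Proof.
  intros Ht HY Hm.
  assert (Hex : exists d, phase t (m + d) < Y).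
  { destruct (INR_unbounded (t / Y)) as [d Hd]. exists d.
    eapply Rle_lt_trans; [apply phase_le; auto; lia |].
    assert (INR d <= INR (m + d)) by (apply le_INR; lia).
    assert (0 < t / Y) by (apply Rdiv_lt_0_compat; auto).
    apply Rmult_lt_reg_r with (INR (m + d)); [lra |].
    replace (t / INR (m + d) * INR (m + d)) with (t / Y * Y) by (field; lra). nra. }
  destruct Hex as [d Hd]. revert m Hm Hd. induction d as [| d IH]; intros m Hm Hd.
  - rewrite Nat.add_0_r in Hd. exists m. split; [lia | split; [auto |]]. intros; lia.
  - destruct (Rlt_dec (phase t m) Y) as [Hlt | Hge].
    + exists m. split; [lia | split; [auto |]]. intros; lia.
    + destruct (IH (S m) ltac:(lia)) as [A [H1 [H2 H3]]].
      { replace (S m + d)%nat with (m + S d)%nat by lia. auto. }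
      exists A. split; [lia | split; [auto |]]. intros n Hn.
      destruct (Nat.eq_dec n m) as [-> | E]; [lra | apply H3; lia].
Qed.

Lemma Cmod_zterm (t : R) (n : nat) : (1 <= n)%nat -> Cmod (zterm t n) = / INR n.
Proof.
  intros Hn. assert (1 <= INR n) by (apply one_le_INR; auto).
  unfold zterm. rewrite Cmod_div by (intros E; apply RtoC_inj in E; lra).
  unfold ipow. rewrite Cmod_cis, Cmod_R, Rabs_pos_eq by lra. field; lra.
Qed.

(** Telescoping of [1 / n <= ln (n / (n - 1))]. *)
Lemma harmonic_block_le (A len : nat) :
  (2 <= A)%nat ->
  rsum (fun n => / INR n) A len <= ln ((INR (A + len) - 1) / (INR A - 1)).
Proof.
  intros HA.
  assert (HA2 : 2 <= INR A) by (apply two_le_INR; auto).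
  induction len as [| len IH].
  - rewrite Nat.add_0_r. simpl. replace ((INR A - 1) / (INR A - 1)) with 1 by (field; lra).
    rewrite ln_1; lra.
  - rewrite rsum_S, Nat.add_succ_r, S_INR.
    assert (Hn : INR A <= INR (A + len)) by (apply le_INR; lia).
    set (x := INR (A + len)) in *. clearbody x.
    rewrite ln_div in * by lra.
    replace (x + 1 - 1) with x by ring.
    pose proof (ln_le_sub_1 ((x - 1) / x) ltac:(apply Rdiv_lt_0_compat; lra)) as H.
    rewrite ln_div in H by lra.
    replace ((x - 1) / x - 1) with (- / x) in H by (field; lra). lra.
Qed.

(** Since [t / (n + 1) <= phase t n <= t / n], the indices of the block lie between [t / Y - 1] and
    [t / x]. The harmonic sum is then the logarithm of a ratio [r], and [ln r <= r - 1] loses little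
    because [r] is near 1 in the uses. *)
Lemma near_block_le (t x Y : R) (A len : nat) :
  0 < t -> 0 < x -> x <= Y -> 2 * Y < t -> (1 <= A)%nat ->
  phase t A < Y -> (forall n, (A <= n < A + len)%nat -> x <= phase t n) ->
  Cmod (csum (zterm t) A len) <= Y / x * (t / (t - 2 * Y)) - 1.
Proof.
  intros Ht Hx HxY HYt HA HuA Hu.
  destruct len as [| len].
  - simpl. rewrite Cmod_0.
    assert (1 <= Y / x) by (apply Rmult_le_reg_r with x; [auto | unfold Rdiv; rewrite Rmult_assoc, Rinv_l; lra]).
    assert (1 <= t / (t - 2 * Y)).
    { apply Rmult_le_reg_r with (t - 2 * Y); [lra | unfold Rdiv; rewrite Rmult_assoc, Rinv_l; lra]. }
    nra.
  - pose proof (phase_ge t A Ht HA) as H1.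
    assert (HA0 : 1 <= INR A) by (apply one_le_INR; auto).
    assert (H2 : t < Y * (INR A + 1)).
    { apply Rmult_lt_reg_r with (/ (INR A + 1)); [apply Rinv_0_lt_compat; lra |].
      rewrite Rmult_assoc, Rinv_r by lra. unfold Rdiv in H1. lra. }
    assert (HA2 : (2 <= A)%nat).
    { destruct (Nat.eq_dec A 1) as [-> | E]; [simpl in H2; lra | lia]. }
    assert (HA2' : 2 <= INR A) by (apply two_le_INR; auto).
    eapply Rle_trans.
    { apply csum_le with (g := fun n => / INR n). intros n Hn. rewrite Cmod_zterm by lia. lra. }
    eapply Rle_trans; [apply harmonic_block_le; auto |].
    specialize (Hu (A + len)%nat ltac:(lia)).
    pose proof (phase_le t (A + len) Ht ltac:(lia)) as H3.
    replace (A + S len)%nat with (S (A + len)) by lia. rewrite S_INR.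
    assert (HB : INR A <= INR (A + len)) by (apply le_INR; lia).
    set (b := INR (A + len)) in *. clearbody b. set (a := INR A) in *. clearbody a.
    assert (H4 : b <= t / x).
    { apply Rmult_le_reg_r with x; auto. replace (t / x * x) with t by (field; lra).
      assert (H5 : x <= t / b) by lra.
      apply Rmult_le_compat_r with (r := b) in H5; [| lra].
      replace (t / b * b) with t in H5 by (field; lra). lra. }
    eapply Rle_trans; [apply ln_le_sub_1; apply Rdiv_lt_0_compat; lra |].
    replace (b + 1 - 1) with b by ring.
    apply Rplus_le_compat_r.
    replace (Y / x * (t / (t - 2 * Y))) with (t / x * / ((t - 2 * Y) / Y)) by (field; lra).
    apply Rmult_le_compat; [lra | left; apply Rinv_0_lt_compat; lra | auto |].
    apply Rinv_le_contravar.
    + apply Rdiv_lt_0_compat; lra.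
    + apply Rmult_le_reg_r with Y; [lra |]. replace ((t - 2 * Y) / Y * Y) with (t - 2 * Y) by (field; lra). lra.
Qed.

(* On the terms with [phase t n] in [2 pi j + phi, 2 pi (j + 1) - phi], on those within [phi] of
   [2 pi j], and beyond [phase t n = phi], respectively; [p <= 2 pi <= P] leaves room for rational
   bounds. *)
Definition kl_bound (p phi t : R) (j : nat) : R :=
  4 / phi * ((p * (INR j + 1) - phi) / (t - (p * (INR j + 1) - phi))).

Definition near_bound (p P phi t : R) (j : nat) : R :=
  (P * INR j + phi) / (p * INR j - phi) * (t / (t - 2 * (P * INR j + phi))) - 1.

Definition end_bound (phi t : R) : R :=
  / t + / (2 * (t / phi - 1)) + (t * t + 5 / 2) / (24 * ((t / phi - 1) * (t / phi - 2))).

Fixpoint tail_bound (p P phi t : R) (K : nat) : R :=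
  match K with
  | O => kl_bound p phi t 0 + end_bound phi t
  | S k => tail_bound p P phi t k + kl_bound p phi t (S k) + near_bound p P phi t (S k)
  end.

(** With [X = p (k + 1) - phi], the first index satisfies [t / (m + 1) <= X], so the leading weight
    [1 / m] is at most [X / (t - X)]. *)
Lemma kl_block_le (t p phi Y : R) (k m A : nat) :
  0 < t -> 0 < phi -> p <= 2 * PI -> p * (INR k + 1) - phi < t -> phi < p ->
  (1 <= m <= A)%nat -> 2 * PI * INR k + phi <= Y ->
  phase t m <= p * (INR k + 1) - phi ->
  (forall n, (m <= n < A)%nat -> Y <= phase t n) ->
  Cmod (csum (zterm t) m (A - m)) <= kl_bound p phi t k.
Proof.
  intros Ht Hphi Hp HXt Hpp Hm HY Hum Hu.
  pose proof (pos_INR k) as Hk.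
  set (X := p * (INR k + 1) - phi) in *.
  assert (HX : 0 < X) by (unfold X; nra).
  assert (Hm1 : 1 <= INR m) by (apply one_le_INR; lia).
  eapply Rle_trans.
  { apply (kuzmin_landau_weighted t phi k); auto; [lia |].
    intros n Hn. split; [apply Rle_trans with Y; auto; apply Hu; lia |].
    apply Rle_trans with X; [| unfold X; nra].
    eapply Rle_trans; [apply (phase_decr t m n); auto; lia | auto]. }
  unfold kl_bound. fold X. rewrite Rmult_comm.
  apply Rmult_le_compat_l; [left; apply Rdiv_lt_0_compat; lra |].
  pose proof (phase_ge t m Ht ltac:(lia)) as H.
  assert (H2 : t <= X * (INR m + 1)).
  { apply Rmult_le_reg_r with (/ (INR m + 1)); [apply Rinv_0_lt_compat; lra |].
    rewrite Rmult_assoc, Rinv_r by lra. unfold Rdiv in H. lra. }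
  apply Rmult_le_reg_r with (INR m * (t - X)); [nra |].
  replace (/ INR m * (INR m * (t - X))) with (t - X) by (field; lra).
  replace (X / (t - X) * (INR m * (t - X))) with (X * INR m) by (field; lra). lra.
Qed.

Lemma csum_split (f : nat -> C) (m n : nat) :
  (1 <= m <= n)%nat -> csum f 1 (n - 1) = (csum f 1 (m - 1) + csum f m (n - m))%C.
Proof.
  intros H. replace (n - 1)%nat with ((m - 1) + (n - m))%nat by lia.
  rewrite csum_app. do 2 f_equal. lia.
Qed.

Lemma Cmod_Ci_div (t : R) : 0 < t -> Cmod (Ci * RtoC (/ t))%C = / t.
Proof.
  intros Ht. unfold Cmod, Ci, RtoC; simpl.
  match goal with |- sqrt ?x = _ => replace x with (/ t * / t) by (field; lra) end.
  apply sqrt_square. left; apply Rinv_0_lt_compat; auto.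
Qed.

(** Induction on [K]: a Kuzmin-Landau block and the block near [2 pi K] are peeled off, which leaves
    the phase below [p K - phi], the hypothesis for [K - 1]. For [K = 0] one last Kuzmin-Landau
    block runs until the phase is below [phi]; there the cut-off is at least [t / phi - 1], and
    Euler-Maclaurin finishes. *)
Lemma zeta_tail_le (zeta : C -> C) (p P phi t : R) (K m : nat) :
  is_riemann_zeta zeta -> 0 < phi -> phi < p -> p <= 2 * PI <= P -> 2 < t / phi - 1 ->
  p * (INR K + 1) - phi < t -> 2 * (P * INR K + phi) < t ->
  (1 <= m)%nat -> phase t m <= p * (INR K + 1) - phi ->
  Cmod (csum (zterm t) 1 (m - 1) - zeta (1, t))%C <= tail_bound p P phi t K.
Proof.
  intros Hz Hphi Hpp HpP Hend.
  assert (Ht : 0 < t).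
  { apply Rmult_lt_reg_r with (/ phi); [apply Rinv_0_lt_compat; auto |]. unfold Rdiv in Hend. lra. }
  revert m; induction K as [| K IH]; intros m HKt HKt2 Hm Hum.
  - simpl in *. destruct (first_phase_below t phi m Ht Hphi Hm) as [A [HmA [HA HA']]].
    assert (HA1 : 1 <= INR A) by (apply one_le_INR; lia).
    pose proof (phase_ge t A Ht ltac:(lia)) as H1.
    assert (H2 : t / phi - 1 <= INR A).
    { apply Rmult_le_reg_r with phi; [auto |].
      replace ((t / phi - 1) * phi) with (t - phi) by (field; lra).
      assert (t < phi * (INR A + 1)).
      { apply Rmult_lt_reg_r with (/ (INR A + 1)); [apply Rinv_0_lt_compat; lra |].
        rewrite Rmult_assoc, Rinv_r by lra. unfold Rdiv in H1. lra. }
      lra. }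
    assert (HA2 : (2 <= A)%nat).
    { destruct (Nat.eq_dec A 1) as [-> | E]; [simpl in H2; lra | lia]. }
    pose proof (zeta_euler_maclaurin zeta t A Hz Ht HA2) as HEM.
    pose proof (kl_block_le t p phi phi 0 m A Ht Hphi ltac:(lra) ltac:(simpl; lra) Hpp
       ltac:(lia) ltac:(simpl; lra) ltac:(simpl; lra) HA') as HKL.
    set (e := (ipow t (INR A) * (RtoC (/ (2 * INR A)) - Ci * RtoC (/ t)))%C) in *.
    assert (He : Cmod e <= / t + / (2 * INR A)).
    { unfold e, ipow. rewrite Cmod_mult, Cmod_cis, Rmult_1_l.
      eapply Rle_trans; [apply Cmod_triangle |].
      rewrite Cmod_opp, Cmod_Ci_div, Cmod_R, Rabs_pos_eq by (auto; left; apply Rinv_0_lt_compat; lra). lra. }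
    rewrite (csum_split _ m A) in HEM by lia.
    replace (csum (zterm t) 1 (m - 1) - zeta (1, t))%C with
      ((csum (zterm t) 1 (m - 1) + csum (zterm t) m (A - m) + e - zeta (1, t)) + (- csum (zterm t) m (A - m) + - e))%C by ring.
    eapply Rle_trans; [apply Cmod_triangle |].
    pose proof (Cmod_triangle (- csum (zterm t) m (A - m)) (- e)) as Htr.
    rewrite !Cmod_opp in Htr.
    unfold end_bound.
    set (y := t / phi - 1) in *.
    assert (/ (2 * INR A) <= / (2 * y)) by (apply Rinv_le_contravar; lra).
    assert ((t * t + 5 / 2) / (24 * (INR A * (INR A - 1))) <= (t * t + 5 / 2) / (24 * (y * (y - 1)))).
    { apply Rmult_le_compat_l; [nra |]. apply Rinv_le_contravar; [nra |].
      apply Rmult_le_compat_l; [lra |]. apply Rmult_le_compat; lra. }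
    replace (t / phi - 2) with (y - 1) by (unfold y; ring). lra.
  - pose proof (pos_INR K) as HK.
    assert (HP : 0 < P) by (pose proof PI_RGT_0; lra).
    rewrite S_INR in *.
    set (Y := P * INR (S K) + phi). set (x := p * INR (S K) - phi).
    assert (Hx : 0 < x) by (unfold x; rewrite S_INR; nra).
    assert (HxY : x <= Y) by (unfold x, Y; rewrite S_INR; nra).
    (* [A] ends the Kuzmin-Landau block and starts the block near the multiple of [2 pi], which ends
       at [B]. *)
    destruct (first_phase_below t Y m Ht ltac:(lra) Hm) as [A [HmA [HA HA']]].
    destruct (first_phase_below t x A Ht ltac:(lra) ltac:(lia)) as [B [HAB [HB HB']]].
    assert (HKL : Cmod (csum (zterm t) m (A - m)) <= kl_bound p phi t (S K)).
    { apply (kl_block_le t p phi Y (S K) m A); auto; try lia; try lra.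
      - rewrite S_INR; lra.
      - unfold Y. pose proof (pos_INR (S K)). nra.
      - rewrite S_INR; lra. }
    assert (Hnear : Cmod (csum (zterm t) A (B - A)) <= near_bound p P phi t (S K)).
    { apply (near_block_le t x Y A (B - A)); auto; try lia.
      - unfold Y; rewrite S_INR; lra.
      - intros n Hn; apply HB'; lia. }
    specialize (IH B ltac:(lra) ltac:(lra) ltac:(lia)).
    assert (HIH : Cmod (csum (zterm t) 1 (B - 1) - zeta (1, t))%C <= tail_bound p P phi t K).
    { apply IH. unfold x in HB. rewrite S_INR in HB. lra. }
    rewrite (csum_split _ m B) in HIH by lia.
    replace (B - m)%nat with ((A - m) + (B - A))%nat in HIH by lia.
    rewrite csum_app in HIH. replace (m + (A - m))%nat with A in HIH by lia.
    change (tail_bound p P phi t (S K)) with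
      (tail_bound p P phi t K + kl_bound p phi t (S K) + near_bound p P phi t (S K)).
    set (c1 := csum (zterm t) m (A - m)) in *. set (c2 := csum (zterm t) A (B - A)) in *.
    replace (csum (zterm t) 1 (m - 1) - zeta (1, t))%C with
      ((csum (zterm t) 1 (m - 1) + (c1 + c2) - zeta (1, t)) + (- c1 + - c2))%C by ring.
    eapply Rle_trans; [apply Cmod_triangle |].
    pose proof (Cmod_triangle (- c1) (- c2)) as Htr. rewrite !Cmod_opp in Htr. lra.
Qed.

(** * Fixed-point arithmetic *)

Definition scale (p : Z) : R := IZR (2 ^ p).
Definition toC (p : Z) (x : Z * Z) : C := (IZR (fst x) / scale p, IZR (snd x) / scale p).

(* The term [- 1 - 2 / scale p] makes the quality factor [q] exactly multiplicative under
   the truncated product [cmulz]. *)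
Definition approx (p : Z) (x : Z * Z) (z : C) (q : R) : Prop :=
  Cmod (toC p x - z)%C <= q - 1 - 2 / scale p.

Definition cmulz (p : Z) (x y : Z * Z) : Z * Z :=
  (Z.shiftr (fst x * fst y - snd x * snd y) p, Z.shiftr (fst x * snd y + snd x * fst y) p).

Lemma scale_pos (p : Z) : (0 <= p)%Z -> 0 < scale p.
Proof. intros H. unfold scale. apply IZR_lt. apply Z.pow_pos_nonneg; lia. Qed.

Lemma Zdiv_bounds (x d : Z) : (0 < d)%Z -> IZR x / IZR d - 1 <= IZR (x / d) <= IZR x / IZR d.
Proof.
  intros Hd. assert (Hd' : 0 < IZR d) by (apply IZR_lt; auto).
  pose proof (Z.div_mod x d ltac:(lia)) as E. pose proof (Z.mod_pos_bound x d Hd) as Hm.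
  assert (ER : IZR x = IZR d * IZR (x / d) + IZR (x mod d)) by (rewrite <- mult_IZR, <- plus_IZR; f_equal; auto).
  assert (0 <= IZR (x mod d)) by (apply IZR_le; lia).
  assert (IZR (x mod d) < IZR d) by (apply IZR_lt; lia).
  rewrite ER. replace ((IZR d * IZR (x / d) + IZR (x mod d)) / IZR d)
    with (IZR (x / d) + IZR (x mod d) / IZR d) by (field; lra).
  assert (0 <= IZR (x mod d) / IZR d) by (apply Rmult_le_pos; [lra | left; apply Rinv_0_lt_compat; lra]).
  assert (IZR (x mod d) / IZR d <= 1).
  { apply Rmult_le_reg_r with (IZR d); [auto |]. unfold Rdiv. rewrite Rmult_assoc, Rinv_l; lra. }
  lra.
Qed.

Lemma Zshiftr_bounds (x p : Z) : (0 <= p)%Z -> IZR x / scale p - 1 <= IZR (Z.shiftr x p) <= IZR x / scale p.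
Proof.
  intros Hp. rewrite Z.shiftr_div_pow2 by auto. apply Zdiv_bounds. apply Z.pow_pos_nonneg; lia.
Qed.

Lemma Cmod_le_sum (a b : R) : Cmod (a, b) <= Rabs a + Rabs b.
Proof.
  pose proof (Rabs_pos a); pose proof (Rabs_pos b).
  unfold Cmod; simpl. rewrite <- (sqrt_square (Rabs a + Rabs b)) by lra.
  apply sqrt_le_1_alt.
  assert (Ha : a * a = Rabs a * Rabs a) by (rewrite <- Rabs_mult, Rabs_pos_eq; [auto | apply Rle_0_sqr]).
  assert (Hb : b * b = Rabs b * Rabs b) by (rewrite <- Rabs_mult, Rabs_pos_eq; [auto | apply Rle_0_sqr]).
  nra.
Qed.

(** With input errors [e], [d] and truncation [rho = 2 / scale p], the new error is at most [rho + e
    + d + e d <= (q - rho) (q' - rho) - 1 + rho]. This is at most [q q' - 1 - rho], because [q] and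
    [q'] are both at least [1 + rho]. *)
Lemma approx_mul (p : Z) (x y : Z * Z) (z z' : C) (q q' : R) :
  (0 <= p)%Z -> Cmod z <= 1 -> Cmod z' <= 1 ->
  approx p x z q -> approx p y z' q' -> approx p (cmulz p x y) (z * z')%C (q * q').
Proof.
  intros Hp Hz Hz' Hx Hy. unfold approx in *.
  pose proof (scale_pos p Hp) as HS. set (S := scale p) in *.
  set (X := toC p x) in *; set (Y := toC p y) in *.
  assert (Hr : Cmod (toC p (cmulz p x y) - X * Y)%C <= 2 / S).
  { unfold X, Y, toC, cmulz, Cminus, Cplus, Copp, Cmult; cbn [fst snd]. fold S.
    eapply Rle_trans; [apply Cmod_le_sum |].
    pose proof (Zshiftr_bounds (fst x * fst y - snd x * snd y) p Hp) as H1.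
    pose proof (Zshiftr_bounds (fst x * snd y + snd x * fst y) p Hp) as H2.
    fold S in H1, H2. rewrite minus_IZR, !mult_IZR in H1. rewrite plus_IZR, !mult_IZR in H2.
    set (r1 := IZR (Z.shiftr _ _)) in H1 |- *. set (r2 := IZR (Z.shiftr _ _)) in H2 |- *.
    clearbody r1 r2. clearbody S. clear - HS H1 H2.
    assert (E1 : forall r s, Rabs (r / S + - (s / S / S)) = Rabs (r - s / S) / S).
    { intros. replace (r / S + - (s / S / S)) with ((r - s / S) / S) by (field; lra).
      unfold Rdiv at 1. rewrite Rabs_mult, (Rabs_pos_eq (/ S)); auto. left; apply Rinv_0_lt_compat; auto. }
    replace (IZR (fst x) / S * (IZR (fst y) / S) - IZR (snd x) / S * (IZR (snd y) / S))
      with ((IZR (fst x) * IZR (fst y) - IZR (snd x) * IZR (snd y)) / S / S) by (field; lra).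
    replace (IZR (fst x) / S * (IZR (snd y) / S) + IZR (snd x) / S * (IZR (fst y) / S))
      with ((IZR (fst x) * IZR (snd y) + IZR (snd x) * IZR (fst y)) / S / S) by (field; lra).
    rewrite !E1.
    replace (2 / S) with (1 / S + 1 / S) by (field; lra).
    apply Rplus_le_compat; apply Rmult_le_compat_r; try (left; apply Rinv_0_lt_compat; auto);
      apply Rabs_le; lra. }
  assert (Hd : Cmod (X * Y - z * z')%C <= Cmod (X - z)%C + Cmod (Y - z')%C + Cmod (X - z)%C * Cmod (Y - z')%C).
  { replace (X * Y - z * z')%C with ((X - z) * z' + z * (Y - z') + (X - z) * (Y - z'))%C by ring.
    eapply Rle_trans; [apply Cmod_triangle |].
    rewrite (Cmod_mult (X - z) (Y - z')). apply Rplus_le_compat_r.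
    eapply Rle_trans; [apply Cmod_triangle |]. rewrite !Cmod_mult.
    pose proof (Cmod_ge_0 (X - z)); pose proof (Cmod_ge_0 (Y - z')).
    apply Rplus_le_compat; [| rewrite <- (Rmult_1_l (Cmod (Y - z')%C)) at 2; apply Rmult_le_compat_r; auto].
    rewrite <- (Rmult_1_r (Cmod (X - z)%C)) at 2. apply Rmult_le_compat_l; auto. }
  assert (Htr : Cmod (toC p (cmulz p x y) - z * z')%C <= 2 / S + Cmod (X * Y - z * z')%C).
  { replace (toC p (cmulz p x y) - z * z')%C with ((toC p (cmulz p x y) - X * Y) + (X * Y - z * z'))%C by ring.
    eapply Rle_trans; [apply Cmod_triangle |]. lra. }
  pose proof (Cmod_ge_0 (X - z)) as H1; pose proof (Cmod_ge_0 (Y - z')) as H2.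
  assert (Hrho : 0 < 2 / S) by (apply Rdiv_lt_0_compat; lra).
  set (rho := 2 / S) in *. set (e := Cmod (X - z)%C) in *; set (d := Cmod (Y - z')%C) in *.
  assert (e * d <= (q - 1 - rho) * (q' - 1 - rho)) by (apply Rmult_le_compat; lra).
  nra.
Qed.

Fixpoint cpowz (p : Z) (x : Z * Z) (k : positive) : Z * Z :=
  match k with
  | xH => x
  | xO k' => let y := cpowz p x k' in cmulz p y y
  | xI k' => let y := cpowz p x k' in cmulz p x (cmulz p y y)
  end.

(** Angles add and qualities multiply in every product, so the quality is [q ^ k] however the
    squarings are arranged. *)
Lemma approx_cis_pow (p : Z) (x : Z * Z) (th q : R) (k : positive) :
  (0 <= p)%Z -> approx p x (cis th) q ->
  approx p (cpowz p x k) (cis (IZR (Z.pos k) * th)) (q ^ Pos.to_nat k).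
Proof.
  intros Hp Hx.
  assert (H1 : forall y, Cmod (cis y) <= 1) by (intros; rewrite Cmod_cis; lra).
  induction k as [k IH | k IH |]; cbn [cpowz].
  - rewrite Pos2Nat.inj_xI. simpl pow. rewrite Nat.add_0_r, pow_add.
    rewrite Pos2Z.inj_xI, plus_IZR, mult_IZR.
    replace ((2 * IZR (Z.pos k) + 1) * th) with (th + (IZR (Z.pos k) * th + IZR (Z.pos k) * th)) by ring.
    rewrite !cis_add. rewrite <- cis_add.
    apply approx_mul; auto. rewrite cis_add. apply approx_mul; auto.
  - rewrite Pos2Nat.inj_xO. simpl Nat.mul. rewrite Nat.add_0_r, pow_add.
    rewrite Pos2Z.inj_xO, mult_IZR.
    replace (2 * IZR (Z.pos k) * th) with (IZR (Z.pos k) * th + IZR (Z.pos k) * th) by ring.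
    rewrite cis_add. apply approx_mul; auto.
  - rewrite Rmult_1_l. simpl. rewrite Rmult_1_r. auto.
Qed.

Lemma approx_weaken (p : Z) (x : Z * Z) (z : C) (q q' : R) :
  q <= q' -> approx p x z q -> approx p x z q'.
Proof. unfold approx. lra. Qed.


(** From [(1 + e) ^ k * (1 - k e) <= 1] and [1 / (1 - y) <= 1 + 2 y] for [0 <= y <= 1 / 2]. *)
Lemma one_plus_pow_le (e : R) (k : nat) : 0 <= e -> INR k * e <= 1 / 2 -> (1 + e) ^ k <= 1 + 2 * (INR k * e).
Proof.
  intros He Hk.
  assert (Hind : forall j, (j <= k)%nat -> (1 + e) ^ j * (1 - INR j * e) <= 1).
  { induction j as [| j IH]; intros Hj.
    - simpl. lra.
    - specialize (IH ltac:(lia)).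
      assert (Hp : 0 < (1 + e) ^ j) by (apply pow_lt; lra).
      rewrite S_INR. simpl pow. pose proof (pos_INR j).
      assert (0 <= (1 + e) ^ j * ((INR j + 1) * e * e)).
      { apply Rmult_le_pos; [lra |]. repeat apply Rmult_le_pos; lra. }
      nra. }
  specialize (Hind k ltac:(lia)).
  pose proof (pos_INR k). assert (0 <= INR k * e) by (apply Rmult_le_pos; auto).
  set (y := INR k * e) in *. clearbody y.
  assert (Hp : 0 < (1 + e) ^ k) by (apply pow_lt; lra).
  set (P := (1 + e) ^ k) in *. clearbody P.
  assert (1 <= (1 + 2 * y) * (1 - y)) by nra.
  apply Rmult_le_reg_r with (1 - y); lra.
Qed.

(** * Logarithms of integers from the artanh series *)

Lemma is_derive_pow_div (m : nat) (x : R) :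
  is_derive (fun x => 2 * x ^ S m / INR (S m)) x (2 * x ^ m).
Proof.
  assert (Hm : INR (S m) <> 0) by (apply not_0_INR; lia).
  auto_derive; auto. cbn [Init.Nat.pred]. set (c := INR (S m)) in *.
  change (match m with O => 1 | S _ => INR m + 1 end) with c. field; auto.
Qed.

(** The remainder vanishes at 0 and has derivative [2 x ^ (2 K) / (1 - x ^ 2)], the tail of a
    geometric series. This is nonnegative and largest at [y], so the remainder is at most [y] times
    that value. *)
Lemma artanh_series_bounds (K : nat) (y : R) :
  0 <= y < 1 ->
  0 <= ln ((1 + y) / (1 - y)) - rsum (fun k => 2 * y ^ (2 * k + 1) / INR (2 * k + 1)) 0 K
    <= 2 * y ^ (2 * K + 1) / (1 - y * y).
Proof.
  intros Hy.
  set (g := fun x => ln (1 + x) - ln (1 - x) - rsum (fun k => 2 * x ^ (2 * k + 1) / INR (2 * k + 1)) 0 K).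
  assert (Hg : forall x, 0 <= x <= y -> is_derive g x (2 * x ^ (2 * K) / (1 - x * x))).
  { intros x Hx. unfold g.
    replace (2 * x ^ (2 * K) / (1 - x * x))
      with ((/ (1 + x) - - / (1 - x)) - 2 * (1 - x ^ (2 * K)) / (1 - x * x)) by (field; nra).
    apply (is_derive_minus (fun x => ln (1 + x) - ln (1 - x))).
    - auto_derive; [lra |]. field; lra.
    - induction K as [| K IH].
      + simpl. replace (2 * (1 - 1) / (1 - x * x)) with 0 by (field; nra). auto_derive; auto.
      + apply (is_derive_ext (fun x => rsum (fun k => 2 * x ^ (2 * k + 1) / INR (2 * k + 1)) 0 K
             + 2 * x ^ (2 * K + 1) / INR (2 * K + 1))).
        { intros z. rewrite rsum_S. reflexivity. }
        replace (2 * (1 - x ^ (2 * S K)) / (1 - x * x))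
          with (2 * (1 - x ^ (2 * K)) / (1 - x * x) + 2 * x ^ (2 * K)).
        * apply (is_derive_plus (fun x => rsum (fun k => 2 * x ^ (2 * k + 1) / INR (2 * k + 1)) 0 K)); auto.
          rewrite Nat.add_1_r. apply is_derive_pow_div.
        * replace (2 * S K)%nat with (S (S (2 * K))) by lia. simpl pow. field; nra. }
  assert (E0 : g 0 = 0).
  { unfold g. rewrite Rplus_0_r, Rminus_0_r, ln_1.
    rewrite (rsum_ext _ (fun _ => 0)).
    - assert (forall m l, rsum (fun _ => 0) m l = 0) as Z.
      { intros m l; revert m; induction l as [| l IH]; intros m; simpl; auto. rewrite IH; ring. }
      rewrite Z. ring.
    - intros n _. rewrite Nat.add_1_r. simpl. unfold Rdiv. ring. }
  rewrite ln_div by lra.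
  change (0 <= g y <= 2 * y ^ (2 * K + 1) / (1 - y * y)).
  assert (Hyy : 0 < 1 - y * y) by nra.
  split.
  - rewrite <- E0. apply (nonneg_derive_le g (fun x => 2 * x ^ (2 * K) / (1 - x * x))); [lra | auto |].
    intros x Hx. apply Rmult_le_pos; [apply Rmult_le_pos; [lra | apply pow_le; lra] |].
    left; apply Rinv_0_lt_compat. nra.
  - assert (H : 2 * y ^ (2 * K) / (1 - y * y) * 0 - g 0 <= 2 * y ^ (2 * K) / (1 - y * y) * y - g y).
    { apply (nonneg_derive_le (fun x => 2 * y ^ (2 * K) / (1 - y * y) * x - g x)
        (fun x => 2 * y ^ (2 * K) / (1 - y * y) - 2 * x ^ (2 * K) / (1 - x * x))); [lra | |].
      - intros x Hx.
        apply (is_derive_minus (fun x => 2 * y ^ (2 * K) / (1 - y * y) * x) g); auto.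
        generalize (2 * y ^ (2 * K) / (1 - y * y)); intros c. auto_derive; auto. ring.
      - intros x Hx.
        enough (2 * x ^ (2 * K) / (1 - x * x) <= 2 * y ^ (2 * K) / (1 - y * y)) by lra.
        apply Rmult_le_compat.
        + apply Rmult_le_pos; [lra | apply pow_le; lra].
        + left; apply Rinv_0_lt_compat; nra.
        + apply Rmult_le_compat_l; [lra |]. apply pow_incr; lra.
        + apply Rinv_le_contravar; nra. }
    rewrite E0 in H. rewrite Nat.add_1_r. cbn [pow].
    replace (2 * (y * y ^ (2 * K)) / (1 - y * y)) with (2 * y ^ (2 * K) / (1 - y * y) * y) by (field; lra).
    lra.
Qed.

(** Partial sum of [2 artanh (1 / N)] in units of [2 ^ (- 60)], with [pw = N ^ (2 k + 1)] and
    [sq = N ^ 2]; each floor division loses at most one unit. *)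
Fixpoint artanhz (terms : nat) (k pw sq : Z) : Z :=
  match terms with
  | O => 0
  | S m => 2 ^ 61 / ((2 * k + 1) * pw) + artanhz m (k + 1) (pw * sq) sq
  end%Z.

Lemma artanhz_bounds (terms k : nat) (N : Z) :
  (1 <= N)%Z ->
  scale 60 * rsum (fun k => 2 * (/ IZR N) ^ (2 * k + 1) / INR (2 * k + 1)) k terms - INR terms
    <= IZR (artanhz terms (Z.of_nat k) (N ^ (2 * Z.of_nat k + 1)) (N * N))
    <= scale 60 * rsum (fun k => 2 * (/ IZR N) ^ (2 * k + 1) / INR (2 * k + 1)) k terms.
Proof.
  intros HN. assert (HNr : 1 <= IZR N) by (apply IZR_le; auto).
  revert k; induction terms as [| m IH]; intros k.
  - simpl. lra.
  - cbn [artanhz rsum]. rewrite plus_IZR, S_INR.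
    replace (Z.of_nat k + 1)%Z with (Z.of_nat (S k)) by lia.
    replace (N ^ (2 * Z.of_nat k + 1) * (N * N))%Z with (N ^ (2 * Z.of_nat (S k) + 1))%Z.
    2:{ replace (2 * Z.of_nat (S k) + 1)%Z with (2 * Z.of_nat k + 1 + 2)%Z by lia.
        rewrite Z.pow_add_r by lia. ring. }
    specialize (IH (S k)).
    assert (Hpos : (0 < N ^ (2 * Z.of_nat k + 1))%Z) by (apply Z.pow_pos_nonneg; lia).
    pose proof (Zdiv_bounds (2 ^ 61) ((2 * Z.of_nat k + 1) * N ^ (2 * Z.of_nat k + 1)) ltac:(nia)) as H.
    assert (E : IZR (2 ^ 61) / IZR ((2 * Z.of_nat k + 1) * N ^ (2 * Z.of_nat k + 1))
       = scale 60 * (2 * (/ IZR N) ^ (2 * k + 1) / INR (2 * k + 1))).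
    { rewrite mult_IZR.
      replace (2 * Z.of_nat k + 1)%Z with (Z.of_nat (2 * k + 1)) by lia.
      rewrite <- INR_IZR_INZ, <- pow_IZR, pow_inv.
      change (IZR (2 ^ 61)) with (IZR (2 ^ 60 * 2)). rewrite mult_IZR. unfold scale.
      field. split; [apply pow_nonzero; lra | apply not_0_INR; lia]. }
    rewrite E in H. lra.
Qed.

(** Rests on [ln ((n + 1) / n) = 2 artanh (1 / (2 n + 1))]. *)
Definition lnstep (n : Z) : Z := artanhz 16 0 (2 * n + 1) ((2 * n + 1) * (2 * n + 1)).

Lemma lnstep_bounds (n : nat) :
  (1 <= n)%nat ->
  Rabs (IZR (lnstep (Z.of_nat n)) - scale 60 * (ln (INR (S n)) - ln (INR n))) <= scale 12.
Proof.
  intros Hn. assert (Hn1 : 1 <= INR n) by (apply one_le_INR; auto).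
  pose proof (artanhz_bounds 16 0 (2 * Z.of_nat n + 1) ltac:(lia)) as H.
  change (2 * Z.of_nat 0 + 1)%Z with 1%Z in H. rewrite Z.pow_1_r in H. change (Z.of_nat 0) with 0%Z in H.
  fold (lnstep (Z.of_nat n)) in H.
  assert (EN : IZR (2 * Z.of_nat n + 1) = 2 * INR n + 1) by (rewrite plus_IZR, mult_IZR, <- INR_IZR_INZ; reflexivity).
  rewrite EN in H. set (y := / (2 * INR n + 1)) in *.
  assert (Hy : 0 < y <= / 3).
  { unfold y. split; [apply Rinv_0_lt_compat; lra | apply Rinv_le_contravar; lra]. }
  pose proof (artanh_series_bounds 16 y ltac:(lra)) as Ha.
  replace ((1 + y) / (1 - y)) with (INR (S n) / INR n) in Ha
    by (rewrite S_INR; unfold y; field; repeat split; lra).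
  rewrite ln_div in Ha by (try rewrite S_INR; lra).
  assert (Hyp : 2 * y ^ (2 * 16 + 1) / (1 - y * y) <= 4 / 3 ^ 33).
  { replace (4 / 3 ^ 33) with (2 * / 3 ^ 33 * 2) by (field; apply pow_nonzero; lra).
    apply Rmult_le_compat.
    - apply Rmult_le_pos; [lra | apply pow_le; lra].
    - left; apply Rinv_0_lt_compat; nra.
    - apply Rmult_le_compat_l; [lra |]. rewrite <- pow_inv. apply pow_incr; lra.
    - rewrite <- (Rinv_inv 2). apply Rinv_le_contravar; nra. }
  (* The series remainder is worst at [n = 1], where [y = 1 / 3]. Together with the 16 floor
     divisions the error stays well below [2 ^ 12] units. *)
  assert (Hc : scale 60 * (4 / 3 ^ 33) <= 1000).
  { unfold scale. apply Rmult_le_reg_r with (3 ^ 33); [apply pow_lt; lra |].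
    replace (IZR (2 ^ 60) * (4 / 3 ^ 33) * 3 ^ 33) with (IZR (2 ^ 60) * 4) by (field; apply pow_nonzero; lra).
    rewrite pow_IZR, <- !mult_IZR. apply IZR_le. vm_compute. discriminate. }
  assert (Hs : 0 < scale 60) by (apply scale_pos; lia).
  set (s := rsum _ 0 16) in *. clearbody s.
  rewrite (INR_IZR_INZ 16) in H; simpl Z.of_nat in H.
  assert (Hs12 : scale 12 = 4096) by reflexivity.
  set (d := ln (INR (S n)) - ln (INR n)) in *.
  set (Y := 2 * y ^ (2 * 16 + 1) / (1 - y * y)) in *. clearbody Y d.
  rewrite Hs12. apply Rabs_le. split; nra.
Qed.

Fixpoint lnlist (cnt : nat) (n l : Z) : list Z :=
  match cnt with
  | O => nil
  | S c => l :: lnlist c (n + 1) (l + lnstep n)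
  end%Z.

(** The running index is the integer [n] whose logarithm, power or Dirichlet term the entry
    represents. *)
Fixpoint list_inv {A : Type} (P : nat -> A -> Prop) (n : nat) (l : list A) : Prop :=
  match l with nil => True | x :: l' => P n x /\ list_inv P (S n) l' end.

Lemma lnlist_inv (cnt n : nat) (l : Z) :
  (1 <= n)%nat -> Rabs (IZR l - scale 60 * ln (INR n)) <= INR n * scale 12 ->
  list_inv (fun n l => Rabs (IZR l - scale 60 * ln (INR n)) <= INR n * scale 12) n
    (lnlist cnt (Z.of_nat n) l).
Proof.
  revert n l; induction cnt as [| c IH]; intros n l Hn Hl; cbn [lnlist list_inv]; auto.
  split; auto.
  replace (Z.of_nat n + 1)%Z with (Z.of_nat (S n)) by lia.
  apply IH; [lia |].
  pose proof (lnstep_bounds n Hn) as H.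
  rewrite plus_IZR, S_INR.
  replace (IZR l + IZR (lnstep (Z.of_nat n)) - scale 60 * ln (INR n + 1))
    with ((IZR l - scale 60 * ln (INR n)) + (IZR (lnstep (Z.of_nat n)) - scale 60 * (ln (INR (S n)) - ln (INR n))))
    by (rewrite S_INR; ring).
  eapply Rle_trans; [apply Rabs_triang |]. lra.
Qed.

Lemma list_inv_map {A B : Type} (P : nat -> A -> Prop) (Q : nat -> B -> Prop) (f : A -> B) (N n : nat) (l : list A) :
  (forall k x, (n <= k <= N)%nat -> P k x -> Q k (f x)) -> (n + length l <= S N)%nat ->
  list_inv P n l -> list_inv Q n (map f l).
Proof.
  revert n; induction l as [| x l IH]; intros n H HN Hl; cbn in *; auto.
  destruct Hl as [Hx Hl]. split; [apply H; auto; lia |]. apply IH; auto; [| lia].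
  intros; apply H; auto; lia.
Qed.

(** * The table of powers [n ^ (- i / 8)] *)

Lemma sin_sub_bounds (x : R) : 0 <= x -> 0 <= x - sin x <= x * x * x / 6.
Proof.
  assert (H1 : forall x, 0 <= x -> sin x <= x).
  { intros y Hy. enough (0 - sin 0 <= y - sin y) by (rewrite sin_0 in H; lra).
    apply (nonneg_derive_le (fun x => x - sin x) (fun x => 1 - cos x)); [lra | |].
    - intros z Hz. auto_derive; auto. ring.
    - intros z Hz. pose proof (COS_bound z). lra. }
  assert (H2 : forall x, 0 <= x -> 1 - x * x / 2 <= cos x).
  { intros y Hy. enough (cos 0 - (1 - 0 * 0 / 2) <= cos y - (1 - y * y / 2)) by (rewrite cos_0 in H; lra).
    apply (nonneg_derive_le (fun x => cos x - (1 - x * x / 2)) (fun x => x - sin x)); [lra | |].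
    - intros z Hz. auto_derive; auto. field.
    - intros z Hz. specialize (H1 z ltac:(lra)). lra. }
  intros Hx. split; [specialize (H1 x Hx); lra |].
  enough (0 * 0 * 0 / 6 - (0 - sin 0) <= x * x * x / 6 - (x - sin x)) by (rewrite sin_0 in H; lra).
  apply (nonneg_derive_le (fun x => x * x * x / 6 - (x - sin x)) (fun x => x * x / 2 - (1 - cos x))); [lra | |].
  - intros z Hz. auto_derive; auto. field.
  - intros z Hz. specialize (H2 z ltac:(lra)). lra.
Qed.

Lemma cos_sub_bounds (x : R) : 0 <= x -> 0 <= cos x - (1 - x * x / 2) <= x * x * x * x / 24.
Proof.
  intros Hx. split.
  - enough (cos 0 - (1 - 0 * 0 / 2) <= cos x - (1 - x * x / 2)) by (rewrite cos_0 in H; lra).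
    apply (nonneg_derive_le (fun x => cos x - (1 - x * x / 2)) (fun x => x - sin x)); [lra | |].
    + intros z Hz. auto_derive; auto. field.
    + intros z Hz. pose proof (sin_sub_bounds z ltac:(lra)). lra.
  - enough (0 * 0 * 0 * 0 / 24 - (cos 0 - (1 - 0 * 0 / 2)) <= x * x * x * x / 24 - (cos x - (1 - x * x / 2)))
      by (rewrite cos_0 in H; lra).
    apply (nonneg_derive_le (fun x => x * x * x * x / 24 - (cos x - (1 - x * x / 2)))
        (fun x => x * x * x / 6 - (x - sin x))); [lra | |].
    + intros z Hz. auto_derive; auto. field.
    + intros z Hz. pose proof (sin_sub_bounds z ltac:(lra)). lra.
Qed.

Lemma cis_taylor (x : R) : Rabs x <= 1 -> Cmod (((1 - x * x / 2)%R, x) - cis x)%C <= Rabs x * Rabs x * Rabs x / 4.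
Proof.
  intros Hx. unfold cis, Cminus, Cplus, Copp; cbn [fst snd]. eapply Rle_trans; [apply Cmod_le_sum |].
  assert (H : forall y, 0 <= y <= 1 -> Rabs (1 - y * y / 2 + - cos y) + Rabs (y + - sin y) <= y * y * y / 4).
  { intros y Hy. pose proof (sin_sub_bounds y ltac:(lra)) as Hs. pose proof (cos_sub_bounds y ltac:(lra)) as Hc.
    rewrite Rabs_left1 by lra. rewrite Rabs_pos_eq by lra.
    assert (0 <= y * y * y) by (repeat apply Rmult_le_pos; lra).
    assert (y * y * y * y <= y * y * y * 1) by (apply Rmult_le_compat_l; lra). lra. }
  destruct (Rle_dec 0 x) as [Hp | Hn].
  - rewrite (Rabs_pos_eq x) in * by auto. apply H; lra.
  - rewrite (Rabs_left1 x) in * by lra. specialize (H (- x) ltac:(lra)).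
    rewrite cos_neg, sin_neg in H.
    rewrite <- (Rabs_Ropp (x + - sin x)).
    replace (- (x + - sin x)) with (- x + - - sin x) by ring.
    replace (x * x / 2) with (- x * - x / 2) by field. exact H.
Qed.

Lemma cis_lipschitz (x y : R) : Cmod (cis x - cis y)%C <= Rabs (x - y).
Proof.
  assert (H : forall x y, y <= x -> Cmod (cis x - cis y)%C <= x - y).
  { clear x y; intros x y Hxy. apply Cmod_le_of_proj. intros a b Hab. unfold cis, Re, Im; simpl.
    enough (y - (a * cos y + b * sin y) <= x - (a * cos x + b * sin x)) by lra.
    apply (nonneg_derive_le (fun x => x - (a * cos x + b * sin x)) (fun x => 1 - (b * cos x - a * sin x))); auto.
    - intros z Hz. auto_derive; auto. ring.
    - intros z Hz. pose proof (proj_le_Cmod (cis z) b (- a) ltac:(lra)) as H.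
      rewrite Cmod_cis in H. unfold cis, Re, Im in H; simpl in H. lra. }
  destruct (Rle_dec y x) as [Hle | Hle].
  - rewrite Rabs_pos_eq by lra. auto.
  - replace (cis x - cis y)%C with (- (cis y - cis x))%C by ring.
    rewrite Cmod_opp, Rabs_left1 by lra. specialize (H y x). lra.
Qed.

(** With [l] close to [2 ^ 60 * ln n], [th] represents the angle [ln n / 2 ^ 19] at scale [2 ^ 60].
    That angle is so small that the quadratic Taylor polynomial suffices; shifting the square by 61
    includes the division by 2. *)
Definition cis_init (l : Z) : Z * Z :=
  let th := Z.shiftr l 19 in (2 ^ 60 - Z.shiftr (th * th) 61, - th)%Z.

Lemma approx_cis_init (n : nat) (l : Z) :
  (1 <= n <= 80)%nat -> Rabs (IZR l - scale 60 * ln (INR n)) <= INR n * scale 12 ->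
  approx 60 (cis_init l) (cis (- (ln (INR n) / IZR (2 ^ 19)))) (1 + / IZR (2 ^ 51)).
Proof.
  intros Hn Hl.
  assert (Hn1 : 1 <= INR n) by (apply one_le_INR; lia).
  assert (Hn2 : INR n <= 80) by (replace 80 with (INR 80) by (rewrite INR_IZR_INZ; reflexivity); apply le_INR; lia).
  assert (Hln : 0 <= ln (INR n) <= 5).
  { split.
    - rewrite <- ln_1. destruct (Req_dec 1 (INR n)) as [<- | E]; [lra |]. left; apply ln_increasing; lra.
    (* [exp 5 > 80] is derived from [exp (1 / 4) > 5 / 4]: its fourth power exceeds [61 / 25], and
       the fifth power of that exceeds 80. *)
    - rewrite <- (ln_exp 5). left; apply ln_increasing; [lra |].
      replace (exp 5) with (exp (1 + 1 + 1 + 1 + 1)) by (f_equal; ring). rewrite !exp_plus.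
      pose proof (exp_ineq1 (1 / 4) ltac:(lra)) as H.
      assert (H2 : 1 + 1 / 4 < exp (1 / 4)) by lra.
      assert (H3 : 61 / 25 < exp 1).
      { replace (exp 1) with (exp (1 / 4 + 1 / 4 + 1 / 4 + 1 / 4)) by (f_equal; field). rewrite !exp_plus.
        set (e := exp (1 / 4)) in *.
        assert (25 / 16 < e * e) by nra. replace (e * e * e * e) with ((e * e) * (e * e)) by ring. nra. }
      set (e := exp 1) in *. clearbody e.
      assert (3721 / 625 < e * e) by nra.
      assert (35 < (e * e) * (e * e)) by nra.
      replace (e * e * e * e * e) with ((e * e) * (e * e) * e) by ring. nra. }
  pose proof (Zshiftr_bounds l 19 ltac:(lia)) as Hth.
  set (th := Z.shiftr l 19) in *.
  pose proof (Zshiftr_bounds (th * th) 61 ltac:(lia)) as Hsq.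
  assert (ES : scale 60 = 1152921504606846976) by reflexivity.
  assert (ES2 : scale 61 = 2 * 1152921504606846976) by (unfold scale; rewrite <- mult_IZR; reflexivity).
  assert (ES3 : scale 19 = 524288) by reflexivity.
  assert (ES4 : scale 12 = 4096) by reflexivity.
  rewrite ES4, ES in Hl. rewrite ES3 in Hth. rewrite ES2, mult_IZR in Hsq.
  apply Rabs_le_between in Hl.
  unfold approx, toC, cis_init. fold th. cbn [fst snd]. rewrite ES.
  rewrite minus_IZR, opp_IZR.
  change (IZR (2 ^ 60)) with 1152921504606846976. change (IZR (2 ^ 19)) with 524288.
  change (IZR (2 ^ 51)) with 2251799813685248.
  set (sq := Z.shiftr (th * th) 61) in *. clearbody sq th.
  set (x := IZR th / 1152921504606846976).
  set (L := ln (INR n)) in *. clearbody L.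
  assert (Ex : IZR th = 1152921504606846976 * x) by (unfold x; field).
  rewrite Ex in *. clearbody x.
  assert (Hx : Rabs (x - L / 524288) <= 2 / 1152921504606846976) by (apply Rabs_le; lra).
  assert (Hxx : Rabs x <= 6 / 524288) by (apply Rabs_le; apply Rabs_le_between in Hx; lra).
  assert (Hx1 : Rabs x <= 1) by lra.
  pose proof (cis_taylor (- x)) as HT. rewrite Rabs_Ropp in HT. specialize (HT Hx1).
  pose proof (cis_lipschitz (- x) (- (L / 524288))) as HL.
  replace (- x - - (L / 524288)) with (- (x - L / 524288)) in HL by ring. rewrite Rabs_Ropp in HL.
  match goal with |- Cmod ?z <= _ =>
    replace z with ((((1 - - x * - x / 2)%R, (- x)%R) - cis (- x)%R) + (cis (- x)%R - cis (- (L / 524288))%R)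
      + RtoC (x * x / 2 - IZR sq / 1152921504606846976)%R)%C end.
  2:{ apply injective_projections; simpl; field. }
  eapply Rle_trans; [apply Cmod_triangle |].
  eapply Rle_trans; [apply Rplus_le_compat_r, Cmod_triangle |].
  rewrite Cmod_R.
  assert (Hsq' : Rabs (x * x / 2 - IZR sq / 1152921504606846976) <= 1 / 1152921504606846976).
  { apply Rabs_le. lra. }
  (* The cubic Taylor remainder dominates the error budget [2 ^ (- 51)]; the rounding contributions
     are a few multiples of [2 ^ (- 60)]. *)
  assert (Hcube : Rabs x * Rabs x * Rabs x <= 6 / 524288 * (6 / 524288) * (6 / 524288)).
  { pose proof (Rabs_pos x). repeat apply Rmult_le_compat; try lra. apply Rmult_le_pos; lra. }
  lra.
Qed.

(* [2 ^ 16 * 8 = 2 ^ 19]: the entry for [n] approximates [n ^ (- i / 8)]. *)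
Definition tab_pow (l : Z) : Z * Z := cpowz 60 (cis_init l) 65536.
Definition tab_gen : list (Z * Z) := map tab_pow (lnlist 80 1 0).

Lemma tab_gen_inv :
  list_inv (fun n x => approx 60 x (cis (- (ln (INR n) / 8))) (1 + / IZR (2 ^ 34))) 1 tab_gen.
Proof.
  unfold tab_gen.
  apply (list_inv_map (fun n l => Rabs (IZR l - scale 60 * ln (INR n)) <= INR n * scale 12) _ _ 80).
  - intros k l Hk Hl. pose proof (approx_cis_init k l Hk Hl) as H.
    apply (approx_cis_pow _ _ _ _ 65536) in H; [| lia].
    replace (IZR 65536 * - (ln (INR k) / IZR (2 ^ 19))) with (- (ln (INR k) / 8)) in H.
    2:{ change (IZR (2 ^ 19)) with 524288. field. }
    refine (approx_weaken _ _ _ _ _ _ H).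
    (* [2 ^ 16] factors with excess [2 ^ (- 51)] give [2 ^ (- 35)], and [one_plus_pow_le] doubles
       it. *)
    eapply Rle_trans; [apply one_plus_pow_le |].
    + left; apply Rinv_0_lt_compat, IZR_lt. reflexivity.
    + rewrite INR_IZR_INZ, positive_nat_Z. change (IZR (2 ^ 51)) with 2251799813685248. lra.
    + rewrite INR_IZR_INZ, positive_nat_Z. change (IZR (2 ^ 51)) with 2251799813685248.
      change (IZR (2 ^ 34)) with 17179869184. lra.
  - vm_compute. lia.
  - apply (lnlist_inv 80 1); [lia |]. simpl INR. rewrite ln_1, Rmult_0_r, Rminus_0_r, Rabs_R0.
    unfold scale; simpl; lra.
Qed.

Definition tab : list (Z * Z) := Eval vm_compute in tab_gen.

Lemma tab_inv :
  list_inv (fun n x => approx 60 x (cis (- (ln (INR n) / 8))) (1 + / IZR (2 ^ 34))) 1 tab.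
Proof.
  replace tab with tab_gen by (vm_compute; reflexivity). exact tab_gen_inv.
Qed.

(** * Interpolation in t *)

(** [f + K x ^ 2 / 2] is convex, hence lies below its chord, and for the added parabola the chord
    exceeds the curve by [K s (h - s) / 2 <= K h ^ 2 / 8]. *)
Lemma chord_le (f f1 f2 : R -> R) (a h K s : R) :
  0 < h -> 0 <= K -> 0 <= s <= h ->
  (forall x, a <= x <= a + h -> is_derive f x (f1 x)) ->
  (forall x, a <= x <= a + h -> is_derive f1 x (f2 x)) ->
  (forall x, a <= x <= a + h -> - K <= f2 x) ->
  f (a + s) <= (1 - s / h) * f a + s / h * f (a + h) + K * (h * h / 8).
Proof.
  intros Hh HK Hs Hf Hf1 Hf2.
  set (c := a + s) in *.
  (* Slope at [c] of the convex function; the tangent there is compared with both endpoints. *)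
  set (g' := f1 c + K * c).
  assert (Hmono : forall x y, a <= x <= y -> y <= a + h -> f1 x + K * x <= f1 y + K * y).
  { intros x y Hxy Hy.
    apply (nonneg_derive_le (fun x => f1 x + K * x) (fun x => f2 x + K)); [lra | |].
    - intros z Hz. apply (is_derive_plus f1 (fun x => K * x)); [apply Hf1; lra |].
      auto_derive; auto; ring.
    - intros z Hz. specialize (Hf2 z ltac:(lra)). lra. }
  assert (Hd : forall z, a <= z <= a + h -> is_derive (fun x => g' * x - (f x + K * (x * x) / 2)) z (g' - (f1 z + K * z))).
  { intros z Hz. apply (is_derive_minus (fun x => g' * x) (fun x => f x + K * (x * x) / 2)).
    - auto_derive; auto; ring.
    - apply (is_derive_plus f (fun x => K * (x * x) / 2)); [apply Hf; auto |]. auto_derive; auto; field. }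
  assert (H1 : g' * a - (f a + K * (a * a) / 2) <= g' * c - (f c + K * (c * c) / 2)).
  { apply (nonneg_derive_le (fun x => g' * x - (f x + K * (x * x) / 2)) (fun z => g' - (f1 z + K * z))).
    - unfold c; lra.
    - intros x Hx. apply Hd. unfold c in Hx; lra.
    - intros x Hx. specialize (Hmono x c ltac:(lra) ltac:(unfold c; lra)). unfold g'. lra. }
  assert (H2 : (f c + K * (c * c) / 2) - g' * c <= (f (a + h) + K * ((a + h) * (a + h)) / 2) - g' * (a + h)).
  { apply (nonneg_derive_le (fun x => (f x + K * (x * x) / 2) - g' * x) (fun z => (f1 z + K * z) - g')).
    - unfold c; lra.
    - intros x Hx. apply (is_derive_ext (fun x => - (g' * x - (f x + K * (x * x) / 2)))); [intros; simpl; ring |].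
      replace (f1 x + K * x - g') with (- (g' - (f1 x + K * x))) by ring.
      apply (is_derive_opp (fun x => g' * x - (f x + K * (x * x) / 2))). apply Hd. unfold c in Hx; lra.
    - intros x Hx. assert (a <= c) by (unfold c; lra).
      specialize (Hmono c x ltac:(lra) ltac:(lra)). unfold g'. lra. }
  assert (Hc : c = a + s) by reflexivity. clearbody c g'. subst c.
  assert (H3 : (h - s) * (f (a + s) + K * ((a + s) * (a + s)) / 2 - (f a + K * (a * a) / 2)) <= (h - s) * (g' * s))
    by (apply Rmult_le_compat_l; lra).
  assert (H4 : s * (g' * (h - s)) <= s * (f (a + h) + K * ((a + h) * (a + h)) / 2 - (f (a + s) + K * ((a + s) * (a + s)) / 2)))
    by (apply Rmult_le_compat_l; lra).
  apply Rmult_le_reg_l with h; auto.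
  replace (h * ((1 - s / h) * f a + s / h * f (a + h) + K * (h * h / 8)))
    with ((h - s) * f a + s * f (a + h) + K * (h * (h * h)) / 8) by (field; lra).
  assert (H5 : 0 <= K * h * ((h - 2 * s) * (h - 2 * s))).
  { apply Rmult_le_pos; [apply Rmult_le_pos; lra | apply Rle_0_sqr]. }
  nra.
Qed.

Definition chord_err (G : R -> C) (a h D : R) : Prop :=
  forall s, 0 <= s <= h ->
    Cmod (G (a + s)%R - (RtoC (1 - s / h) * G a + RtoC (s / h) * G (a + h)%R))%C <= D.

Lemma chord_err_le (G : R -> C) (a h D B s : R) :
  0 < h -> chord_err G a h D -> Cmod (G a) <= B -> Cmod (G (a + h)%R) <= B -> 0 <= s <= h ->
  Cmod (G (a + s)%R) <= B + D.
Proof.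
  intros Hh HG H0 H1 Hs. specialize (HG s Hs).
  assert (Hr : 0 <= s / h <= 1).
  { split; [apply Rmult_le_pos; [lra | left; apply Rinv_0_lt_compat; auto] |].
    apply Rmult_le_reg_r with h; auto. unfold Rdiv. rewrite Rmult_assoc, Rinv_l; lra. }
  set (r := s / h) in *. clearbody r.
  set (c := (RtoC (1 - r) * G a + RtoC r * G (a + h)%R)%C) in *.
  replace (G (a + s)%R) with ((G (a + s)%R - c) + c)%C by ring.
  eapply Rle_trans; [apply Cmod_triangle |].
  assert (Cmod c <= B).
  { unfold c. eapply Rle_trans; [apply Cmod_triangle |].
    rewrite !Cmod_mult, !Cmod_R, !Rabs_pos_eq by lra. nra. }
  lra.
Qed.

Lemma chord_err_plus (G1 G2 : R -> C) (a h D1 D2 : R) :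
  chord_err G1 a h D1 -> chord_err G2 a h D2 -> chord_err (fun x => G1 x + G2 x)%C a h (D1 + D2).
Proof.
  intros H1 H2 s Hs. specialize (H1 s Hs). specialize (H2 s Hs).
  match goal with |- Cmod ?z <= _ => replace z with
    ((G1 (a + s)%R - (RtoC (1 - s / h) * G1 a + RtoC (s / h) * G1 (a + h)%R))
    + (G2 (a + s)%R - (RtoC (1 - s / h) * G2 a + RtoC (s / h) * G2 (a + h)%R)))%C by ring end.
  eapply Rle_trans; [apply Cmod_triangle |]. lra.
Qed.

Lemma chord_err_ext (G1 G2 : R -> C) (a h D : R) :
  (forall x, G1 x = G2 x) -> chord_err G1 a h D -> chord_err G2 a h D.
Proof. intros E H s Hs. rewrite <- !E. apply H; auto. Qed.

Lemma chord_err_weaken (G : R -> C) (a h D D' : R) : D <= D' -> chord_err G a h D -> chord_err G a h D'.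
Proof. intros HD H s Hs. specialize (H s Hs). lra. Qed.

Lemma chord_err_scal (c : R) (G : R -> C) (a h D : R) :
  chord_err G a h D -> chord_err (fun x => RtoC c * G x)%C a h (Rabs c * D).
Proof.
  intros H s Hs. specialize (H s Hs).
  match goal with |- Cmod ?z <= _ => replace z with
    (RtoC c * (G (a + s)%R - (RtoC (1 - s / h) * G a + RtoC (s / h) * G (a + h)%R)))%C by ring end.
  rewrite Cmod_mult, Cmod_R. apply Rmult_le_compat_l; [apply Rabs_pos | auto].
Qed.

(** The second-derivative bound may be one-sided because it is assumed for every direction [(c, d)],
    opposite ones included. *)
Lemma chord_err_of_proj (G : R -> C) (G1 G2 : R -> R -> R -> R) (a h K : R) :
  0 < h -> 0 <= K ->
  (forall c d x, c * c + d * d <= 1 -> a <= x <= a + h ->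
     is_derive (fun x => c * Re (G x) + d * Im (G x)) x (G1 c d x)) ->
  (forall c d x, c * c + d * d <= 1 -> a <= x <= a + h -> is_derive (G1 c d) x (G2 c d x)) ->
  (forall c d x, c * c + d * d <= 1 -> a <= x <= a + h -> - K <= G2 c d x) ->
  chord_err G a h (K * (h * h / 8)).
Proof.
  intros Hh HK H1 H2 H3 s Hs. apply Cmod_le_of_proj. intros c d Hcd.
  pose proof (chord_le _ _ _ a h K s Hh HK Hs (fun x => H1 c d x Hcd) (fun x => H2 c d x Hcd) (fun x => H3 c d x Hcd)) as H.
  cbv beta in H. unfold Re, Im, Cminus, Cplus, Copp, Cmult, RtoC in *; cbn [fst snd] in *.
  lra.
Qed.

Lemma rot_lower (c d th : R) : c * c + d * d <= 1 -> - 1 <= c * cos th + d * sin th <= 1.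
Proof.
  intros H. pose proof (proj_le_Cmod (cis th) c d H) as H1. pose proof (proj_le_Cmod (cis th) (- c) (- d) ltac:(lra)) as H2.
  rewrite Cmod_cis in H1, H2. unfold cis, Re, Im in *; simpl in *. lra.
Qed.

Lemma chord_err_cis (mu a h : R) : 0 < h -> chord_err (fun x => cis (mu * x)) a h (mu * mu * (h * h / 8)).
Proof.
  intros Hh. apply (chord_err_of_proj _
    (fun c d x => mu * (d * cos (mu * x) - c * sin (mu * x)))
    (fun c d x => - (mu * mu) * (c * cos (mu * x) + d * sin (mu * x)))); auto.
  - apply Rle_0_sqr.
  - intros c d x Hcd Hx. unfold cis, Re, Im; cbn [fst snd]. auto_derive; auto. ring.
  - intros c d x Hcd Hx. auto_derive; auto. ring.
  - intros c d x Hcd Hx. pose proof (rot_lower c d (mu * x) Hcd). pose proof (Rle_0_sqr mu) as Hm; unfold Rsqr in Hm. nra.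
Qed.

Lemma chord_err_cis_div (mu a h : R) :
  0 < h -> 0 < a ->
  chord_err (fun x => cis (mu * x) * (- Ci * RtoC (/ x)))%C a h
    ((mu * mu / a + 2 * Rabs mu / (a * a) + 2 / (a * a * a)) * (h * h / 8)).
Proof.
  intros Hh Ha.
  assert (Hia : 0 < / a) by (apply Rinv_0_lt_compat; auto).
  apply (chord_err_of_proj _
    (fun c d x => mu * (c * cos (mu * x) + d * sin (mu * x)) / x - (c * sin (mu * x) - d * cos (mu * x)) / (x * x))
    (fun c d x => - (mu * mu) * (c * sin (mu * x) - d * cos (mu * x)) / x
        - 2 * mu * (c * cos (mu * x) + d * sin (mu * x)) / (x * x)
        + 2 * (c * sin (mu * x) - d * cos (mu * x)) / (x * x * x))); auto.
  - pose proof (Rabs_pos mu).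
    assert (0 <= mu * mu) by apply Rle_0_sqr.
    unfold Rdiv. rewrite !Rinv_mult.
    assert (0 < / a * / a) by (apply Rmult_lt_0_compat; auto).
    assert (0 < / a * / a * / a) by (apply Rmult_lt_0_compat; auto).
    repeat apply Rplus_le_le_0_compat; apply Rmult_le_pos; lra.
  - intros c d x Hcd Hx. apply (is_derive_ext (fun x => (c * sin (mu * x) - d * cos (mu * x)) / x)).
    { intros y. unfold cis, Re, Im, Cmult, Copp, Ci, RtoC, Rdiv; simpl. ring. }
    auto_derive; [lra |]. field; lra.
  - intros c d x Hcd Hx. auto_derive; [repeat split; try lra; nra |]. field; lra.
  - intros c d x Hcd Hx.
    assert (H1 : - 1 <= c * sin (mu * x) - d * cos (mu * x) <= 1).
    { pose proof (rot_lower (- d) c (mu * x) ltac:(lra)). lra. }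
    pose proof (rot_lower c d (mu * x) Hcd) as H2.
    set (A := c * sin (mu * x) - d * cos (mu * x)) in *. set (B := c * cos (mu * x) + d * sin (mu * x)) in *.
    clearbody A B.
    assert (Hix : 0 < / x <= / a) by (split; [apply Rinv_0_lt_compat | apply Rinv_le_contravar]; lra).
    assert (Hm : 0 <= mu * mu) by apply Rle_0_sqr.
    assert (HmB : mu * B <= Rabs mu).
    { eapply Rle_trans; [apply Rle_abs |]. rewrite Rabs_mult. rewrite <- (Rmult_1_r (Rabs mu)) at 2.
      apply Rmult_le_compat_l; [apply Rabs_pos | apply Rabs_le; lra]. }
    pose proof (Rabs_pos mu) as Hm0.
    unfold Rdiv. rewrite !Rinv_mult. set (y := / x) in *. set (b := / a) in *. clearbody y b.
    assert (Hyb : y * y <= b * b) by nra. assert (Hyy : 0 < y * y) by nra.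
    assert (Hyyb : y * y * y <= b * b * b) by (apply Rmult_le_compat; lra).
    assert (E1 : mu * mu * A * y <= mu * mu * b).
    { assert (A * y <= b) by nra. rewrite Rmult_assoc. apply Rmult_le_compat_l; auto. }
    assert (E2 : mu * B * (y * y) <= Rabs mu * (b * b)).
    { apply Rle_trans with (Rabs mu * (y * y)); [apply Rmult_le_compat_r; lra | apply Rmult_le_compat_l; lra]. }
    assert (E3 : - (b * b * b) <= A * (y * y * y)).
    { assert (0 < y * y * y) by nra. nra. }
    nra.
Qed.

Lemma chord_err_csum (G : nat -> R -> C) (D : nat -> R) (a h : R) (m len : nat) :
  0 < h ->
  (forall n, (m <= n < m + len)%nat -> chord_err (G n) a h (D n)) ->
  chord_err (fun x => csum (fun n => G n x) m len) a h (rsum D m len).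
Proof.
  intros Hh. revert m; induction len as [| len IH]; intros m H; simpl.
  - intros s Hs. match goal with |- Cmod ?z <= _ => replace z with (RtoC 0) by ring end. rewrite Cmod_0; lra.
  - apply (chord_err_plus (G m)); [apply H; lia | apply IH; intros; apply H; lia].
Qed.

(** Second moment of the frequencies [ln n] about [W] with weights [1 / n]. It bounds the second
    derivative in [t] of the sum of [n ^ (- 1 - i t)] after rotation by [cis (W * t)]. *)
Definition dispersion (W : R) (M : nat) : R :=
  rsum (fun n => / INR n * ((W - ln (INR n)) * (W - ln (INR n)))) 1 M.

Lemma zterm_eq (t : R) (n : nat) : (1 <= n)%nat -> zterm t n = (RtoC (/ INR n) * cis (- ln (INR n) * t))%C.
Proof.
  intros Hn. assert (1 <= INR n) by (apply one_le_INR; lia).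
  unfold zterm, ipow. rewrite RtoC_inv by lra.
  replace (- ln (INR n) * t) with (- (t * ln (INR n))) by ring. unfold Cdiv. ring.
Qed.

Lemma rsum_scal (c : R) (f : nat -> R) (m len : nat) : rsum (fun n => f n * c) m len = rsum f m len * c.
Proof. revert m; induction len as [| len IH]; intros m; simpl; [ring | rewrite IH; ring]. Qed.

Lemma csum_scal (c : C) (f : nat -> C) (m len : nat) : csum (fun n => c * f n)%C m len = (c * csum f m len)%C.
Proof. revert m; induction len as [| len IH]; intros m; simpl; [ring | rewrite IH; ring]. Qed.

(* Multiplying by [cis (W * t)] does not change the modulus, but it centres the frequencies, which
   makes linear interpolation in [t] more accurate. *)
Lemma chord_err_csum_zterm (W a h : R) (M : nat) :
  0 < h ->
  chord_err (fun t => cis (W * t) * csum (zterm t) 1 M)%C a h (dispersion W M * (h * h / 8)).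
Proof.
  intros Hh. unfold dispersion. rewrite <- rsum_scal.
  apply (chord_err_ext (fun t => csum (fun n => RtoC (/ INR n) * cis ((W - ln (INR n)) * t))%C 1 M)).
  - intros t. rewrite <- csum_scal. apply csum_ext. intros n Hn. rewrite zterm_eq by lia.
    replace ((W - ln (INR n)) * t) with (W * t + - ln (INR n) * t) by ring.
    rewrite cis_add. ring.
  - apply (chord_err_csum (fun n t => RtoC (/ INR n) * cis ((W - ln (INR n)) * t))%C); auto.
    intros n Hn. assert (1 <= INR n) by (apply one_le_INR; lia).
    eapply chord_err_weaken; [right |].
    2: apply (chord_err_scal (/ INR n) (fun t => cis ((W - ln (INR n)) * t))); apply chord_err_cis; auto.
    rewrite Rabs_pos_eq by (left; apply Rinv_0_lt_compat; lra). ring.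
Qed.

Definition em_approx (N : nat) (t : R) : C :=
  (csum (zterm t) 1 (N - 1) + ipow t (INR N) * (RtoC (/ (2 * INR N)) - Ci * RtoC (/ t)))%C.

Lemma chord_err_em_approx (N : nat) (a h : R) :
  0 < h -> 0 < a -> (1 <= N)%nat ->
  chord_err (em_approx N) a h
    ((dispersion 0 N + (ln (INR N) * ln (INR N) / a + 2 * ln (INR N) / (a * a) + 2 / (a * a * a))) * (h * h / 8)).
Proof.
  intros Hh Ha HN.
  assert (HN1 : 1 <= INR N) by (apply one_le_INR; lia).
  assert (Hl : 0 <= ln (INR N)).
  { rewrite <- ln_1. destruct (Req_dec 1 (INR N)) as [<- | E]; [lra |]. left; apply ln_increasing; lra. }
  apply (chord_err_ext (fun t => (cis (0 * t) * csum (zterm t) 1 (N - 1) + RtoC (/ (2 * INR N)) * cis (- ln (INR N) * t))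
        + cis (- ln (INR N) * t) * (- Ci * RtoC (/ t)))%C).
  - intros t. unfold em_approx, ipow. rewrite Rmult_0_l.
    replace (cis 0) with (RtoC 1) by (unfold cis; rewrite cos_0, sin_0; reflexivity).
    replace (- ln (INR N) * t) with (- (t * ln (INR N))) by ring. ring.
  - rewrite Rmult_plus_distr_r.
    apply (chord_err_plus (fun t => (cis (0 * t) * csum (zterm t) 1 (N - 1) + RtoC (/ (2 * INR N)) * cis (- ln (INR N) * t))%C)).
    (* The half-weighted term at [N] costs [ln N ^ 2 / (2 N)], which the full [N]-th term of
       [dispersion 0 N] covers. *)
    + apply chord_err_weaken with (dispersion 0 (N - 1) * (h * h / 8)
          + Rabs (/ (2 * INR N)) * (- ln (INR N) * - ln (INR N) * (h * h / 8))).
      * unfold dispersion. replace N with (S (N - 1)) at 5 by lia. rewrite rsum_S.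
        replace (1 + (N - 1))%nat with N by lia.
        rewrite Rabs_pos_eq by (left; apply Rinv_0_lt_compat; lra).
        assert (0 <= / INR N * (ln (INR N) * ln (INR N) * (h * h / 8))).
        { repeat apply Rmult_le_pos; try lra. left; apply Rinv_0_lt_compat; lra. }
        replace (/ (2 * INR N)) with (/ INR N * / 2) by (field; lra). nra.
      * apply (chord_err_plus (fun t => cis (0 * t) * csum (zterm t) 1 (N - 1))%C).
        -- apply chord_err_csum_zterm; auto.
        -- apply (chord_err_scal _ (fun t => cis (- ln (INR N) * t))). apply chord_err_cis; auto.
    + eapply chord_err_weaken; [| apply (chord_err_cis_div (- ln (INR N)) a h); auto].
      rewrite Rabs_Ropp, Rabs_pos_eq by auto. right; field; lra.
Qed.

(** * Evaluation on a grid *)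

(** Divides by [n] and passes from scale [2 ^ 60] to [2 ^ 30] in one rounding. The high powers taken
    from the table use 60 bits, the short walk along the grid only 30. *)
Definition downz (n : Z) (x : Z * Z) : Z * Z := (fst x / (2 ^ 30 * n), snd x / (2 ^ 30 * n))%Z.

Lemma approx_downz (n : nat) (x : Z * Z) (z : C) (q : R) :
  (1 <= n)%nat -> approx 60 x z q ->
  approx 30 (downz (Z.of_nat n) x) (RtoC (/ INR n) * z)%C (q + / IZR (2 ^ 28)).
Proof.
  intros Hn Hx. unfold approx in *.
  assert (Hn1 : 1 <= INR n) by (apply one_le_INR; lia).
  assert (Hi : 0 < / INR n <= 1).
  { split; [apply Rinv_0_lt_compat; lra |]. rewrite <- Rinv_1. apply Rinv_le_contravar; lra. }
  assert (E60 : scale 60 = 1073741824 * 1073741824) by (unfold scale; rewrite <- mult_IZR; reflexivity).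
  assert (E30 : scale 30 = 1073741824) by reflexivity.
  change (IZR (2 ^ 28)) with 268435456.
  replace (toC 30 (downz (Z.of_nat n) x) - RtoC (/ INR n) * z)%C with
    ((toC 30 (downz (Z.of_nat n) x) - RtoC (/ INR n) * toC 60 x) + RtoC (/ INR n) * (toC 60 x - z))%C by ring.
  eapply Rle_trans; [apply Cmod_triangle |].
  rewrite Cmod_mult, Cmod_R, (Rabs_pos_eq (/ INR n)) by lra.
  assert (H1 : Cmod (toC 30 (downz (Z.of_nat n) x) - RtoC (/ INR n) * toC 60 x)%C <= 2 / 1073741824).
  { unfold toC, downz, RtoC, Cminus, Cplus, Copp, Cmult; cbn [fst snd].
    eapply Rle_trans; [apply Cmod_le_sum |].
    pose proof (Zdiv_bounds (fst x) (2 ^ 30 * Z.of_nat n) ltac:(lia)) as Ha.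
    pose proof (Zdiv_bounds (snd x) (2 ^ 30 * Z.of_nat n) ltac:(lia)) as Hb.
    rewrite mult_IZR, <- INR_IZR_INZ in Ha, Hb. change (IZR (2 ^ 30)) with 1073741824 in Ha, Hb.
    rewrite E60, E30.
    set (r1 := IZR (fst x / _)) in *. set (r2 := IZR (snd x / _)) in *. clearbody r1 r2.
    assert (E : forall r s, Rabs (r - s / (1073741824 * INR n)) <= 1 ->
       Rabs (r / 1073741824 + - (/ INR n * (s / (1073741824 * 1073741824)))) <= / 1073741824).
    { intros r s Hr.
      replace (r / 1073741824 + - (/ INR n * (s / (1073741824 * 1073741824))))
        with (/ 1073741824 * (r - s / (1073741824 * INR n))) by (field; lra).
      rewrite Rabs_mult, Rabs_pos_eq by lra. lra. }
    replace (/ INR n * (IZR (fst x) / (1073741824 * 1073741824)) - 0 * (IZR (snd x) / (1073741824 * 1073741824)))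
      with (/ INR n * (IZR (fst x) / (1073741824 * 1073741824))) by ring.
    replace (/ INR n * (IZR (snd x) / (1073741824 * 1073741824)) + 0 * (IZR (fst x) / (1073741824 * 1073741824)))
      with (/ INR n * (IZR (snd x) / (1073741824 * 1073741824))) by ring.
    pose proof (E r1 (IZR (fst x)) ltac:(apply Rabs_le; lra)).
    pose proof (E r2 (IZR (snd x)) ltac:(apply Rabs_le; lra)). lra. }
  pose proof (Cmod_ge_0 (toC 60 x - z)) as H0.
  assert (/ INR n * Cmod (toC 60 x - z)%C <= 1 * Cmod (toC 60 x - z)%C) by (apply Rmult_le_compat_r; lra).
  rewrite E60 in Hx. rewrite E30. lra.
Qed.

Fixpoint vstart (k : positive) (n : Z) (l : list (Z * Z)) : list (Z * Z) :=
  match l with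
  | nil => nil
  | x :: l' => downz n (cpowz 60 x k) :: vstart k (n + 1) l'
  end%Z.

Definition omega (k : positive) (l : list (Z * Z)) : list (Z * Z) :=
  map (fun x => downz 1 (cpowz 60 x k)) l.

Definition tabq : R := 1 + / IZR (2 ^ 34).

Lemma list_inv_mono {A : Type} (P Q : nat -> A -> Prop) (n : nat) (l : list A) :
  (forall k x, (n <= k)%nat -> P k x -> Q k x) -> list_inv P n l -> list_inv Q n l.
Proof.
  revert n; induction l as [| x l IH]; intros n H Hl; cbn in *; auto.
  destruct Hl; split; [apply H; auto |]. apply IH; auto. intros; apply H; auto; lia.
Qed.

Lemma list_inv_firstn {A : Type} (P : nat -> A -> Prop) (M n : nat) (l : list A) :
  list_inv P n l -> list_inv P n (firstn M l).
Proof.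
  revert n l; induction M as [| M IH]; intros n [| x l] Hl; cbn in *; auto. destruct Hl; auto.
Qed.

Lemma vstart_length (k : positive) (n : Z) (l : list (Z * Z)) : length (vstart k n l) = length l.
Proof. revert n; induction l as [| x l IH]; intros n; cbn; auto. Qed.

Lemma vstart_inv (k : positive) (t : R) (n : nat) (l : list (Z * Z)) :
  (1 <= n)%nat -> t = IZR (Z.pos k) / 8 ->
  list_inv (fun n x => approx 60 x (cis (- (ln (INR n) / 8))) tabq) n l ->
  list_inv (fun n x => approx 30 x (zterm t n) (tabq ^ Pos.to_nat k + / IZR (2 ^ 28))) n (vstart k (Z.of_nat n) l).
Proof.
  intros Hn Ht. revert n Hn; induction l as [| x l IH]; intros n Hn Hl; cbn [vstart list_inv] in *; auto.
  destruct Hl as [Hx Hl]. split.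
  - rewrite zterm_eq by auto. apply approx_downz; auto.
    replace (- ln (INR n) * t) with (IZR (Z.pos k) * - (ln (INR n) / 8)) by (rewrite Ht; field).
    apply approx_cis_pow; [lia | auto].
  - replace (Z.of_nat n + 1)%Z with (Z.of_nat (S n)) by lia. apply IH; auto.
Qed.

Lemma omega_inv (k : positive) (h : R) (n : nat) (l : list (Z * Z)) :
  h = IZR (Z.pos k) / 8 ->
  list_inv (fun n x => approx 60 x (cis (- (ln (INR n) / 8))) tabq) n l ->
  list_inv (fun n x => approx 30 x (cis (- ln (INR n) * h)) (tabq ^ Pos.to_nat k + / IZR (2 ^ 28))) n (omega k l).
Proof.
  intros Hh. revert n; induction l as [| x l IH]; intros n Hl; cbn [omega map list_inv] in *; auto.
  destruct Hl as [Hx Hl]. split; [| apply IH; auto].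
  replace (cis (- ln (INR n) * h)) with (RtoC (/ INR 1) * cis (- ln (INR n) * h))%C
    by (simpl INR; rewrite Rinv_1; ring).
  apply (approx_downz 1); auto.
  replace (- ln (INR n) * h) with (IZR (Z.pos k) * - (ln (INR n) / 8)) by (rewrite Hh; field).
  apply approx_cis_pow; [lia | auto].
Qed.

Fixpoint zmul (om vs : list (Z * Z)) : list (Z * Z) :=
  match om, vs with
  | o :: om', x :: vs' => cmulz 30 o x :: zmul om' vs'
  | _, _ => nil
  end.

Lemma zmul_inv (t h c q : R) (n : nat) (om vs : list (Z * Z)) :
  (1 <= n)%nat -> length om = length vs ->
  list_inv (fun n x => approx 30 x (cis (- ln (INR n) * h)) c) n om ->
  list_inv (fun n x => approx 30 x (zterm t n) q) n vs ->
  length (zmul om vs) = length vs /\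
  list_inv (fun n x => approx 30 x (zterm (t + h) n) (q * c)) n (zmul om vs).
Proof.
  revert n vs; induction om as [| o om IH]; intros n [| x vs] Hn HL Ho Hv; cbn in *; try discriminate; auto.
  destruct Ho as [Ho1 Ho2], Hv as [Hv1 Hv2].
  destruct (IH (S n) vs ltac:(lia) ltac:(lia) Ho2 Hv2) as [I1 I2].
  split; [lia |]. split; auto.
  assert (1 <= INR n) by (apply one_le_INR; lia).
  replace (zterm (t + h) n) with (cis (- ln (INR n) * h) * zterm t n)%C.
  - rewrite (Rmult_comm q c). apply approx_mul; auto; [lia | rewrite Cmod_cis; lra |].
    rewrite Cmod_zterm by auto. rewrite <- Rinv_1. apply Rinv_le_contravar; lra.
  - rewrite !zterm_eq by auto. replace (- ln (INR n) * (t + h)) with (- ln (INR n) * h + - ln (INR n) * t) by ring.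
    rewrite cis_add. ring.
Qed.

Definition small (x : Z * Z) (B : Z) : bool :=
  ((0 <=? B) && (fst x * fst x + snd x * snd x <=? B * B))%Z.

Lemma small_le (x : Z * Z) (B : Z) : small x B = true -> Cmod (toC 30 x) <= IZR B / scale 30.
Proof.
  unfold small. rewrite andb_true_iff, !Z.leb_le. intros [HB Hx].
  apply IZR_le in HB. apply IZR_le in Hx. rewrite plus_IZR, !mult_IZR in Hx.
  assert (HS : 0 < scale 30) by (apply scale_pos; lia).
  unfold toC, Cmod; cbn [fst snd].
  assert (0 <= IZR B / scale 30) by (apply Rmult_le_pos; [auto | left; apply Rinv_0_lt_compat; auto]).
  rewrite <- (sqrt_square (IZR B / scale 30)) by auto.
  apply sqrt_le_1_alt.
  replace ((IZR (fst x) / scale 30) ^ 2 + (IZR (snd x) / scale 30) ^ 2)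
    with ((IZR (fst x) * IZR (fst x) + IZR (snd x) * IZR (snd x)) * / (scale 30 * scale 30)) by (field; lra).
  replace (IZR B / scale 30 * (IZR B / scale 30)) with (IZR B * IZR B * / (scale 30 * scale 30)) by (field; lra).
  apply Rmult_le_compat_r; [left; apply Rinv_0_lt_compat; nra | auto].
Qed.

(** [num] is the grid time multiplied by the number of grid steps per unit, hence an integer. The
    bound [B] stays fixed over a unit interval because it comes from the logarithm of the left end.
    The starting point itself is tested by the caller. *)
Fixpoint run_unit (T : Z -> list (Z * Z) -> Z * Z) (om : list (Z * Z)) (B num : Z) (j : nat)
    (vs : list (Z * Z)) : option (list (Z * Z)) :=
  match j with
  | O => Some vs
  | S j' =>
      let vs' := zmul om vs in
      if small (T (num + 1)%Z vs') B then run_unit T om B (num + 1) j' vs' else None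
  end.

(* [la] is a lower bound of [2 ^ 30 * ln a], updated by [ln ((a + 1) / a) >= 2 / (2 a + 1)]. *)
Fixpoint run (T : Z -> list (Z * Z) -> Z * Z) (om : list (Z * Z)) (H : nat) (cst : Z) (cnt : nat)
    (a la : Z) (vs : list (Z * Z)) : bool :=
  match cnt with
  | O => true
  | S c =>
      let B := (3 * la / 4 - cst)%Z in
      if small (T (a * Z.of_nat H)%Z vs) B then
        match run_unit T om B (a * Z.of_nat H) H vs with
        | Some vs' => run T om H cst c (a + 1) (la + 2 ^ 31 / (2 * a + 1)) vs'
        | None => false
        end
      else false
  end.

Definition err_q : R := / IZR (2 ^ 15).

(** Abstracts over the two quantities evaluated on the grid, the plain partial sum and the
    Euler-Maclaurin approximation. [Z.of_nat H <= num] encodes [t >= 1], which keeps the factor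
    [N / t] of the latter at most [N]. *)
Definition valid (T : Z -> list (Z * Z) -> Z * Z) (G : R -> C) (M H : nat) (err : R) : Prop :=
  forall num t vs, (Z.of_nat H <= num)%Z -> IZR num = t * INR H -> length vs = M ->
    list_inv (fun n x => approx 30 x (zterm t n) (1 + err_q)) 1 vs ->
    Cmod (G t) <= Cmod (toC 30 (T num vs)) + err.

Section Run.

Variables (T : Z -> list (Z * Z) -> Z * Z) (G : R -> C) (M H : nat) (err c : R) (om : list (Z * Z)).
Hypothesis HT : valid T G M H err.
Hypothesis HH : (1 <= H)%nat.
Hypothesis Hom : list_inv (fun n x => approx 30 x (cis (- ln (INR n) * (/ INR H))) c) 1 om.
Hypothesis HomL : length om = M.
Hypothesis Hc : 1 <= c.

Let state (t q : R) (vs : list (Z * Z)) : Prop :=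
  length vs = M /\ list_inv (fun n x => approx 30 x (zterm t n) q) 1 vs.

Lemma state_small (num : Z) (t q : R) (B : Z) (vs : list (Z * Z)) :
  (Z.of_nat H <= num)%Z -> IZR num = t * INR H -> q <= 1 + err_q -> state t q vs ->
  small (T num vs) B = true -> Cmod (G t) <= IZR B / scale 30 + err.
Proof.
  intros Hn Ht Hq [HL Hv] Hs. apply small_le in Hs.
  assert (Hv' : list_inv (fun n x => approx 30 x (zterm t n) (1 + err_q)) 1 vs).
  { eapply list_inv_mono; [| exact Hv]. intros k x _ Hx. eapply approx_weaken; [exact Hq | exact Hx]. }
  pose proof (HT num t vs Hn Ht HL Hv') as He.
  lra.
Qed.

(** Each rotation multiplies the quality by [c]. It suffices that the final quality is at most
    [1 + err_q], because [1 <= c] makes all earlier ones smaller. *)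
Lemma run_unit_sound (B : Z) (j : nat) (num : Z) (t q : R) (vs vs' : list (Z * Z)) :
  (Z.of_nat H <= num)%Z -> IZR num = t * INR H -> 0 < q -> q * c ^ j <= 1 + err_q -> state t q vs ->
  run_unit T om B num j vs = Some vs' ->
  state (t + INR j / INR H) (q * c ^ j) vs' /\
  forall i, (1 <= i <= j)%nat -> Cmod (G (t + INR i / INR H)) <= IZR B / scale 30 + err.
Proof.
  assert (HHr : 1 <= INR H) by (apply one_le_INR; lia).
  revert num t q vs; induction j as [| j IH]; intros num t q vs Hn Ht Hq Hqc Hst Hrun; cbn [run_unit] in Hrun.
  - injection Hrun as <-. simpl. replace (t + 0 / INR H) with t by (field; lra). rewrite Rmult_1_r.
    split; auto. intros; lia.
  - destruct (small (T (num + 1)%Z (zmul om vs)) B) eqn:Es; [| discriminate].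
    destruct Hst as [HL Hv].
    destruct (zmul_inv t (/ INR H) c q 1 om vs (le_n 1) ltac:(lia) Hom Hv) as [HL' Hv'].
    assert (Hst' : state (t + / INR H) (q * c) (zmul om vs)) by (split; [lia | auto]).
    assert (Ht' : IZR (num + 1) = (t + / INR H) * INR H).
    { rewrite plus_IZR, Ht. field; lra. }
    assert (Hq' : 0 < q * c) by nra.
    simpl in Hqc. assert (Hqc' : q * c * c ^ j <= 1 + err_q) by lra.
    destruct (IH (num + 1)%Z (t + / INR H) (q * c) (zmul om vs) ltac:(lia) Ht' Hq' Hqc' Hst' Hrun) as [I1 I2].
    rewrite S_INR.
    split.
    + replace (t + (INR j + 1) / INR H) with (t + / INR H + INR j / INR H) by (field; lra).
      replace (q * c ^ S j) with (q * c * c ^ j) by (simpl; ring). auto.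
    + intros i Hi. destruct (Nat.eq_dec i 1) as [-> | Ei].
      * simpl INR. replace (t + 1 / INR H) with (t + / INR H) by (field; lra).
        apply (state_small (num + 1) _ (q * c) B (zmul om vs)); auto; [lia |].
        assert (1 <= c ^ j) by (apply pow_R1_Rle; auto). nra.
      * replace (t + INR i / INR H) with (t + / INR H + INR (i - 1) / INR H).
        -- apply I2; lia.
        -- rewrite minus_INR by lia. simpl INR. field; lra.
Qed.

Lemma ln_succ_ge (a : Z) : (1 <= a)%Z -> 2 / (2 * IZR a + 1) <= ln (IZR (a + 1)) - ln (IZR a).
Proof.
  intros Ha. apply IZR_le in Ha.
  set (y := / (2 * IZR a + 1)).
  assert (Hy : 0 < y < 1).
  { unfold y. split; [apply Rinv_0_lt_compat; lra |]. rewrite <- Rinv_1. apply Rinv_lt_contravar; lra. }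
  pose proof (artanh_series_bounds 1 y ltac:(lra)) as Hs.
  replace ((1 + y) / (1 - y)) with (IZR (a + 1) / IZR a) in Hs
    by (rewrite plus_IZR; unfold y; field; repeat split; lra).
  rewrite ln_div in Hs by (try rewrite plus_IZR; lra).
  simpl in Hs. unfold Rdiv. fold y. lra.
Qed.

(** On [[a, a + 1]] the tested grid values are at most [3 / 4 * ln a - cst / 2 ^ 30], interpolation
    adds [D], and [ln a <= ln t]. Later units follow by induction, with [la] advanced by a lower
    bound for [ln ((a + 1) / a)]. *)
Lemma run_sound (cst : Z) (D : R) (cnt : nat) (a la : Z) (q : R) (vs : list (Z * Z)) :
  (1 <= a)%Z -> IZR la <= scale 30 * ln (IZR a) ->
  0 < q -> q * c ^ (cnt * H) <= 1 + err_q -> state (IZR a) q vs ->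
  (forall t0, IZR a <= t0 -> chord_err G t0 (/ INR H) D) ->
  run T om H cst cnt a la vs = true ->
  forall t, IZR a <= t <= IZR a + INR cnt ->
    (0 < cnt)%nat ->
    Cmod (G t) <= 3 / 4 * ln t - IZR cst / scale 30 + err + D.
Proof.
  assert (HHr : 1 <= INR H) by (apply one_le_INR; lia).
  assert (HS : 0 < scale 30) by (apply scale_pos; lia).
  revert a la q vs; induction cnt as [| m IH]; intros a la q vs Ha Hla Hq Hqc Hst HD Hrun t Ht Hcnt; [lia |].
  cbn [run] in Hrun. set (B := (3 * la / 4 - cst)%Z) in *.
  assert (Har : 1 <= IZR a) by (apply IZR_le; auto).
  destruct (small (T (a * Z.of_nat H)%Z vs) B) eqn:Es; [| discriminate].
  destruct (run_unit T om B (a * Z.of_nat H) H vs) as [vs' |] eqn:Er; [| discriminate].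
  assert (Hnum : IZR (a * Z.of_nat H) = IZR a * INR H) by (rewrite mult_IZR, <- INR_IZR_INZ; auto).
  assert (Hnp : (Z.of_nat H <= a * Z.of_nat H)%Z) by nia.
  assert (Hsplit : q * c ^ H * c ^ (m * H) <= 1 + err_q).
  { rewrite Rmult_assoc, <- pow_add. exact Hqc. }
  assert (Hc1 : 1 <= c ^ (m * H)) by (apply pow_R1_Rle; auto).
  assert (Hc2 : 1 <= c ^ H) by (apply pow_R1_Rle; auto).
  assert (Hqp : 0 < q * c ^ H) by (apply Rmult_lt_0_compat; lra).
  assert (Hqc1 : q * c ^ H <= 1 + err_q).
  { rewrite <- (Rmult_1_r (q * c ^ H)). eapply Rle_trans; [apply Rmult_le_compat_l; [lra | exact Hc1] | exact Hsplit]. }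
  destruct (run_unit_sound B H (a * Z.of_nat H) (IZR a) q vs vs' Hnp Hnum Hq Hqc1 Hst Er) as [Hst' Hpts].
  replace (INR H / INR H) with 1 in Hst' by (field; lra).
  destruct (Rle_dec t (IZR a + 1)) as [Hle | Hgt].
  - assert (Hgrid : forall i, (i <= H)%nat -> Cmod (G (IZR a + INR i / INR H)) <= IZR B / scale 30 + err).
    { intros i Hi. destruct (Nat.eq_dec i 0) as [-> | Ei]; [| apply Hpts; lia].
      simpl INR. replace (IZR a + 0 / INR H) with (IZR a) by (field; lra).
      apply (state_small _ _ q B vs Hnp Hnum); auto. nra. }
    (* Locates the grid cell containing [t]. *)
    assert (Hi : exists i, (i < H)%nat /\ INR i / INR H <= t - IZR a <= INR (S i) / INR H).
    { assert (Hk : forall k, (1 <= k)%nat -> t - IZR a <= INR k / INR H ->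
        exists i, (i < k)%nat /\ INR i / INR H <= t - IZR a <= INR (S i) / INR H).
      { induction k as [| k IHk]; intros Hk Hkt; [lia |].
        destruct (Rle_dec (INR k / INR H) (t - IZR a)) as [H1 | H1].
        - exists k. split; [lia |]. lra.
        - destruct (Nat.eq_dec k 0) as [-> | Ek].
          + exfalso; apply H1. simpl. replace (0 / INR H) with 0 by (field; lra). lra.
          + destruct (IHk ltac:(lia) ltac:(lra)) as [i [Hi1 Hi2]]. exists i. split; [lia | auto]. }
      apply Hk; auto. replace (INR H / INR H) with 1 by (field; lra). lra. }
    destruct Hi as [i [HiH Hit]].
    assert (Hi0 : 0 <= INR i / INR H).
    { apply Rmult_le_pos; [apply pos_INR | left; apply Rinv_0_lt_compat; lra]. }
    assert (Hstep : INR (S i) / INR H = INR i / INR H + / INR H) by (rewrite S_INR; field; lra).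
    assert (HG : Cmod (G t) <= IZR B / scale 30 + err + D).
    { replace t with (IZR a + INR i / INR H + (t - IZR a - INR i / INR H)) by ring.
      apply (chord_err_le G _ (/ INR H)).
      - apply Rinv_0_lt_compat; lra.
      - apply HD; lra.
      - apply Hgrid; lia.
      - replace (IZR a + INR i / INR H + / INR H) with (IZR a + INR (S i) / INR H) by lra.
        apply Hgrid; lia.
      - lra. }
    assert (HB : IZR B / scale 30 <= 3 / 4 * ln (IZR a) - IZR cst / scale 30).
    { unfold B. rewrite minus_IZR.
      pose proof (Zdiv_bounds (3 * la) 4 ltac:(lia)) as [_ H4]. rewrite mult_IZR in H4.
      replace (3 / 4 * ln (IZR a) - IZR cst / scale 30)
        with ((3 * (scale 30 * ln (IZR a)) / 4 - IZR cst) * / scale 30) by (field; lra).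
      apply Rmult_le_compat_r; [left; apply Rinv_0_lt_compat; auto |]. lra. }
    assert (Hln : ln (IZR a) <= ln t).
    { destruct (Req_dec (IZR a) t) as [<- | E]; [lra |]. left; apply ln_increasing; lra. }
    lra.
  - destruct m as [| m]; [simpl in Ht; lra |].
    apply (IH (a + 1)%Z (la + 2 ^ 31 / (2 * a + 1))%Z (q * c ^ H) vs').
    + lia.
    + rewrite plus_IZR. pose proof (Zdiv_bounds (2 ^ 31) (2 * a + 1) ltac:(lia)) as [_ Hd].
      rewrite plus_IZR, mult_IZR in Hd.
      pose proof (ln_succ_ge a Ha) as Hl.
      assert (E : IZR (2 ^ 31) / (2 * IZR a + 1) = scale 30 * (2 / (2 * IZR a + 1))).
      { replace (IZR (2 ^ 31)) with (2 * scale 30) by (unfold scale; rewrite <- mult_IZR; reflexivity). field; lra. }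
      rewrite E in Hd. nra.
    + nra.
    + exact Hsplit.
    + rewrite plus_IZR. exact Hst'.
    + intros t0 Ht0. apply HD. rewrite plus_IZR in Ht0. lra.
    + exact Hrun.
    + rewrite plus_IZR. rewrite S_INR in Ht. lra.
    + lia.
Qed.

End Run.

(** * Evaluation of the partial sum and of the Euler-Maclaurin approximation from the list of
    terms *)

Fixpoint zsum (l : list (Z * Z)) : Z * Z :=
  match l with
  | nil => (0, 0)
  | x :: l' => let s := zsum l' in (fst x + fst s, snd x + snd s)
  end%Z.

Lemma zsum_approx (f : nat -> C) (n : nat) (l : list (Z * Z)) :
  list_inv (fun n x => approx 30 x (f n) (1 + err_q)) n l ->
  Cmod (toC 30 (zsum l) - csum f n (length l))%C <= INR (length l) * err_q.
Proof.
  assert (HS : 0 < scale 30) by (apply scale_pos; lia).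
  revert n; induction l as [| x l IH]; intros n Hl.
  - cbn [zsum length csum]. simpl INR.
    replace (toC 30 (0, 0)%Z - 0)%C with (RtoC 0).
    + rewrite Cmod_0; lra.
    + unfold toC, RtoC; simpl. apply injective_projections; simpl; field; lra.
  - destruct Hl as [Hx Hl]. specialize (IH _ Hl).
    cbn [zsum length csum]. rewrite S_INR.
    replace (toC 30 (fst x + fst (zsum l), snd x + snd (zsum l))%Z - (f n + csum f (S n) (length l)))%C
      with ((toC 30 x - f n) + (toC 30 (zsum l) - csum f (S n) (length l)))%C.
    + eapply Rle_trans; [apply Cmod_triangle |].
      unfold approx in Hx. assert (0 < 2 / scale 30) by (apply Rdiv_lt_0_compat; lra). lra.
    + unfold toC; cbn [fst snd]. rewrite !plus_IZR.
      set (c := csum f (S n) (length l)). clearbody c.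
      apply injective_projections; simpl; field; lra.
Qed.

Definition T_sum (num : Z) (l : list (Z * Z)) : Z * Z := zsum l.

Lemma Cmod_cis_mul (x : R) (z : C) : Cmod (cis x * z)%C = Cmod z.
Proof. rewrite Cmod_mult, Cmod_cis. ring. Qed.

Lemma valid_T_sum (W : R) (M H : nat) :
  valid T_sum (fun t => cis (W * t) * csum (zterm t) 1 M)%C M H (INR M * err_q).
Proof.
  intros num t vs Hnum Ht HL Hv. rewrite Cmod_cis_mul.
  pose proof (zsum_approx (zterm t) 1 vs Hv) as Hs. rewrite HL in Hs. unfold T_sum.
  replace (csum (zterm t) 1 M) with (toC 30 (zsum vs) + - (toC 30 (zsum vs) - csum (zterm t) 1 M))%C by ring.
  eapply Rle_trans; [apply Cmod_triangle |]. rewrite Cmod_opp. lra.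
Qed.

(** Uses the form of [em_approx_eq]: the full sum up to [N] plus the last term times
    [- 1 / 2 - i N / t]. In integers [N / t] is [k / num], so only the last list entry is needed
    besides the sum. *)
Definition T_em (N H : nat) (num : Z) (l : list (Z * Z)) : Z * Z :=
  let s := zsum l in
  let x := last l (0, 0)%Z in
  let k := (Z.of_nat N * Z.of_nat H)%Z in
  (fst s + - fst x / 2 + k * snd x / num, snd s + - snd x / 2 + - (k * fst x) / num)%Z.

Lemma last_inv {A : Type} (P : nat -> A -> Prop) (d : A) (n : nat) (l : list A) :
  (1 <= length l)%nat -> list_inv P n l -> P (n + length l - 1)%nat (last l d).
Proof.
  revert n; induction l as [| x l IH]; intros n HL Hl; cbn [length] in HL; [lia |].
  destruct Hl as [Hx Hl]. destruct l as [| y l].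
  - simpl. replace (n + 1 - 1)%nat with n by lia. auto.
  - change (last (x :: y :: l) d) with (last (y :: l) d).
    replace (n + length (x :: y :: l) - 1)%nat with (S n + length (y :: l) - 1)%nat by (simpl; lia).
    apply IH; auto. simpl; lia.
Qed.

Lemma em_approx_eq (N : nat) (t : R) :
  (1 <= N)%nat -> 0 < t ->
  em_approx N t = (csum (zterm t) 1 N + zterm t N * (- RtoC (/ 2) - Ci * RtoC (INR N / t)))%C.
Proof.
  intros HN Ht. assert (HN1 : 1 <= INR N) by (apply one_le_INR; lia).
  assert (E : csum (zterm t) 1 N = (csum (zterm t) 1 (N - 1) + zterm t N)%C).
  { replace N with (S (N - 1)) at 1 by lia. rewrite csum_S. do 2 f_equal. lia. }
  unfold em_approx. rewrite E.
  set (c := csum (zterm t) 1 (N - 1)). clearbody c.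
  unfold zterm. set (z := ipow t (INR N)). clearbody z.
  apply injective_projections; simpl; field; lra.
Qed.

(** The sum contributes [N * err_q], the last entry once more [(1 / 2 + N) * err_q], and the
    remaining [err_q / 2] covers the four floor divisions. *)
Lemma valid_T_em (N H : nat) :
  (1 <= N)%nat -> (1 <= H)%nat -> valid (T_em N H) (em_approx N) N H ((2 * INR N + 1) * err_q).
Proof.
  intros HN HH num t vs Hnum Ht HL Hv.
  assert (HN1 : 1 <= INR N) by (apply one_le_INR; lia).
  assert (HH1 : 1 <= INR H) by (apply one_le_INR; lia).
  assert (Ht1 : 1 <= t).
  { apply IZR_le in Hnum. rewrite <- INR_IZR_INZ, Ht in Hnum. nra. }
  pose proof (zsum_approx (zterm t) 1 vs Hv) as Hs. rewrite HL in Hs.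
  pose proof (last_inv _ (0, 0)%Z 1 vs ltac:(lia) Hv) as Hx. cbv beta in Hx.
  replace (1 + length vs - 1)%nat with N in Hx by lia.
  rewrite em_approx_eq by (auto; lra).
  unfold T_em. set (x := last vs (0, 0)%Z) in *. set (s := zsum vs) in *. clearbody x s.
  set (c := csum (zterm t) 1 N) in *. clearbody c.
  unfold approx in Hx. set (z := zterm t N) in *. clearbody z.
  assert (HS : 0 < scale 30) by (apply scale_pos; lia).
  assert (ES : scale 30 = 1073741824) by reflexivity.
  assert (Eq : err_q = / 32768) by reflexivity.
  set (r := INR N / t) in *.
  assert (Hr : 0 <= r <= INR N).
  { unfold r. split; [apply Rmult_le_pos; [lra | left; apply Rinv_0_lt_compat; lra] |].
    apply Rmult_le_reg_r with t; [lra |]. unfold Rdiv. rewrite Rmult_assoc, Rinv_l by lra. nra. }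
  pose proof (Zdiv_bounds (- fst x) 2 ltac:(lia)) as H1.
  pose proof (Zdiv_bounds (- snd x) 2 ltac:(lia)) as H2.
  pose proof (Zdiv_bounds (Z.of_nat N * Z.of_nat H * snd x) num ltac:(lia)) as H3.
  pose proof (Zdiv_bounds (- (Z.of_nat N * Z.of_nat H * fst x)) num ltac:(lia)) as H4.
  rewrite opp_IZR in H1, H2, H4. rewrite !mult_IZR, <- !INR_IZR_INZ, Ht in H3, H4.
  replace (INR N * INR H * IZR (snd x) / (t * INR H)) with (r * IZR (snd x)) in H3 by (unfold r; field; lra).
  replace (- (INR N * INR H * IZR (fst x)) / (t * INR H)) with (- (r * IZR (fst x))) in H4 by (unfold r; field; lra).
  set (d1 := (- fst x / 2)%Z) in *. set (d2 := (- snd x / 2)%Z) in *.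
  set (d3 := (Z.of_nat N * Z.of_nat H * snd x / num)%Z) in *.
  set (d4 := (- (Z.of_nat N * Z.of_nat H * fst x) / num)%Z) in *.
  clearbody d1 d2 d3 d4 r.
  set (V := toC 30 (fst s + d1 + d3, snd s + d2 + d4)%Z).
  set (X := toC 30 x) in *.
  assert (HV : Cmod (V - (toC 30 s + X * (- RtoC (/ 2) - Ci * RtoC r)))%C <= 4 / scale 30).
  { unfold V, X, toC, Ci, RtoC, Cminus, Cplus, Copp, Cmult; cbn [fst snd]. rewrite !plus_IZR.
    eapply Rle_trans; [apply Cmod_le_sum |].
    assert (E : forall y, Rabs y <= 2 -> Rabs (y / scale 30) <= 2 / scale 30).
    { intros y Hy. unfold Rdiv. rewrite Rabs_mult, (Rabs_pos_eq (/ scale 30)) by (left; apply Rinv_0_lt_compat; auto).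
      apply Rmult_le_compat_r; [left; apply Rinv_0_lt_compat; auto | auto]. }
    match goal with |- Rabs ?e1 + Rabs ?e2 <= _ =>
      replace e1 with ((IZR d1 - (- IZR (fst x) / 2) + (IZR d3 - r * IZR (snd x))) / scale 30) by (field; lra);
      replace e2 with ((IZR d2 - (- IZR (snd x) / 2) + (IZR d4 - - (r * IZR (fst x)))) / scale 30) by (field; lra)
    end.
    replace (4 / scale 30) with (2 / scale 30 + 2 / scale 30) by (field; lra).
    apply Rplus_le_compat; apply E; apply Rabs_le; lra. }
  replace (c + z * (- RtoC (/ 2) - Ci * RtoC r))%C with
    (V + - (V - (toC 30 s + X * (- RtoC (/ 2) - Ci * RtoC r))) + - (toC 30 s - c)
      + - ((X - z) * (- RtoC (/ 2) - Ci * RtoC r)))%C by ring.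
  eapply Rle_trans; [apply Cmod_triangle |].
  eapply Rle_trans; [apply Rplus_le_compat_r, Cmod_triangle |].
  eapply Rle_trans; [apply Rplus_le_compat_r, Rplus_le_compat_r, Cmod_triangle |].
  rewrite !Cmod_opp, Cmod_mult.
  assert (Hf : Cmod (- RtoC (/ 2) - Ci * RtoC r)%C <= / 2 + r).
  { unfold Ci, RtoC, Cminus, Cplus, Copp, Cmult; cbn [fst snd].
    eapply Rle_trans; [apply Cmod_le_sum |].
    apply Rplus_le_compat; apply Rabs_le; lra. }
  assert (Hxz : Cmod (X - z)%C * Cmod (- RtoC (/ 2) - Ci * RtoC r)%C <= err_q * (/ 2 + INR N)).
  { apply Rmult_le_compat; try apply Cmod_ge_0; [| lra].
    assert (0 < 2 / scale 30) by (apply Rdiv_lt_0_compat; lra). lra. }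
  rewrite Eq in *. rewrite ES in *. lra.
Qed.

(** Allows one evaluation at the left end of a range to serve the whole range. The Kuzmin-Landau and
    near-block bounds decrease because [1 / (t - X)] and [t / (t - 2 Y)] do. *)
Lemma tail_bound_decr (p P phi a t : R) (K : nat) :
  0 < phi -> phi < p -> p <= P -> 2 < a / phi - 1 ->
  p * (INR K + 1) - phi < a -> 2 * (P * INR K + phi) < a -> a <= t ->
  tail_bound p P phi t K <= tail_bound p P phi a K.
Proof.
  intros Hphi Hp HpP Hend HK1 HK2 Hat.
  assert (Ha : 0 < a).
  { apply Rmult_lt_reg_r with (/ phi); [apply Rinv_0_lt_compat; auto |]. unfold Rdiv in Hend. lra. }
  assert (Hkl : forall j, p * (INR j + 1) - phi < a -> kl_bound p phi t j <= kl_bound p phi a j).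
  { intros j Hj. pose proof (pos_INR j). unfold kl_bound.
    apply Rmult_le_compat_l; [left; apply Rdiv_lt_0_compat; lra |].
    apply Rmult_le_compat_l; [nra |]. apply Rinv_le_contravar; lra. }
  induction K as [| K IH].
  - simpl in *. apply Rplus_le_compat; [apply (Hkl O); simpl; lra |].
    unfold end_bound.
    assert (Hq : a / phi <= t / phi) by (apply Rmult_le_compat_r; [left; apply Rinv_0_lt_compat; auto | auto]).
    apply Rplus_le_compat; [apply Rplus_le_compat; apply Rinv_le_contravar; lra |].
    (* Numerator and denominator both grow with [t]. Written in [1 / y] with [y = t / phi], every
       factor is visibly decreasing in [t]. *)
    replace ((t * t + 5 / 2) / (24 * ((t / phi - 1) * (t / phi - 2))))
      with ((phi * phi + 5 / 2 * / ((t / phi) * (t / phi))) * (/ 24 * (/ (1 - / (t / phi)) * / (1 - 2 / (t / phi))))).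
    2:{ field. repeat split; try lra; intros E; assert (t / phi * phi = t) by (field; lra); nra. }
    replace ((a * a + 5 / 2) / (24 * ((a / phi - 1) * (a / phi - 2))))
      with ((phi * phi + 5 / 2 * / ((a / phi) * (a / phi))) * (/ 24 * (/ (1 - / (a / phi)) * / (1 - 2 / (a / phi))))).
    2:{ field. repeat split; try lra; intros E; assert (a / phi * phi = a) by (field; lra); nra. }
    set (y := t / phi) in *. set (b := a / phi) in *. clearbody y b.
    assert (Hiy : 0 < / y <= / b) by (split; [apply Rinv_0_lt_compat | apply Rinv_le_contravar]; lra).
    assert (Hib : / b < / 3) by (apply Rinv_lt_contravar; lra).
    unfold Rdiv at 2 4.
    assert (0 < / (1 - / y)) by (apply Rinv_0_lt_compat; lra).
    assert (0 < / (1 - 2 * / y)) by (apply Rinv_0_lt_compat; lra).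
    assert (/ (1 - / y) <= / (1 - / b)) by (apply Rinv_le_contravar; lra).
    assert (/ (1 - 2 * / y) <= / (1 - 2 * / b)) by (apply Rinv_le_contravar; lra).
    assert (0 < / (y * y)) by (apply Rinv_0_lt_compat; nra).
    assert (/ (y * y) <= / (b * b)) by (apply Rinv_le_contravar; nra).
    apply Rmult_le_compat; try lra.
    + nra.
    + apply Rmult_le_pos; [lra |]. apply Rmult_le_pos; lra.
    + apply Rmult_le_compat_l; [lra |]. apply Rmult_le_compat; lra.
  - rewrite S_INR in *. pose proof (pos_INR K) as HK.
    change (tail_bound p P phi t (S K)) with
      (tail_bound p P phi t K + kl_bound p phi t (S K) + near_bound p P phi t (S K)).
    change (tail_bound p P phi a (S K)) with
      (tail_bound p P phi a K + kl_bound p phi a (S K) + near_bound p P phi a (S K)).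
    assert (Hn : near_bound p P phi t (S K) <= near_bound p P phi a (S K)).
    { unfold near_bound. rewrite S_INR. apply Rplus_le_compat_r.
      set (Y := P * (INR K + 1) + phi) in *.
      assert (HY : 0 < Y) by (unfold Y; nra).
      apply Rmult_le_compat_l.
      - left. apply Rdiv_lt_0_compat; [auto | nra].
      - apply Rmult_le_reg_r with ((t - 2 * Y) * (a - 2 * Y)); [apply Rmult_lt_0_compat; lra |].
        replace (t / (t - 2 * Y) * ((t - 2 * Y) * (a - 2 * Y))) with (t * (a - 2 * Y)) by (field; lra).
        replace (a / (a - 2 * Y) * ((t - 2 * Y) * (a - 2 * Y))) with (a * (t - 2 * Y)) by (field; lra). nra. }
    specialize (IH ltac:(lra) ltac:(lra)). specialize (Hkl (S K) ltac:(rewrite S_INR; lra)). lra.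
Qed.

(** Upper bound for the dispersion at scale [2 ^ 120]. The margin [2 ^ 20] exceeds twice the table
    error [80 * 2 ^ 12], and [+ 1] compensates the floor. *)
Fixpoint dispz (lw n : Z) (l : list Z) : Z :=
  match l with
  | nil => 0
  | x :: l' => let d := (Z.abs (x - lw) + 2 ^ 20)%Z in d * d / n + 1 + dispz lw (n + 1) l'
  end%Z.

Lemma dispz_bound (lw : Z) (W : R) (n : nat) (l : list Z) :
  (1 <= n)%nat -> (n + length l <= 81)%nat ->
  Rabs (IZR lw - scale 60 * W) <= 80 * scale 12 ->
  list_inv (fun n l => Rabs (IZR l - scale 60 * ln (INR n)) <= INR n * scale 12) n l ->
  scale 60 * scale 60 * rsum (fun n => / INR n * ((W - ln (INR n)) * (W - ln (INR n)))) n (length l)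
    <= IZR (dispz lw (Z.of_nat n) l).
Proof.
  intros Hn HL Hw. revert n Hn HL; induction l as [| x l IH]; intros n Hn HL Hl.
  - simpl. lra.
  - destruct Hl as [Hx Hl]. cbn [dispz length rsum].
    replace (Z.of_nat n + 1)%Z with (Z.of_nat (S n)) by lia.
    specialize (IH (S n) ltac:(lia) ltac:(simpl in HL; lia) Hl).
    rewrite !plus_IZR.
    assert (Hn1 : 1 <= INR n) by (apply one_le_INR; lia).
    assert (Hn2 : INR n <= 80) by (replace 80 with (INR 80) by (rewrite INR_IZR_INZ; reflexivity); apply le_INR; simpl in HL; lia).
    set (d := (Z.abs (x - lw) + 2 ^ 20)%Z).
    pose proof (Zdiv_bounds (d * d) (Z.of_nat n) ltac:(lia)) as [Hd _].
    rewrite mult_IZR, <- INR_IZR_INZ in Hd.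
    assert (HW : scale 60 * Rabs (W - ln (INR n)) <= IZR d).
    { unfold d. rewrite plus_IZR, abs_IZR, minus_IZR.
      assert (HS : 0 < scale 60) by (apply scale_pos; lia).
      rewrite <- (Rabs_pos_eq (scale 60)) at 1 by lra. rewrite <- Rabs_mult.
      replace (scale 60 * (W - ln (INR n)))
        with (- (IZR x - IZR lw) + ((IZR x - scale 60 * ln (INR n)) + - (IZR lw - scale 60 * W))) by ring.
      eapply Rle_trans; [apply Rabs_triang |]. rewrite Rabs_Ropp. apply Rplus_le_compat_l.
      eapply Rle_trans; [apply Rabs_triang |]. rewrite Rabs_Ropp.
      assert (ES : scale 12 = 4096) by reflexivity. rewrite ES in *.
      change (IZR (2 ^ 20)) with 1048576. nra. }
    assert (Hsq : scale 60 * scale 60 * ((W - ln (INR n)) * (W - ln (INR n))) <= IZR d * IZR d).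
    { assert (HS : 0 < scale 60) by (apply scale_pos; lia).
      pose proof (Rabs_pos (W - ln (INR n))).
      replace ((W - ln (INR n)) * (W - ln (INR n))) with (Rabs (W - ln (INR n)) * Rabs (W - ln (INR n)))
        by (rewrite <- Rabs_mult; apply Rabs_pos_eq, Rle_0_sqr).
      replace (scale 60 * scale 60 * (Rabs (W - ln (INR n)) * Rabs (W - ln (INR n))))
        with ((scale 60 * Rabs (W - ln (INR n))) * (scale 60 * Rabs (W - ln (INR n)))) by ring.
      assert (0 <= scale 60 * Rabs (W - ln (INR n))) by (apply Rmult_le_pos; lra).
      apply Rmult_le_compat; lra. }
    assert (Hdiv : scale 60 * scale 60 * (/ INR n * ((W - ln (INR n)) * (W - ln (INR n)))) <= IZR d * IZR d / INR n).
    { unfold Rdiv. rewrite (Rmult_comm (IZR d * IZR d)).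
      replace (scale 60 * scale 60 * (/ INR n * ((W - ln (INR n)) * (W - ln (INR n)))))
        with (/ INR n * (scale 60 * scale 60 * ((W - ln (INR n)) * (W - ln (INR n))))) by ring.
      apply Rmult_le_compat_l; [left; apply Rinv_0_lt_compat; lra | auto]. }
    lra.
Qed.

Definition lns : list Z := Eval vm_compute in lnlist 80 1 0.

Lemma lns_inv : list_inv (fun n l => Rabs (IZR l - scale 60 * ln (INR n)) <= INR n * scale 12) 1 lns.
Proof.
  replace lns with (lnlist 80 1 0) by (vm_compute; reflexivity).
  apply (lnlist_inv 80 1); [lia |]. simpl INR. rewrite ln_1, Rmult_0_r, Rminus_0_r, Rabs_R0.
  unfold scale; simpl; lra.
Qed.

Lemma list_inv_nth {A : Type} (P : nat -> A -> Prop) (d : A) (i n : nat) (l : list A) :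
  list_inv P n l -> (i < length l)%nat -> P (n + i)%nat (nth i l d).
Proof.
  revert i n; induction l as [| x l IH]; intros i n Hl Hi; cbn [length] in Hi; [lia |].
  destruct Hl as [Hx Hl]. destruct i as [| i]; cbn [nth].
  - rewrite Nat.add_0_r; auto.
  - replace (n + S i)%nat with (S n + i)%nat by lia. apply IH; auto; lia.
Qed.

Lemma ln_approx (n : nat) :
  (1 <= n <= 80)%nat -> Rabs (ln (INR n) - IZR (nth (n - 1) lns 0%Z) / scale 60) <= / IZR (2 ^ 41).
Proof.
  intros Hn.
  assert (HL : length lns = 80%nat) by reflexivity.
  pose proof (list_inv_nth _ 0%Z (n - 1) 1 lns lns_inv ltac:(lia)) as H. cbv beta in H.
  replace (1 + (n - 1))%nat with n in H by lia.
  assert (Hn2 : INR n <= 80) by (replace 80 with (INR 80) by (rewrite INR_IZR_INZ; reflexivity); apply le_INR; lia).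
  assert (ES : scale 60 = 1152921504606846976) by reflexivity.
  assert (ES2 : scale 12 = 4096) by reflexivity.
  rewrite ES, ES2 in *. change (IZR (2 ^ 41)) with 2199023255552.
  apply Rabs_le_between in H. apply Rabs_le. lra.
Qed.

Lemma dispersion_le (w0 M : nat) (c : Z) :
  (1 <= w0 <= 80)%nat -> (M <= 80)%nat ->
  (dispz (nth (w0 - 1) lns 0) 1 (firstn M lns) * 1000 <= c * 2 ^ 120)%Z ->
  dispersion (ln (INR w0)) M <= IZR c / 1000.
Proof.
  intros Hw HM Hc.
  apply IZR_le in Hc. rewrite !mult_IZR in Hc.
  replace (IZR (2 ^ 120)) with (scale 60 * scale 60) in Hc by (unfold scale; rewrite <- mult_IZR; reflexivity).
  assert (HL : length lns = 80%nat) by reflexivity.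
  assert (HLM : length (firstn M lns) = M) by (rewrite length_firstn, HL; lia).
  pose proof (list_inv_nth _ 0%Z (w0 - 1) 1 lns lns_inv ltac:(lia)) as H. cbv beta in H.
  replace (1 + (w0 - 1))%nat with w0 in H by lia.
  assert (Hn2 : INR w0 <= 80) by (replace 80 with (INR 80) by (rewrite INR_IZR_INZ; reflexivity); apply le_INR; lia).
  assert (HS : 0 < scale 60) by (apply scale_pos; lia).
  assert (ES : scale 12 = 4096) by reflexivity.
  assert (H' : Rabs (IZR (nth (w0 - 1) lns 0%Z) - scale 60 * ln (INR w0)) <= 80 * scale 12) by (rewrite ES in *; lra).
  pose proof (dispz_bound _ _ 1 (firstn M lns) (le_n 1) ltac:(lia) H' (list_inv_firstn _ _ _ _ lns_inv)) as Hb.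
  rewrite HLM in Hb. fold (dispersion (ln (INR w0)) M) in Hb. change (Z.of_nat 1) with 1%Z in Hb.
  apply Rmult_le_reg_l with (scale 60 * scale 60); [nra |]. lra.
Qed.

(** Error budget of a segment: powering up to exponent [8 * 2000] costs about [2 ^ (- 19)], and at
    most 1600 rotations cost less than [2 ^ (- 16)]. Together they stay below [err_q]. *)
Lemma quality_le (a cnt H k : nat) :
  (a <= 2000)%nat -> (cnt * H <= 1600)%nat -> (k <= 8)%nat ->
  (tabq ^ (8 * a) + / IZR (2 ^ 28)) * (tabq ^ k + / IZR (2 ^ 28)) ^ (cnt * H) <= 1 + err_q.
Proof.
  intros Ha HJ Hk.
  assert (B : forall n m : nat, (n <= m)%nat -> INR n <= INR m) by (intros; apply le_INR; auto).
  pose proof (B _ _ Ha) as Ha'; pose proof (B _ _ HJ) as HJ'; pose proof (B _ _ Hk) as Hk'.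
  rewrite (INR_IZR_INZ 2000), (INR_IZR_INZ 1600), (INR_IZR_INZ 8) in *. simpl Z.of_nat in *.
  set (e := / IZR (2 ^ 34)).
  assert (He : e = / 17179869184) by reflexivity.
  change (IZR (2 ^ 28)) with 268435456.
  assert (Hq1 : tabq ^ (8 * a) <= 1 + 2 * (INR (8 * a) * e)).
  { apply one_plus_pow_le; [rewrite He; lra |]. rewrite mult_INR, (INR_IZR_INZ 8), He. simpl Z.of_nat. lra. }
  assert (Hq2 : tabq ^ k <= 1 + 2 * (INR k * e)).
  { apply one_plus_pow_le; rewrite He; lra. }
  rewrite mult_INR, (INR_IZR_INZ 8), He in Hq1. simpl Z.of_nat in Hq1. rewrite He in Hq2.
  assert (Hp1 : 1 <= tabq ^ (8 * a)) by (apply pow_R1_Rle; unfold tabq; fold e; rewrite He; lra).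
  assert (Hp2 : 1 <= tabq ^ k) by (apply pow_R1_Rle; unfold tabq; fold e; rewrite He; lra).
  set (y := 2 * (8 * / 17179869184) + / 268435456).
  assert (Hy : (tabq ^ k + / 268435456) ^ (cnt * H) <= (1 + y) ^ (cnt * H)).
  { apply pow_incr. unfold y. lra. }
  assert (Hy2 : (1 + y) ^ (cnt * H) <= 1 + 2 * (INR (cnt * H) * y)).
  { apply one_plus_pow_le; unfold y; lra. }
  assert (Hy3 : INR (cnt * H) * y <= 1600 * y) by (apply Rmult_le_compat_r; unfold y; lra).
  assert (H0 : 1 <= (tabq ^ k + / 268435456) ^ (cnt * H)) by (apply pow_R1_Rle; lra).
  apply Rle_trans with ((1 + 2 * (8 * 2000 * / 17179869184) + / 268435456) * (1 + 2 * (1600 * y))).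
  - apply Rmult_le_compat; lra.
  - unfold y, err_q. change (IZR (2 ^ 15)) with 32768. lra.
Qed.

Definition seg_check (T : Z -> list (Z * Z) -> Z * Z) (M H : nat) (k : positive) (a cnt : nat) (la cst : Z) : bool :=
  run T (omega k (firstn M tab)) H cst cnt (Z.of_nat a) la
    (vstart (Pos.of_nat (8 * a)) 1 (firstn M tab)).

Lemma seg_sound (T : Z -> list (Z * Z) -> Z * Z) (G : R -> C) (M H : nat) (k : positive) (a cnt : nat)
    (la cst : Z) (err D : R) :
  (Pos.to_nat k * H = 8)%nat -> (1 <= a <= 2000)%nat -> (cnt * H <= 1600)%nat -> (M <= 80)%nat ->
  valid T G M H err ->
  (forall t0, INR a <= t0 -> chord_err G t0 (/ INR H) D) ->
  IZR la <= scale 30 * ln (INR a) ->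
  seg_check T M H k a cnt la cst = true ->
  forall t, INR a <= t <= INR a + INR cnt -> (0 < cnt)%nat ->
  Cmod (G t) <= 3 / 4 * ln t - IZR cst / scale 30 + err + D.
Proof.
  intros HkH Ha HJ HM HT HD Hla Hrun t Ht Hcnt.
  assert (HH : (1 <= H)%nat) by nia.
  assert (Hk : (Pos.to_nat k <= 8)%nat) by nia.
  assert (HHr : 1 <= INR H) by (apply one_le_INR; lia).
  assert (HLt : length tab = 80%nat) by reflexivity.
  assert (HLM : length (firstn M tab) = M) by (rewrite length_firstn, HLt; lia).
  pose proof (list_inv_firstn _ M 1 _ tab_inv) as Htab.
  assert (Hh : / INR H = IZR (Z.pos k) / 8).
  { assert (E : INR (Pos.to_nat k * H) = 8) by (rewrite HkH, INR_IZR_INZ; reflexivity).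
    rewrite mult_INR, (INR_IZR_INZ (Pos.to_nat k)), positive_nat_Z in E.
    apply Rmult_eq_reg_r with (INR H); [| lra]. rewrite Rinv_l by lra. unfold Rdiv. lra. }
  pose proof (omega_inv k (/ INR H) 1 _ Hh Htab) as Hom.
  pose proof (vstart_inv (Pos.of_nat (8 * a)) (INR a) 1 (firstn M tab) (le_n 1)) as Hv.
  assert (Ha8 : INR a = IZR (Z.pos (Pos.of_nat (8 * a))) / 8).
  { rewrite <- positive_nat_Z, Nat2Pos.id, <- INR_IZR_INZ by lia. rewrite mult_INR, (INR_IZR_INZ 8). simpl Z.of_nat. lra. }
  specialize (Hv Ha8 Htab). rewrite Nat2Pos.id in Hv by lia.
  rewrite INR_IZR_INZ in Ht, Hla, HD.
  assert (Htq : forall n, 1 <= tabq ^ n).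
  { intros n. apply pow_R1_Rle. unfold tabq. pose proof (Rinv_0_lt_compat (IZR (2 ^ 34)) ltac:(apply IZR_lt; reflexivity)). lra. }
  assert (H28 : 0 < / IZR (2 ^ 28)) by (apply Rinv_0_lt_compat, IZR_lt; reflexivity).
  apply (run_sound T G M H err (tabq ^ Pos.to_nat k + / IZR (2 ^ 28)) (omega k (firstn M tab)) HT HH Hom)
    with (cnt := cnt) (a := Z.of_nat a) (la := la) (q := tabq ^ (8 * a) + / IZR (2 ^ 28))
         (vs := vstart (Pos.of_nat (8 * a)) 1 (firstn M tab)); auto.
  - unfold omega. rewrite length_map. auto.
  - pose proof (Htq (Pos.to_nat k)); lra.
  - lia.
  - pose proof (Htq (8 * a)%nat). lra.
  - apply quality_le; lia.
  - split; [rewrite vstart_length; auto |]. rewrite <- INR_IZR_INZ. exact Hv.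
Qed.

(** Consecutive partial sums of the alternating series for [PI / 4 = 2 arctan (1 / 3) + arctan (1 /
    7)]. *)
Lemma PI_bounds : 3141 / 1000 <= PI <= 3142 / 1000.
Proof.
  pose proof (PI_2_3_7_ineq 3) as H.
  unfold tg_alt, PI_2_3_7_tg, Ratan_seq in H.
  simpl sum_f_R0 in H. simpl INR in H. simpl pow in H. lra.
Qed.

(** The table stops at 80, so each segment start is split as a product [x * y]. The spare [2 ^ 30]
    at scale [2 ^ 60] absorbs both table errors. *)
Lemma ln_lower (n x y : nat) (la : Z) :
  (1 <= x <= 80)%nat -> (1 <= y <= 80)%nat -> n = (x * y)%nat ->
  (la * 2 ^ 30 + 2 ^ 30 <= nth (x - 1) lns 0 + nth (y - 1) lns 0)%Z ->
  IZR la <= scale 30 * ln (INR n).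
Proof.
  intros Hx Hy -> Hla.
  assert (Hx1 : 1 <= INR x) by (apply one_le_INR; lia).
  assert (Hy1 : 1 <= INR y) by (apply one_le_INR; lia).
  rewrite mult_INR, ln_mult by lra.
  pose proof (ln_approx x Hx) as H1. pose proof (ln_approx y Hy) as H2.
  apply Rabs_le_between in H1. apply Rabs_le_between in H2.
  apply IZR_le in Hla. rewrite !plus_IZR, mult_IZR in Hla.
  assert (E60 : scale 60 = 1152921504606846976) by reflexivity.
  assert (E30 : scale 30 = 1073741824) by reflexivity.
  rewrite E60 in *. rewrite E30. change (IZR (2 ^ 30)) with 1073741824 in Hla.
  change (IZR (2 ^ 41)) with 2199023255552 in *. lra.
Qed.

(** * From one verified grid run to the bound on one segment *)

Section Segments.

Variable zeta : C -> C.
Hypothesis Hz : is_riemann_zeta zeta.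

(* In both lemmas [2 ^ - 30 * cst] dominates the sum of the truncation, interpolation and rounding
   errors. *)
Lemma segment_em (N H : nat) (k : positive) (a cnt : nat) (la cst : Z) (ke c2 : R) :
  (Pos.to_nat k * H = 8)%nat -> (2 <= a <= 2000)%nat -> (cnt * H <= 1600)%nat -> (0 < cnt)%nat -> (2 <= N <= 80)%nat ->
  IZR la <= scale 30 * ln (INR a) ->
  dispersion 0 N <= c2 ->
  ln (INR N) * ln (INR N) / INR a + 2 * ln (INR N) / (INR a * INR a) + 2 / (INR a * INR a * INR a) <= ke ->
  (2 * INR N + 1) * err_q + (c2 + ke) / (8 * (INR H * INR H))
    + ((INR a + INR cnt) * (INR a + INR cnt) + 5 / 2) / (24 * (INR N * (INR N - 1))) <= IZR cst / scale 30 ->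
  seg_check (T_em N H) N H k a cnt la cst = true ->
  forall t, INR a <= t <= INR a + INR cnt -> Cmod (zeta (1, t)) <= 3 / 4 * ln t.
Proof.
  intros HkH Ha HJ Hcnt HN Hla Hc2 Hke Hcst Hrun t Ht.
  assert (HH : (1 <= H)%nat) by nia.
  assert (HHr : 1 <= INR H) by (apply one_le_INR; lia).
  assert (HNr : 2 <= INR N) by (apply two_le_INR; lia).
  assert (Har : 2 <= INR a) by (apply two_le_INR; lia).
  assert (Hl : 0 <= ln (INR N)).
  { rewrite <- ln_1. left; apply ln_increasing; lra. }
  assert (HD : forall t0, INR a <= t0 -> chord_err (em_approx N) t0 (/ INR H) ((c2 + ke) / (8 * (INR H * INR H)))).
  { intros t0 Ht0.
    eapply chord_err_weaken; [| apply chord_err_em_approx; [apply Rinv_0_lt_compat; lra | lra | lia]].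
    replace ((c2 + ke) / (8 * (INR H * INR H))) with ((c2 + ke) * (/ INR H * / INR H / 8)) by (field; lra).
    assert (0 < / INR H) by (apply Rinv_0_lt_compat; lra).
    apply Rmult_le_compat_r; [nra |].
    apply Rplus_le_compat; auto. eapply Rle_trans; [| exact Hke].
    assert (Ha2 : INR a * INR a <= t0 * t0) by nra.
    assert (Ha3 : INR a * INR a * INR a <= t0 * t0 * t0) by (apply Rmult_le_compat; nra).
    assert (Hp2 : 0 < INR a * INR a) by nra.
    assert (Hp3 : 0 < INR a * INR a * INR a) by (apply Rmult_lt_0_compat; lra).
    assert (Hl2 : 0 <= ln (INR N) * ln (INR N)) by nra.
    apply Rplus_le_compat; [apply Rplus_le_compat |]; apply Rmult_le_compat_l; try lra;
      apply Rinv_le_contravar; lra. }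
  pose proof (seg_sound (T_em N H) (em_approx N) N H k a cnt la cst _ _ HkH ltac:(lia) HJ ltac:(lia)
    (valid_T_em N H ltac:(lia) HH) HD Hla Hrun t Ht Hcnt) as HG.
  pose proof (zeta_euler_maclaurin zeta t N Hz ltac:(lra) ltac:(lia)) as HE.
  fold (em_approx N t) in HE.
  replace (zeta (1, t)) with (em_approx N t + - (em_approx N t - zeta (1, t)))%C by ring.
  eapply Rle_trans; [apply Cmod_triangle |]. rewrite Cmod_opp.
  assert ((t * t + 5 / 2) / (24 * (INR N * (INR N - 1)))
    <= ((INR a + INR cnt) * (INR a + INR cnt) + 5 / 2) / (24 * (INR N * (INR N - 1)))).
  { apply Rmult_le_compat_r; [left; apply Rinv_0_lt_compat; nra | nra]. }
  lra.
Qed.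

Lemma segment_tail (M H : nat) (k : positive) (w0 a cnt : nat) (la cst : Z) (K : nat) (phi tau c2 : R) :
  (Pos.to_nat k * H = 8)%nat -> (1 <= a <= 2000)%nat -> (cnt * H <= 1600)%nat -> (0 < cnt)%nat -> (M <= 80)%nat ->
  0 < phi < 6282 / 1000 -> 2 < INR a / phi - 1 ->
  6282 / 1000 * (INR K + 1) - phi < INR a -> 2 * (6284 / 1000 * INR K + phi) < INR a ->
  INR a + INR cnt <= (6282 / 1000 * (INR K + 1) - phi) * INR (S M) ->
  IZR la <= scale 30 * ln (INR a) ->
  dispersion (ln (INR w0)) M <= c2 ->
  tail_bound (6282 / 1000) (6284 / 1000) phi (INR a) K <= tau ->
  INR M * err_q + c2 / (8 * (INR H * INR H)) + tau <= IZR cst / scale 30 ->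
  seg_check T_sum M H k a cnt la cst = true ->
  forall t, INR a <= t <= INR a + INR cnt -> Cmod (zeta (1, t)) <= 3 / 4 * ln t.
Proof.
  intros HkH Ha HJ Hcnt HM Hphi Hend HK1 HK2 HM2 Hla Hc2 Htau Hcst Hrun t Ht.
  assert (HH : (1 <= H)%nat) by nia.
  assert (HHr : 1 <= INR H) by (apply one_le_INR; lia).
  assert (Har : 1 <= INR a) by (apply one_le_INR; lia).
  set (W := ln (INR w0)) in *.
  assert (HD : forall t0, INR a <= t0 ->
     chord_err (fun t => cis (W * t) * csum (zterm t) 1 M)%C t0 (/ INR H) (c2 / (8 * (INR H * INR H)))).
  { intros t0 Ht0. assert (0 < / INR H) by (apply Rinv_0_lt_compat; lra).
    eapply chord_err_weaken; [| apply chord_err_csum_zterm; auto].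
    replace (c2 / (8 * (INR H * INR H))) with (c2 * (/ INR H * / INR H / 8)) by (field; lra).
    apply Rmult_le_compat_r; [nra | auto]. }
  pose proof (seg_sound T_sum _ M H k a cnt la cst _ _ HkH Ha HJ HM (valid_T_sum W M H) HD Hla Hrun t Ht Hcnt) as HG.
  cbv beta in HG. rewrite Cmod_cis_mul in HG.
  pose proof PI_bounds as Hpi.
  assert (Hend' : 2 < t / phi - 1).
  { assert (INR a / phi <= t / phi) by (apply Rmult_le_compat_r; [left; apply Rinv_0_lt_compat; lra | lra]). lra. }
  (* [phase t (S M) <= t / (M + 1)], and the hypothesis relating [a + cnt] to [S M] makes this small
     enough at the right end. Thus one [M] serves the whole segment; [6282 / 1000] and [6284 / 1000]
     enclose [2 pi]. *)
  assert (Hu : phase t (S M) <= 6282 / 1000 * (INR K + 1) - phi).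
  { eapply Rle_trans; [apply phase_le; [lra | lia] |].
    pose proof (lt_0_INR (S M) ltac:(lia)).
    apply Rmult_le_reg_r with (INR (S M)); auto. unfold Rdiv. rewrite Rmult_assoc, Rinv_l by lra. lra. }
  pose proof (zeta_tail_le zeta (6282 / 1000) (6284 / 1000) phi t K (S M) Hz ltac:(lra) ltac:(lra) ltac:(lra)
    Hend' ltac:(lra) ltac:(lra) ltac:(lia) Hu) as HE.
  replace (S M - 1)%nat with M in HE by lia.
  pose proof (tail_bound_decr (6282 / 1000) (6284 / 1000) phi (INR a) t K ltac:(lra) ltac:(lra) ltac:(lra)
    Hend ltac:(lra) ltac:(lra) ltac:(lra)) as HT.
  replace (zeta (1, t)) with (csum (zterm t) 1 M + - (csum (zterm t) 1 M - zeta (1, t)))%C by ring.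
  eapply Rle_trans; [apply Cmod_triangle |]. rewrite Cmod_opp. lra.
Qed.

End Segments.

Ltac num := rewrite !INR_IZR_INZ; simpl Z.of_nat; lra.
Ltac num_err := change err_q with (/ 32768); change (scale 30) with 1073741824; num.
Ltac num_tail := rewrite INR_IZR_INZ; simpl Z.of_nat;
  unfold tail_bound, kl_bound, near_bound, end_bound; simpl INR; lra.

(** * The range 3 <= t <= 2000 *)

(* The parameters were found by a numerical search minimising the work [M * H * cnt]; [la] is just
   below [2 ^ 30 * ln a]. *)
Lemma zeta_le_42_50 (zeta : C -> C) (t : R) :
  is_riemann_zeta zeta -> 42 <= t <= 50 -> Cmod (zeta (1, t)) <= 3 / 4 * ln t.
Proof.
  intros Hz Ht.
  apply (segment_tail zeta Hz 11 4 2 3 42 8 4013292173 518323439 0 (185 / 100) (466 / 1000) (2098 / 1000));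
    [reflexivity | lia | lia | lia | lia | lra | num | num | num | num | | | num_tail | num_err | | num].
  - apply (ln_lower 42 6 7); [lia | lia | reflexivity | vm_compute; discriminate].
  - apply dispersion_le; [lia | lia | vm_compute; discriminate].
  - vm_compute; reflexivity.
Qed.

Lemma zeta_le_50_90 (zeta : C -> C) (t : R) :
  is_riemann_zeta zeta -> 50 <= t <= 90 -> Cmod (zeta (1, t)) <= 3 / 4 * ln t.
Proof.
  intros Hz Ht.
  apply (segment_tail zeta Hz 19 2 4 3 50 40 4200502697 556384651 0 (175 / 100) (409 / 1000) (3475 / 1000));
    [reflexivity | lia | lia | lia | lia | lra | num | num | num | num | | | num_tail | num_err | | num].
  - apply (ln_lower 50 5 10); [lia | lia | reflexivity | vm_compute; discriminate].
  - apply dispersion_le; [lia | lia | vm_compute; discriminate].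
  - vm_compute; reflexivity.
Qed.

Lemma zeta_le_90_180 (zeta : C -> C) (t : R) :
  is_riemann_zeta zeta -> 90 <= t <= 180 -> Cmod (zeta (1, t)) <= 3 / 4 * ln t.
Proof.
  intros Hz Ht.
  apply (segment_tail zeta Hz 37 2 4 5 90 90 4831633823 484832446 0 (145 / 100) (268 / 1000) (5837 / 1000));
    [reflexivity | lia | lia | lia | lia | lra | num | num | num | num | | | num_tail | num_err | | num].
  - apply (ln_lower 90 9 10); [lia | lia | reflexivity | vm_compute; discriminate].
  - apply dispersion_le; [lia | lia | vm_compute; discriminate].
  - vm_compute; reflexivity.
Qed.

Lemma zeta_le_180_320 (zeta : C -> C) (t : R) :
  is_riemann_zeta zeta -> 180 <= t <= 320 -> Cmod (zeta (1, t)) <= 3 / 4 * ln t.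
Proof.
  intros Hz Ht.
  apply (segment_tail zeta Hz 27 2 4 4 180 140 5575894941 1161700313 1 (90 / 100) (938 / 1000) (4579 / 1000));
    [reflexivity | lia | lia | lia | lia | lra | num | num | num | num | | | num_tail | num_err | | num].
  - apply (ln_lower 180 12 15); [lia | lia | reflexivity | vm_compute; discriminate].
  - apply dispersion_le; [lia | lia | vm_compute; discriminate].
  - vm_compute; reflexivity.
Qed.

Lemma zeta_le_320_500 (zeta : C -> C) (t : R) :
  is_riemann_zeta zeta -> 320 <= t <= 500 -> Cmod (zeta (1, t)) <= 3 / 4 * ln t.
Proof.
  intros Hz Ht.
  apply (segment_tail zeta Hz 27 2 4 4 320 180 6193687487 1444094412 2 (80 / 100) (1201 / 1000) (4579 / 1000));
    [reflexivity | lia | lia | lia | lia | lra | num | num | num | num | | | num_tail | num_err | | num].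
  - apply (ln_lower 320 16 20); [lia | lia | reflexivity | vm_compute; discriminate].
  - apply dispersion_le; [lia | lia | vm_compute; discriminate].
  - vm_compute; reflexivity.
Qed.

Lemma zeta_le_500_700 (zeta : C -> C) (t : R) :
  is_riemann_zeta zeta -> 500 <= t <= 700 -> Cmod (zeta (1, t)) <= 3 / 4 * ln t.
Proof.
  intros Hz Ht.
  apply (segment_tail zeta Hz 28 2 4 4 500 200 6672884615 1620455720 3 (80 / 100) (1361 / 1000) (4714 / 1000));
    [reflexivity | lia | lia | lia | lia | lra | num | num | num | num | | | num_tail | num_err | | num].
  - apply (ln_lower 500 20 25); [lia | lia | reflexivity | vm_compute; discriminate].
  - apply dispersion_le; [lia | lia | vm_compute; discriminate].
  - vm_compute; reflexivity.
Qed.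

Lemma zeta_le_700_900 (zeta : C -> C) (t : R) :
  is_riemann_zeta zeta -> 700 <= t <= 900 -> Cmod (zeta (1, t)) <= 3 / 4 * ln t.
Proof.
  intros Hz Ht.
  apply (segment_tail zeta Hz 36 1 8 5 700 200 7034168928 1957537253 3 (70 / 100) (1106 / 1000) (5728 / 1000));
    [reflexivity | lia | lia | lia | lia | lra | num | num | num | num | | | num_tail | num_err | | num].
  - apply (ln_lower 700 20 35); [lia | lia | reflexivity | vm_compute; discriminate].
  - apply dispersion_le; [lia | lia | vm_compute; discriminate].
  - vm_compute; reflexivity.
Qed.

Lemma zeta_le_900_1260 (zeta : C -> C) (t : R) :
  is_riemann_zeta zeta -> 900 <= t <= 1260 -> Cmod (zeta (1, t)) <= 3 / 4 * ln t.
Proof.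
  intros Hz Ht.
  apply (segment_tail zeta Hz 41 1 8 5 900 360 7304015740 2222512670 4 (70 / 100) (1285 / 1000) (6269 / 1000));
    [reflexivity | lia | lia | lia | lia | lra | num | num | num | num | | | num_tail | num_err | | num].
  - apply (ln_lower 900 30 30); [lia | lia | reflexivity | vm_compute; discriminate].
  - apply dispersion_le; [lia | lia | vm_compute; discriminate].
  - vm_compute; reflexivity.
Qed.

Lemma zeta_le_1260_1440 (zeta : C -> C) (t : R) :
  is_riemann_zeta zeta -> 1260 <= t <= 1440 -> Cmod (zeta (1, t)) <= 3 / 4 * ln t.
Proof.
  intros Hz Ht.
  apply (segment_tail zeta Hz 38 1 8 5 1260 180 7665300053 2235836139 5 (70 / 100) (1338 / 1000) (5945 / 1000));
    [reflexivity | lia | lia | lia | lia | lra | num | num | num | num | | | num_tail | num_err | | num].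
  - apply (ln_lower 1260 30 42); [lia | lia | reflexivity | vm_compute; discriminate].
  - apply dispersion_le; [lia | lia | vm_compute; discriminate].
  - vm_compute; reflexivity.
Qed.

Lemma zeta_le_1440_1680 (zeta : C -> C) (t : R) :
  is_riemann_zeta zeta -> 1440 <= t <= 1680 -> Cmod (zeta (1, t)) <= 3 / 4 * ln t.
Proof.
  intros Hz Ht.
  apply (segment_tail zeta Hz 33 2 4 4 1440 240 7808678294 2124338694 7 (80 / 100) (1809 / 1000) (5390 / 1000));
    [reflexivity | lia | lia | lia | lia | lra | num | num | num | num | | | num_tail | num_err | | num].
  - apply (ln_lower 1440 36 40); [lia | lia | reflexivity | vm_compute; discriminate].
  - apply dispersion_le; [lia | lia | vm_compute; discriminate].
  - vm_compute; reflexivity.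
Qed.

Lemma zeta_le_1680_2000 (zeta : C -> C) (t : R) :
  is_riemann_zeta zeta -> 1680 <= t <= 2000 -> Cmod (zeta (1, t)) <= 3 / 4 * ln t.
Proof.
  intros Hz Ht.
  apply (segment_tail zeta Hz 46 1 8 5 1680 320 7974196327 2396891121 6 (65 / 100) (1380 / 1000) (6807 / 1000));
    [reflexivity | lia | lia | lia | lia | lra | num | num | num | num | | | num_tail | num_err | | num].
  - apply (ln_lower 1680 40 42); [lia | lia | reflexivity | vm_compute; discriminate].
  - apply dispersion_le; [lia | lia | vm_compute; discriminate].
  - vm_compute; reflexivity.
Qed.

(** For these small [t] the Euler-Maclaurin approximation itself is evaluated. Taking [N = 12], the
    right end of the range, keeps the truncation error below [1 / 20]. *)
Lemma zeta_le_3_12 (zeta : C -> C) (t : R) :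
  is_riemann_zeta zeta -> 3 <= t <= 12 -> Cmod (zeta (1, t)) <= 3 / 4 * ln t.
Proof.
  intros Hz Ht.
  apply (segment_em zeta Hz 12 4 2 3 9 1179625942 117984499 (2686 / 1000) (5362 / 1000));
    [reflexivity | lia | lia | lia | lia | | | | num_err | | num].
  - apply (ln_lower 3 1 3); [lia | lia | reflexivity | vm_compute; discriminate].
  - replace 0 with (ln (INR 1)) by (simpl; apply ln_1).
    apply dispersion_le; [lia | lia | vm_compute; discriminate].
  (* The table value of [ln 12] yields the bound [ke] on the second derivative of the term carrying
     [1 / t]. *)
  - pose proof (ln_approx 12 ltac:(lia)) as Hl. apply Rabs_le_between in Hl.
    match type of Hl with context [IZR ?z / scale 60] => let y := eval vm_compute in z in change z with y in Hl end.
    change (scale 60) with 1152921504606846976 in Hl. change (IZR (2 ^ 41)) with 2199023255552 in Hl.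
    rewrite (INR_IZR_INZ 3); simpl Z.of_nat.
    set (l := ln (INR 12)) in *. clearbody l. nra.
  - vm_compute; reflexivity.
Qed.

Lemma zeta_le_12_42 (zeta : C -> C) (t : R) :
  is_riemann_zeta zeta -> 12 <= t <= 42 -> Cmod (zeta (1, t)) <= 3 / 4 * ln t.
Proof.
  intros Hz Ht.
  apply (segment_em zeta Hz 40 4 2 12 30 2668148178 204990087 (1188 / 1000) (16893 / 1000));
    [reflexivity | lia | lia | lia | lia | | | | num_err | | num].
  - apply (ln_lower 12 3 4); [lia | lia | reflexivity | vm_compute; discriminate].
  - replace 0 with (ln (INR 1)) by (simpl; apply ln_1).
    apply dispersion_le; [lia | lia | vm_compute; discriminate].
  - pose proof (ln_approx 40 ltac:(lia)) as Hl. apply Rabs_le_between in Hl.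
    match type of Hl with context [IZR ?z / scale 60] => let y := eval vm_compute in z in change z with y in Hl end.
    change (scale 60) with 1152921504606846976 in Hl. change (IZR (2 ^ 41)) with 2199023255552 in Hl.
    rewrite (INR_IZR_INZ 12); simpl Z.of_nat.
    set (l := ln (INR 40)) in *. clearbody l. nra.
  - vm_compute; reflexivity.
Qed.

(** * Large t *)

Ltac ln_num n H :=
  pose proof (ln_approx n ltac:(lia)) as H; apply Rabs_le_between in H;
  match type of H with context [IZR ?z / scale 60] =>
    let y := eval vm_compute in z in change z with y in H end;
  change (scale 60) with 1152921504606846976 in H; change (IZR (2 ^ 41)) with 2199023255552 in H;
  rewrite (INR_IZR_INZ n) in H; simpl Z.of_nat in H.

Lemma ln_le (x y : R) : 0 < x -> x <= y -> ln x <= ln y.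
Proof.
  intros Hx Hxy. destruct (Req_dec x y) as [-> | E]; [lra |]. left; apply ln_increasing; lra.
Qed.

(** Induction from [M = 3], where [11 / 6 - ln (7 / 2)] is just below [581 / 1000]. The step is [1 /
    (M + 1) <= ln ((M + 3 / 2) / (M + 1 / 2))], the first term of the artanh series at
    [1 / (2 (M + 1))]. The shift by one half brings the constant close to Euler's. *)
Lemma harmonic_le (M : nat) :
  (3 <= M)%nat -> rsum (fun n => / INR n) 1 M <= ln (INR M + / 2) + 581 / 1000.
Proof.
  intros HM. induction HM as [| M HM IH].
  - ln_num 7%nat H7. ln_num 2%nat H2. simpl rsum. simpl INR.
    replace (1 + 1 + 1 + / 2) with (7 / 2) by field. rewrite ln_div by lra. lra.
  - rewrite rsum_S. assert (HM3 : 3 <= INR M) by (replace 3 with (INR 3) by (simpl; ring); apply le_INR; auto).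
    replace (1 + M)%nat with (S M) by lia. rewrite S_INR.
    set (x := INR M) in *. clearbody x.
    set (y := / (2 * (x + 1))).
    assert (Hy : 0 < y < 1).
    { unfold y. split; [apply Rinv_0_lt_compat; lra |]. rewrite <- Rinv_1. apply Rinv_lt_contravar; lra. }
    pose proof (artanh_series_bounds 1 y ltac:(lra)) as Hs.
    replace ((1 + y) / (1 - y)) with ((x + 1 + / 2) / (x + / 2)) in Hs
      by (unfold y; field; repeat split; lra).
    rewrite ln_div in Hs by lra. simpl in Hs.
    replace (/ (x + 1)) with (2 * (y * 1) / 1) by (unfold y; field; lra). lra.
Qed.

(* Summing the first [t / X] terms trivially and the rest with [zeta_tail_le]. *)
Lemma zeta_le_tail_bound (zeta : C -> C) (p P phi t : R) (K : nat) :
  is_riemann_zeta zeta -> 0 < phi -> phi < p -> p <= 2 * PI <= P -> 2 < t / phi - 1 ->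
  3 * (p * (INR K + 1) - phi) < t -> 2 * (P * INR K + phi) < t ->
  Cmod (zeta (1, t)) <= ln t - ln (p * (INR K + 1) - phi) + (p * (INR K + 1) - phi) / (2 * t) + 581 / 1000
     + tail_bound p P phi t K.
Proof.
  intros Hz Hphi Hpp HpP Hend HK1 HK2.
  pose proof (pos_INR K) as HK0.
  set (X := p * (INR K + 1) - phi) in *.
  assert (HX : 0 < X) by (unfold X; nra).
  assert (Ht : 0 < t) by lra.
  assert (HtX : 3 < t / X).
  { apply Rmult_lt_reg_r with X; auto. unfold Rdiv. rewrite Rmult_assoc, Rinv_l; lra. }
  assert (Hm : exists M : nat, INR M <= t / X < INR M + 1).
  { destruct (nfloor_ex (t / X) ltac:(lra)) as [M HM]. exists M. lra. }
  destruct Hm as [M HM].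
  assert (HM3 : (3 <= M)%nat).
  { assert (H : (2 < M)%nat) by (apply INR_lt; simpl; lra). lia. }
  pose proof (harmonic_le M HM3) as HH.
  assert (Hu : phase t (S M) <= X).
  { eapply Rle_trans; [apply phase_le; auto; lia |]. rewrite S_INR.
    apply Rmult_le_reg_r with (INR M + 1); [lra |].
    unfold Rdiv. rewrite Rmult_assoc, Rinv_l by lra.
    assert (t / X * X = t) by (field; lra). nra. }
  pose proof (zeta_tail_le zeta p P phi t K (S M) Hz Hphi Hpp HpP Hend ltac:(fold X; lra) HK2 ltac:(lia) Hu) as HE.
  replace (S M - 1)%nat with M in HE by lia.
  assert (HF : Cmod (csum (zterm t) 1 M) <= rsum (fun n => / INR n) 1 M).
  { apply csum_le. intros n Hn. rewrite Cmod_zterm by lia. lra. }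
  replace (zeta (1, t)) with (csum (zterm t) 1 M + - (csum (zterm t) 1 M - zeta (1, t)))%C by ring.
  eapply Rle_trans; [apply Cmod_triangle |]. rewrite Cmod_opp.
  assert (Hln : ln (INR M + / 2) <= ln t - ln X + X / (2 * t)).
  { eapply Rle_trans; [apply (ln_le _ (t / X * (1 + X / (2 * t)))) |].
    - pose proof (pos_INR M); lra.
    - replace (t / X * (1 + X / (2 * t))) with (t / X + / 2) by (field; lra). lra.
    - assert (0 < X / (2 * t)) by (apply Rdiv_lt_0_compat; lra).
      rewrite ln_mult, ln_div by (try apply Rdiv_lt_0_compat; lra).
      pose proof (ln_1p_le (X / (2 * t)) ltac:(lra)). lra. }
  lra.
Qed.

(** With [K = 4] and [phi = 1 / 2] the cut-off parameter is [X = 3091 / 100], and [ln X] minus the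
    harmonic constant and the shift exceeds [283 / 100]. What remains to be absorbed is
    [ln t / 4 + tau]. *)
Lemma zeta_le_range (zeta : C -> C) (a b tau lb t : R) :
  is_riemann_zeta zeta -> 2000 <= a -> a <= t <= b ->
  tail_bound (6282 / 1000) (6284 / 1000) (1 / 2) a 4 <= tau ->
  ln b <= lb -> lb / 4 + tau <= 283 / 100 ->
  Cmod (zeta (1, t)) <= 3 / 4 * ln t.
Proof.
  intros Hz Ha Ht Htau Hlb Hsum.
  pose proof PI_bounds as Hpi.
  pose proof (zeta_le_tail_bound zeta (6282 / 1000) (6284 / 1000) (1 / 2) t 4 Hz ltac:(lra) ltac:(lra) ltac:(lra)
    ltac:(lra) ltac:(simpl; lra) ltac:(simpl; lra)) as H.
  pose proof (tail_bound_decr (6282 / 1000) (6284 / 1000) (1 / 2) a t 4 ltac:(lra) ltac:(lra) ltac:(lra)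
    ltac:(lra) ltac:(simpl; lra) ltac:(simpl; lra) ltac:(lra)) as HT.
  assert (Hlt : ln t <= ln b) by (apply ln_le; lra).
  assert (HX : 6282 / 1000 * (INR 4 + 1) - 1 / 2 = 3091 / 100) by (simpl; field).
  rewrite HX in H.
  assert (HlX : 343 / 100 <= ln (3091 / 100)).
  { ln_num 34%nat H34. ln_num 10%nat H10. ln_num 11%nat H11.
    apply Rle_trans with (ln (34 / 11 * 10)); [| apply ln_le; lra].
    rewrite ln_mult, ln_div by lra. lra. }
  assert (Hsm : 3091 / 100 / (2 * t) <= 1 / 100).
  { apply Rmult_le_reg_r with (2 * t); [lra |]. unfold Rdiv at 1. rewrite Rmult_assoc, Rinv_l by lra. lra. }
  lra.
Qed.

Lemma zeta_le_2000_6561 (zeta : C -> C) (t : R) :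
  is_riemann_zeta zeta -> 2000 <= t <= 6561 -> Cmod (zeta (1, t)) <= 3 / 4 * ln t.
Proof.
  intros Hz Ht.
  ln_num 50%nat H50. ln_num 40%nat H40. ln_num 10%nat H10. ln_num 3%nat H3.
  destruct (Rle_dec t 2500) as [H1 | H1]; [| destruct (Rle_dec t 4000) as [H2 | H2]].
  - apply (zeta_le_range zeta 2000 2500 (82 / 100) (783 / 100)); auto; try lra.
    + unfold tail_bound, kl_bound, near_bound, end_bound. simpl INR. lra.
    + replace 2500 with (50 * 50) by ring. rewrite ln_mult by lra. lra.
  - apply (zeta_le_range zeta 2500 4000 (74 / 100) (83 / 10)); auto; try lra.
    + unfold tail_bound, kl_bound, near_bound, end_bound. simpl INR. lra.
    + replace 4000 with (10 * 10 * 40) by ring. rewrite !ln_mult by lra. lra.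
  - apply (zeta_le_range zeta 4000 6561 (6 / 10) (88 / 10)); auto; try lra.
    + unfold tail_bound, kl_bound, near_bound, end_bound. simpl INR. lra.
    + replace 6561 with (3 ^ 8) by ring. rewrite ln_pow by lra. simpl INR. lra.
Qed.

(* With [t = q ^ 4] and about [7 q / 10] stationary blocks, the terms summed trivially contribute
   [3 / 4 * ln t] minus a constant, and the blocks less than that constant. *)
Section Large.

Variables (q : R) (K : nat).
Hypothesis Hq : 9 <= q.
Hypothesis HK : INR K <= 7 / 10 * q < INR K + 1.

Let t := q ^ 4.
(** Of order [1 / q], so that the near blocks cost [O (ln K / q)] and the Kuzmin-Landau blocks,
    growing with [1 / phi], cost [O (1 / q)]. *)
Let phi := 7 / (2 * q).

Lemma large_powers : 729 * q <= t /\ 0 < / q <= / 9 /\ / t = / q * / q * / q * / q /\ 0 < t.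
Proof.
  unfold t. assert (81 <= q * q) by nra. assert (729 <= q * q * q) by nra.
  repeat split.
  - simpl. nra.
  - apply Rinv_0_lt_compat; lra.
  - apply Rinv_le_contravar; lra.
  - simpl. field; lra.
  - apply pow_lt; lra.
Qed.

Lemma phi_bounds : phi = 7 / 2 * / q /\ 0 < phi <= 389 / 1000.
Proof.
  destruct large_powers as (_ & Hi & _).
  assert (E : phi = 7 / 2 * / q) by (unfold phi; field; lra).
  rewrite E. split; [auto |]. split; [nra | lra].
Qed.

(** Here [4 / phi = 8 q / 7], [X <= 6284 / 1000 * (j + 1)] and [X <= t / 100]; the product of the
    constants is just below [726 / 100]. *)
Lemma kl_bound_large (j : nat) :
  (j <= K)%nat -> kl_bound (2 * PI) phi t j <= 726 / 100 * (/ q * / q * / q) * (INR j + 1).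
Proof.
  intros Hj. apply le_INR in Hj. pose proof (pos_INR j) as Hj0. pose proof PI_bounds as Hpi.
  destruct large_powers as (Hp & Hi & Ht & Ht0). destruct phi_bounds as (Ephi & Hphi).
  unfold kl_bound. set (X := 2 * PI * (INR j + 1) - phi).
  assert (HX : 0 < X <= 6284 / 1000 * (INR j + 1)) by (unfold X; nra).
  assert (HXt : X <= / 100 * t) by lra.
  assert (H1 : X / (t - X) <= X * (100 / 99 * / t)).
  { apply Rmult_le_compat_l; [lra |].
    replace (100 / 99 * / t) with (/ (99 / 100 * t)) by (field; lra). apply Rinv_le_contravar; lra. }
  assert (H2 : 4 / phi = 8 / 7 * q) by (unfold phi; field; lra).
  rewrite H2.
  apply Rle_trans with (8 / 7 * q * (X * (100 / 99 * / t))).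
  { apply Rmult_le_compat_l; lra. }
  rewrite Ht.
  replace (8 / 7 * q * (X * (100 / 99 * (/ q * / q * / q * / q))))
    with (800 / 693 * (/ q * / q * / q) * X) by (field; lra).
  set (c := / q * / q * / q). assert (0 < c) by (unfold c; repeat apply Rmult_lt_0_compat; lra).
  apply Rle_trans with (800 / 693 * c * (6284 / 1000 * (INR j + 1))).
  - apply Rmult_le_compat_l; lra.
  - nra.
Qed.

(** Both ratios are written as [1 +] a small term: [2 phi / (2 pi j - phi)] gives the part in
    [1 / (q j)], and [2 Y / (t - 2 Y)] the part in [j / t]. The cross term goes into the second
    coefficient. *)
Lemma near_bound_large (j : nat) :
  (1 <= j <= K)%nat ->
  near_bound (2 * PI) (2 * PI) phi t j
    <= 119 / 100 * / q * / INR j + 155 / 10 * (/ q * / q * / q * / q) * INR j.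
Proof.
  intros [Hj1 Hj]. apply le_INR in Hj1, Hj. simpl in Hj1. pose proof PI_bounds as Hpi.
  destruct large_powers as (Hp & Hi & Ht & Ht0). destruct phi_bounds as (Ephi & Hphi).
  unfold near_bound. rewrite <- Ht.
  set (Y := 2 * PI * INR j + phi).
  assert (HY : 0 < Y <= 6673 / 1000 * INR j) by (unfold Y; nra).
  assert (Hx : 5893 / 1000 * INR j <= 2 * PI * INR j - phi) by nra.
  assert (HYt : 2 * Y <= 2 / 100 * t) by lra.
  assert (Hij : 0 < / INR j <= 1).
  { split; [apply Rinv_0_lt_compat; lra |]. rewrite <- Rinv_1. apply Rinv_le_contravar; lra. }
  assert (Hr : Y / (2 * PI * INR j - phi) <= 1 + 119 / 100 * / q * / INR j).
  { apply Rle_trans with (1 + 2 * phi * (1000 / 5893 * / INR j)).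
    - replace (Y / (2 * PI * INR j - phi)) with (1 + 2 * phi * / (2 * PI * INR j - phi)) by (unfold Y; field; lra).
      apply Rplus_le_compat_l. apply Rmult_le_compat_l; [lra |].
      replace (1000 / 5893 * / INR j) with (/ (5893 / 1000 * INR j)) by (field; lra).
      apply Rinv_le_contravar; lra.
    - rewrite Ephi. apply Rplus_le_compat_l.
      assert (0 < / q * / INR j) by (apply Rmult_lt_0_compat; lra). nra. }
  assert (Hs : t / (t - 2 * Y) <= 1 + 1362 / 100 * / t * INR j).
  { replace (t / (t - 2 * Y)) with (1 + 2 * Y * / (t - 2 * Y)) by (field; lra).
    apply Rplus_le_compat_l.
    apply Rle_trans with (2 * (6673 / 1000 * INR j) * (100 / 98 * / t)).
    - apply Rmult_le_compat; [lra | left; apply Rinv_0_lt_compat; lra | lra |].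
      replace (100 / 98 * / t) with (/ (98 / 100 * t)) by (field; lra). apply Rinv_le_contravar; lra.
    - assert (0 < / t * INR j) by (apply Rmult_lt_0_compat; [apply Rinv_0_lt_compat |]; lra). nra. }
  assert (H0 : 0 < / t * INR j) by (apply Rmult_lt_0_compat; [apply Rinv_0_lt_compat |]; lra).
  assert (Hr0 : 0 < 119 / 100 * / q * / INR j <= 133 / 1000).
  { split; [repeat apply Rmult_lt_0_compat; lra |].
    assert (/ q * / INR j <= / 9 * 1) by (apply Rmult_le_compat; lra). lra. }
  apply Rle_trans with ((1 + 119 / 100 * / q * / INR j) * (1 + 1362 / 100 * / t * INR j) - 1).
  - apply Rplus_le_compat_r. apply Rmult_le_compat; try lra.
    + left; apply Rdiv_lt_0_compat; lra.
    + left; apply Rdiv_lt_0_compat; lra.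
  - set (r := 119 / 100 * / q * / INR j) in *. clearbody r. nra.
Qed.

(** The Euler-Maclaurin remainder is essentially [phi ^ 2 / 24], since its cut-off is about
    [t / phi]; the other two terms are negligible. *)
Lemma end_bound_large : end_bound phi t <= 7 / 1000.
Proof.
  destruct large_powers as (Hp & Hi & Ht & Ht0). destruct phi_bounds as (Ephi & Hphi).
  unfold end_bound.
  set (y := t / phi).
  assert (Hyt : y * phi = t) by (unfold y; field; lra).
  assert (Hy : 16000 <= y).
  { assert (6561 <= t) by lra. nra. }
  assert (H1 : / t <= / 6561) by (apply Rinv_le_contravar; lra).
  assert (H2 : / (2 * (y - 1)) <= / 30000) by (apply Rinv_le_contravar; lra).
  assert (H3 : (t * t + 5 / 2) / (24 * ((y - 1) * (y - 2))) <= 65 / 10000).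
  { apply Rmult_le_reg_r with (24 * ((y - 1) * (y - 2))); [nra |].
    unfold Rdiv at 1. rewrite Rmult_assoc, Rinv_l by nra.
    rewrite <- Hyt.
    assert (y * phi * (y * phi) <= 1514 / 10000 * (y * y)).
    { replace (y * phi * (y * phi)) with (phi * phi * (y * y)) by ring.
      apply Rmult_le_compat_r; nra. }
    nra. }
  lra.
Qed.

Lemma tail_bound_large (k : nat) :
  (k <= K)%nat ->
  tail_bound (2 * PI) (2 * PI) phi t k
    <= end_bound phi t + 726 / 100 * (/ q * / q * / q) * ((INR k + 1) * (INR k + 2) / 2)
       + 119 / 100 * / q * rsum (fun n => / INR n) 1 k
       + 155 / 10 * (/ q * / q * / q * / q) * (INR k * (INR k + 1) / 2).
Proof.
  induction k as [| k IH]; intros Hk.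
  - cbn [tail_bound rsum]. pose proof (kl_bound_large 0 Hk) as H. simpl INR in *. lra.
  - specialize (IH ltac:(lia)).
    pose proof (kl_bound_large (S k) Hk) as H1. pose proof (near_bound_large (S k) ltac:(lia)) as H2.
    rewrite rsum_S. replace (1 + k)%nat with (S k) by lia.
    change (tail_bound (2 * PI) (2 * PI) phi t (S k)) with
      (tail_bound (2 * PI) (2 * PI) phi t k + kl_bound (2 * PI) phi t (S k) + near_bound (2 * PI) (2 * PI) phi t (S k)).
    rewrite S_INR in *. lra.
Qed.

Lemma zeta_le_large (zeta : C -> C) :
  is_riemann_zeta zeta -> Cmod (zeta (1, t)) <= 3 / 4 * ln t.
Proof.
  intros Hz. pose proof PI_bounds as Hpi.
  destruct large_powers as (Hp & Hi & Ht & Ht0). destruct phi_bounds as (Ephi & Hphi).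
  pose proof (pos_INR K) as HK0.
  assert (HK6 : (6 <= K)%nat).
  { assert (H : (5 < K)%nat) by (apply INR_lt; simpl; lra). lia. }
  set (X := 2 * PI * (INR K + 1) - phi).
  assert (HX : 4354 / 1000 * q <= X <= 6284 / 1000 * (INR K + 1)) by (unfold X; nra).
  assert (HXt : X <= / 100 * t) by lra.
  assert (Hend : 2 < t / phi - 1).
  { assert (t / phi * phi = t) by (field; lra). assert (6561 <= t) by lra. nra. }
  pose proof (zeta_le_tail_bound zeta (2 * PI) (2 * PI) phi t K Hz ltac:(lra) ltac:(lra) ltac:(lra) Hend
    ltac:(fold X; lra) ltac:(nra)) as H.
  fold X in H.
  pose proof (tail_bound_large K (le_n K)) as HT.
  pose proof end_bound_large as HE.
  pose proof (harmonic_le K ltac:(lia)) as HH.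
  ln_num 34%nat H34. ln_num 5%nat H5. ln_num 13%nat H13. ln_num 3%nat H3.
  assert (Hlt : ln t = 4 * ln q) by (unfold t; rewrite ln_pow by lra; simpl INR; ring).
  (* This gains one of the four [ln q] in [ln t], leaving [3 ln q = 3 / 4 * ln t]; the constant
     [13 / 3] is the saving that pays for all error terms. *)
  assert (HlX : ln q + ln (13 / 3) <= ln X).
  { rewrite <- ln_mult by lra. apply ln_le; nra. }
  assert (Hl13 : 1466 / 1000 <= ln (13 / 3)) by (rewrite ln_div by lra; lra).
  assert (HX2 : X / (2 * t) <= 5 / 1000).
  { apply Rmult_le_reg_r with (2 * t); [lra |]. unfold Rdiv at 1. rewrite Rmult_assoc, Rinv_l by lra. lra. }
  (* Tangent to the logarithm at [34 / 5], the value of [7 / 10 * q + 1 / 2] at the extreme case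
     [q = 9]. A bound linear in [q] becomes bounded after multiplication by [1 / q]. *)
  assert (HlK : ln (INR K + / 2) <= 991 / 1000 + 103 / 1000 * q).
  { apply Rle_trans with (ln (34 / 5 * ((7 / 10 * q + / 2) / (34 / 5)))).
    - apply ln_le; [lra |]. field_simplify (34 / 5 * ((7 / 10 * q + / 2) / (34 / 5))). lra.
    - rewrite ln_mult by lra.
      pose proof (ln_le_sub_1 ((7 / 10 * q + / 2) / (34 / 5)) ltac:(lra)).
      rewrite (ln_div 34 5) by lra. lra. }
  set (i := / q) in *.
  assert (Hqi : q * i = 1) by (unfold i; field; lra).
  assert (T1 : 726 / 100 * (i * i * i) * ((INR K + 1) * (INR K + 2) / 2) <= 302 / 1000).
  { assert ((INR K + 1) * (INR K + 2) <= (7 / 10 * q + 1) * (7 / 10 * q + 2)) by nra.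
    assert (0 < i * i * i) by (repeat apply Rmult_lt_0_compat; lra).
    apply Rle_trans with (726 / 100 * (i * i * i) * ((7 / 10 * q + 1) * (7 / 10 * q + 2) / 2)).
    - apply Rmult_le_compat_l; lra.
    - replace (726 / 100 * (i * i * i) * ((7 / 10 * q + 1) * (7 / 10 * q + 2) / 2))
        with (363 / 100 * i * ((7 / 10 * (q * i) + i) * (7 / 10 * (q * i) + 2 * i))) by field.
      rewrite Hqi.
      assert ((7 / 10 * 1 + i) * (7 / 10 * 1 + 2 * i) <= 748101 / 1000000) by nra.
      nra. }
  assert (T2 : 119 / 100 * i * rsum (fun n => / INR n) 1 K <= 331 / 1000).
  { apply Rle_trans with (119 / 100 * i * (1572 / 1000 + 103 / 1000 * q)).
    - apply Rmult_le_compat_l; lra.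
    - nra. }
  assert (T3 : 155 / 10 * (i * i * i * i) * (INR K * (INR K + 1) / 2) <= 55 / 1000).
  { assert (INR K * (INR K + 1) <= 7 / 10 * q * (7 / 10 * q + 1)) by nra.
    assert (0 < i * i * i * i) by (repeat apply Rmult_lt_0_compat; lra).
    apply Rle_trans with (155 / 10 * (i * i * i * i) * (7 / 10 * q * (7 / 10 * q + 1) / 2)).
    - apply Rmult_le_compat_l; lra.
    - replace (155 / 10 * (i * i * i * i) * (7 / 10 * q * (7 / 10 * q + 1) / 2))
        with (155 / 20 * (i * i) * (7 / 10 * (q * i) * (7 / 10 * (q * i) + i))) by field.
      rewrite Hqi.
      assert (i * i <= / 81) by nra. nra. }
  (* The costs [581 + 5 + 7 + 302 + 331 + 55], in thousandths, stay below the saving of 1466. *)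
  rewrite Hlt in *. lra.
Qed.

End Large.

Theorem theorem1 (zeta : C -> C) (Hzeta : is_riemann_zeta zeta)
    (t : R) (ht : 3 <= t) :
  Cmod (zeta (1 + Ci * RtoC t)%C) <= 3 / 4 * ln t.
Proof.
  replace (1 + Ci * RtoC t)%C with (1, t) by (apply injective_projections; simpl; ring).
  destruct (Rle_dec t 12); [apply zeta_le_3_12; auto |].
  destruct (Rle_dec t 42); [apply zeta_le_12_42; auto; lra |].
  destruct (Rle_dec t 50); [apply zeta_le_42_50; auto; lra |].
  destruct (Rle_dec t 90); [apply zeta_le_50_90; auto; lra |].
  destruct (Rle_dec t 180); [apply zeta_le_90_180; auto; lra |].
  destruct (Rle_dec t 320); [apply zeta_le_180_320; auto; lra |].
  destruct (Rle_dec t 500); [apply zeta_le_320_500; auto; lra |].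
  destruct (Rle_dec t 700); [apply zeta_le_500_700; auto; lra |].
  destruct (Rle_dec t 900); [apply zeta_le_700_900; auto; lra |].
  destruct (Rle_dec t 1260); [apply zeta_le_900_1260; auto; lra |].
  destruct (Rle_dec t 1440); [apply zeta_le_1260_1440; auto; lra |].
  destruct (Rle_dec t 1680); [apply zeta_le_1440_1680; auto; lra |].
  destruct (Rle_dec t 2000); [apply zeta_le_1680_2000; auto; lra |].
  destruct (Rle_dec t 6561); [apply zeta_le_2000_6561; auto; lra |].
  (* [6561 = 9 ^ 4], so [q >= 9] in the remaining range. *)
  set (q := sqrt (sqrt t)).
  assert (Hq : 9 <= q).
  { unfold q. rewrite <- (sqrt_square 9) by lra. apply sqrt_le_1_alt.
    rewrite <- (sqrt_square (9 * 9)) by lra. apply sqrt_le_1_alt. lra. }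
  assert (Et : t = q ^ 4).
  { replace (q ^ 4) with ((q * q) * (q * q)) by ring. unfold q.
    rewrite (sqrt_sqrt (sqrt t)) by apply sqrt_pos. rewrite sqrt_sqrt; lra. }
  destruct (nfloor_ex (7 / 10 * q) ltac:(lra)) as [K HK].
  rewrite Et. apply (zeta_le_large q K); auto.
Qed.
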